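(* Let $0<\zeta_3<\zeta_2<\zeta_1$, $b=4\zeta_1\zeta_2\zeta_3$, $c=2(\zeta_1^2+\zeta_2^2+\zeta_3^2)$, $\nu=\sqrt{\zeta_1^2-\zeta_3^2}$, $k=\sqrt{(\zeta_1^2-\zeta_2^2)/(\zeta_1^2-\zeta_3^2)}$, let $\alpha\in(0,K)$ be defined by $\mathrm{sn}(\alpha)=\sqrt{(\zeta_1-\zeta_3)/(\zeta_1+\zeta_2)}$, and let $\phi$ be the traveling periodic profile $$\phi(x)=\frac{2(\zeta_1+\zeta_3)(\zeta_2+\zeta_3)}{(\zeta_1+\zeta_3)-(\zeta_1-\zeta_2)\mathrm{sn}^2(\nu x)}-\zeta_1-\zeta_2-\zeta_3,$$ so that $u(x,t)=\phi(x+ct)$ solves the defocusing mKdV equation $u_t-6u^2u_x+u_{xxx}=0$. Define $$s_0=\zeta_2+\zeta_3-\zeta_1+2\sqrt{\zeta_1^2-\zeta_3^2}\,Z(\alpha),\qquad c_b=2(\zeta_1^2+\zeta_2^2+\zeta_3^2)-\frac{4\zeta_1\zeta_2\zeta_3}{\zeta_2+\zeta_3-\zeta_1+2\sqrt{\zeta_1^2-\zeta_3^2}\,Z(\alpha)},$$ and $\xi=x+ct$, $\eta=s_0(x+c_bt)$. Then for every $\eta_0\in\mathbb{R}$, $$u(x,t)=\frac{4\phi(\xi)\Theta^2(\nu\xi+\alpha)+e^{2(\eta+\eta_0)}\Theta^2(\nu\xi-\alpha)\bigl(2\phi(\xi)\phi'(\xi)-\phi''(\xi)-b\bigr)}{4\Theta^2(\nu\xi+\alpha)+e^{2(\eta+\eta_0)}\Theta^2(\nu\xi-\alpha)\bigl(c+2\phi'(\xi)-2\phi(\xi)^2\bigr)}$$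 is a bounded solution of the defocusing mKdV equation $u_t-6u^2u_x+u_{xxx}=0$ on $\mathbb{R}\times\mathbb{R}$ (a kink breather). Moreover $c_b<c$, $s_0>0$, and $$u(x,t)\to\begin{cases}\phi(\xi) & \text{as } \eta\to-\infty,\\ -\phi(\xi-2\nu^{-1}\alpha) & \text{as } \eta\to+\infty.\end{cases}$$
   Context: For $k\in(0,1)$: $K=K(k)$ is the complete elliptic integral of the first kind, $k'=\sqrt{1-k^2}$, $K'=K(k')$, $q=e^{-\pi K'/K}$, $\theta_4(y)=1+2\sum_{n\ge1}(-1)^nq^{n^2}\cos(2ny)$, $\Theta(x)=\theta_4\!\left(\frac{\pi x}{2K}\right)$, and Jacobi's zeta function is $Z(x)=\Theta'(x)/\Theta(x)$. $\mathrm{sn}$ is the Jacobi elliptic function of modulus $k$. *)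

(* Defs.v *)
From Stdlib Require Import Reals Lra ClassicalEpsilon.
From Coquelicot Require Import Coquelicot.
Open Scope R_scope.

Definition ell_integrand (k th : R) : R := / sqrt (1 - k ^ 2 * sin th ^ 2).

Definition ellK (k : R) : R := RInt (ell_integrand k) 0 (PI / 2).

Definition kprime (k : R) : R := sqrt (1 - k ^ 2).

Definition nome (k : R) : R := exp (- PI * ellK (kprime k) / ellK k).

Definition theta4 (k y : R) : R :=
  1 + 2 * Series (fun n : nat =>
        (-1) ^ (S n) * nome k ^ (S n * S n) * cos (2 * INR (S n) * y)).

Definition Theta (k x : R) : R := theta4 k (PI * x / (2 * ellK k)).

Definition jacZ (k x : R) : R := Derive (Theta k) x / Theta k x.

Definition ellF (k phi : R) : R := RInt (ell_integrand k) 0 phi.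
Definition am (k u : R) : R := epsilon (inhabits 0) (fun phi => ellF k phi = u).

Definition sn (k u : R) : R := sin (am k u).

Definition bcoef (z1 z2 z3 : R) : R := 4 * z1 * z2 * z3.
Definition ccoef (z1 z2 z3 : R) : R := 2 * (z1 ^ 2 + z2 ^ 2 + z3 ^ 2).
Definition nuc (z1 z3 : R) : R := sqrt (z1 ^ 2 - z3 ^ 2).
Definition kmod (z1 z2 z3 : R) : R := sqrt ((z1 ^ 2 - z2 ^ 2) / (z1 ^ 2 - z3 ^ 2)).

Definition phi (z1 z2 z3 x : R) : R :=
  2 * (z1 + z3) * (z2 + z3)
    / ((z1 + z3) - (z1 - z2) * sn (kmod z1 z2 z3) (nuc z1 z3 * x) ^ 2)
  - z1 - z2 - z3.

Definition s0 (z1 z2 z3 alpha : R) : R :=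
  z2 + z3 - z1 + 2 * sqrt (z1 ^ 2 - z3 ^ 2) * jacZ (kmod z1 z2 z3) alpha.

Definition cb (z1 z2 z3 alpha : R) : R :=
  2 * (z1 ^ 2 + z2 ^ 2 + z3 ^ 2)
  - 4 * z1 * z2 * z3
    / (z2 + z3 - z1 + 2 * sqrt (z1 ^ 2 - z3 ^ 2) * jacZ (kmod z1 z2 z3) alpha).

Definition kb_num (z1 z2 z3 alpha eta0 xi eta : R) : R :=
  let k := kmod z1 z2 z3 in
  let nu := nuc z1 z3 in
  let p := phi z1 z2 z3 in
  4 * p xi * Theta k (nu * xi + alpha) ^ 2
  + exp (2 * (eta + eta0)) * Theta k (nu * xi - alpha) ^ 2
    * (2 * p xi * Derive p xi - Derive_n p 2 xi - bcoef z1 z2 z3).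

Definition kb_den (z1 z2 z3 alpha eta0 xi eta : R) : R :=
  let k := kmod z1 z2 z3 in
  let nu := nuc z1 z3 in
  let p := phi z1 z2 z3 in
  4 * Theta k (nu * xi + alpha) ^ 2
  + exp (2 * (eta + eta0)) * Theta k (nu * xi - alpha) ^ 2
    * (ccoef z1 z2 z3 + 2 * Derive p xi - 2 * p xi ^ 2).

Definition kbU (z1 z2 z3 alpha eta0 xi eta : R) : R :=
  kb_num z1 z2 z3 alpha eta0 xi eta / kb_den z1 z2 z3 alpha eta0 xi eta.

Definition xi_of (z1 z2 z3 x t : R) : R := x + ccoef z1 z2 z3 * t.
Definition eta_of (z1 z2 z3 alpha x t : R) : R :=
  s0 z1 z2 z3 alpha * (x + cb z1 z2 z3 alpha * t).

Definition kbu (z1 z2 z3 alpha eta0 x t : R) : R :=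
  kbU z1 z2 z3 alpha eta0 (xi_of z1 z2 z3 x t) (eta_of z1 z2 z3 alpha x t).

Definition mKdV_solution (u : R -> R -> R) : Prop :=
  forall x t,
    ex_derive (fun s => u x s) t /\
    ex_derive_n (fun y => u y t) 1 x /\
    ex_derive_n (fun y => u y t) 2 x /\
    ex_derive_n (fun y => u y t) 3 x /\
    Derive (fun s => u x s) t
      - 6 * (u x t) ^ 2 * Derive (fun y => u y t) x
      + Derive_n (fun y => u y t) 3 x = 0.

(* Main.v *)
(** Let [D = c + 2 phi' - 2 phi^2], [b = 4 z1 z2 z3] and
    [E = exp (2 (eta + eta0)) (Theta (nu xi - alpha) / Theta (nu xi + alpha))^2]. Then
    [u = phi - v] with [v = 2 b E / (4 + E D)]. The addition formula for Z gives
    [phi (xi) = s0 + nu (Z (nu xi - alpha) - Z (nu xi + alpha))], hence [E_x = 2 phi E] and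
    [E_t = (2 c phi - 2 b) E]; with [D' = 2 b - 2 phi D] the function [v] satisfies
    [v_x = 2 phi v - v^2] and a similar equation in t, and the mKdV equation becomes a polynomial
    identity. Positivity of [D] follows from the first integral of the equation of [phi], and
    [s0 > 0] from [(E D)' = 2 b E > 0] over a period. The limit at plus infinity is
    [phi - 2 b / D]; it equals [- phi (xi - 2 alpha / nu)] because the Miura transforms
    [phi^2 - phi'] and [phi^2 + phi'] differ by that shift.

    The link between the theta series and the elliptic integrals is made without complex
    analysis. Rearranging double series yields bilinear theta identities, from which the quotient
    theta_1 / theta_4 satisfies the differential equation of sn and the Landen transformation of
    K appears as a change of nome from q to q^2. The equality q = exp (- pi K' / K) holds because
    log q and - pi K' / K both double under the Landen transformation and have a bounded
    difference. *)

Require Import Defs.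
From Stdlib Require Import Reals Lra Lia ZArith List Classical ClassicalEpsilon FinFun Ranalysis5.
From Coquelicot Require Import Coquelicot.
Import ListNotations.
Open Scope R_scope.

(** * Unconditional sums over a type *)

(** Without complex analysis, zeros of theta functions cannot be counted by contour integrals and no
    imaginary quasi-period is at hand. The passage from the parameter t to 2 t takes their place:
    the bilinear identities express products at t through values at 2 t, and for large t the series
    are governed by their leading terms. Absence of zeros, surjectivity of the modulus and the value
    of the nome are all carried along this doubling. The identities themselves are reindexings of a
    sum over Z * Z, whence a notion of sum that knows no order of the terms. A second obstacle is
    that [Theta] depends on k through elliptic integrals and [sn] through the inverse of such an
    integral, while the series are parametrized by t. Statements relating them are proved for k =
    [kap t] and transferred by surjectivity of [kap]; the addition theorem of [sn] is derived from
    its differential equations alone. *)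

Definition lsum {I : Type} (f : I -> R) (L : list I) : R :=
  fold_right (fun i s => f i + s) 0 L.

(** Convergence of the net of finite partial sums, a finite set being a duplicate-free list. No
    enumeration of the index type is chosen, so a bijection of indices preserves sums outright. *)
Definition hsum {I : Type} (f : I -> R) (l : R) : Prop :=
  forall eps, 0 < eps -> exists L0, forall L,
    NoDup L -> incl L0 L -> Rabs (lsum f L - l) < eps.

Definition hval {I : Type} (f : I -> R) : R := epsilon (inhabits 0) (hsum f).

Definition summable {I : Type} (f : I -> R) : Prop :=
  exists M, forall L, NoDup L -> lsum (fun i => Rabs (f i)) L <= M.

(** Turns a concatenation of lists into a finite set again; equality on the index type is decided
    classically. *)
Definition dedup {I : Type} (L : list I) : list I :=
  nodup (fun x y => excluded_middle_informative (x = y)) L.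

Lemma dedup_NoDup {I : Type} (L : list I) : NoDup (dedup L).
Proof. apply NoDup_nodup. Qed.

Lemma dedup_incl {I : Type} (L : list I) : incl L (dedup L).
Proof. intros x Hx. apply nodup_In; exact Hx. Qed.

Lemma lsum_app {I : Type} (f : I -> R) L1 L2 : lsum f (L1 ++ L2) = lsum f L1 + lsum f L2.
Proof. induction L1 as [|x L1 IH]; simpl; [lra | rewrite IH; lra]. Qed.

Lemma lsum_map {I J : Type} (g : J -> I) (f : I -> R) L :
  lsum f (map g L) = lsum (fun j => f (g j)) L.
Proof. induction L as [|x L IH]; simpl; [lra | rewrite IH; lra]. Qed.

Lemma lsum_plus {I : Type} (f g : I -> R) L :
  lsum (fun i => f i + g i) L = lsum f L + lsum g L.
Proof. induction L as [|x L IH]; simpl; [lra | rewrite IH; lra]. Qed.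

Lemma lsum_scal {I : Type} (a : R) (f : I -> R) L :
  lsum (fun i => a * f i) L = a * lsum f L.
Proof. induction L as [|x L IH]; simpl; [lra | rewrite IH; lra]. Qed.

Lemma lsum_ext {I : Type} (f g : I -> R) L :
  (forall i, f i = g i) -> lsum f L = lsum g L.
Proof. intros H; induction L as [|x L IH]; simpl; [lra | rewrite IH, H; lra]. Qed.

Lemma lsum_le {I : Type} (f g : I -> R) L :
  (forall i, f i <= g i) -> lsum f L <= lsum g L.
Proof. intros H; induction L as [|x L IH]; simpl; [lra | specialize (H x); lra]. Qed.

Lemma lsum_nonneg {I : Type} (f : I -> R) L : (forall i, 0 <= f i) -> 0 <= lsum f L.
Proof. intros H; induction L as [|x L IH]; simpl; [lra | specialize (H x); lra]. Qed.

Lemma lsum_incl_le {I : Type} (f : I -> R) L L' :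
  (forall i, 0 <= f i) -> NoDup L -> incl L L' -> lsum f L <= lsum f L'.
Proof.
  intros Hf HL; revert L'; induction HL as [|x L Hx HL IH]; intros L' Hi; simpl.
  - now apply lsum_nonneg.
  - destruct (in_split x L' (Hi x (or_introl eq_refl))) as [l1 [l2 ->]].
    rewrite lsum_app; simpl.
    assert (H : lsum f L <= lsum f (l1 ++ l2)).
    { apply IH. intros y Hy.
      assert (Hy' := Hi y (or_intror Hy)).
      apply in_app_or in Hy'. apply in_or_app.
      destruct Hy' as [H|[H|H]]; auto. subst; contradiction. }
    rewrite lsum_app in H; lra.
Qed.

Lemma lsum_prod {I J : Type} (f : I -> R) (g : J -> R) A B :
  lsum (fun ij => f (fst ij) * g (snd ij)) (list_prod A B) = lsum f A * lsum g B.
Proof.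
  induction A as [|x A IH]; simpl; [lra|].
  rewrite lsum_app, IH, lsum_map; simpl. rewrite lsum_scal; lra.
Qed.

Lemma hsum_unique {I : Type} (f : I -> R) a b : hsum f a -> hsum f b -> a = b.
Proof.
  intros Ha Hb. apply NNPP; intros Hn.
  assert (He : 0 < Rabs (a - b) / 2) by (assert (0 < Rabs (a - b)) by (apply Rabs_pos_lt; lra); lra).
  destruct (Ha _ He) as [A HA]. destruct (Hb _ He) as [B HB].
  specialize (HA (dedup (A ++ B)) (dedup_NoDup _)).
  specialize (HB (dedup (A ++ B)) (dedup_NoDup _)).
  specialize (HA (fun x Hx => dedup_incl _ _ (in_or_app _ _ _ (or_introl Hx)))).
  specialize (HB (fun x Hx => dedup_incl _ _ (in_or_app _ _ _ (or_intror Hx)))).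
  revert HA HB He. unfold Rabs; repeat destruct Rcase_abs; lra.
Qed.

Lemma hsum_ext {I : Type} (f g : I -> R) l : (forall i, f i = g i) -> hsum f l -> hsum g l.
Proof.
  intros H Hf eps He. destruct (Hf eps He) as [L0 HL]. exists L0; intros L H1 H2.
  rewrite <- (lsum_ext f g) by auto. auto.
Qed.

Lemma hsum_plus {I : Type} (f g : I -> R) a b :
  hsum f a -> hsum g b -> hsum (fun i => f i + g i) (a + b).
Proof.
  intros Ha Hb eps He.
  destruct (Ha (eps / 2)) as [A HA]; [lra|]. destruct (Hb (eps / 2)) as [B HB]; [lra|].
  exists (A ++ B); intros L H1 H2. rewrite lsum_plus.
  specialize (HA L H1 (fun x Hx => H2 _ (in_or_app _ _ _ (or_introl Hx)))).
  specialize (HB L H1 (fun x Hx => H2 _ (in_or_app _ _ _ (or_intror Hx)))).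
  revert HA HB. unfold Rabs; repeat destruct Rcase_abs; lra.
Qed.

Lemma hsum_scal {I : Type} (c : R) (f : I -> R) a :
  hsum f a -> hsum (fun i => c * f i) (c * a).
Proof.
  intros Ha eps He.
  assert (Hc : 0 < Rabs c + 1) by (assert (H := Rabs_pos c); lra).
  destruct (Ha (eps / (Rabs c + 1))) as [A HA]; [apply Rdiv_lt_0_compat; lra|].
  exists A; intros L H1 H2. rewrite lsum_scal.
  specialize (HA L H1 H2).
  replace (c * lsum f L - c * a) with (c * (lsum f L - a)) by ring.
  rewrite Rabs_mult.
  apply Rle_lt_trans with (Rabs c * (eps / (Rabs c + 1))).
  - apply Rmult_le_compat_l; [apply Rabs_pos | lra].
  - apply Rlt_le_trans with ((Rabs c + 1) * (eps / (Rabs c + 1))).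
    + apply Rmult_lt_compat_r; [apply Rdiv_lt_0_compat; lra | lra].
    + right; field; lra.
Qed.

Lemma hsum_le {I : Type} (f g : I -> R) a b :
  (forall i, f i <= g i) -> hsum f a -> hsum g b -> a <= b.
Proof.
  intros H Ha Hb. apply Rnot_lt_le; intros Hn.
  destruct (Ha ((a - b) / 2)) as [A HA]; [lra|]. destruct (Hb ((a - b) / 2)) as [B HB]; [lra|].
  specialize (HA (dedup (A ++ B)) (dedup_NoDup _) (fun x Hx => dedup_incl _ _ (in_or_app _ _ _ (or_introl Hx)))).
  specialize (HB (dedup (A ++ B)) (dedup_NoDup _) (fun x Hx => dedup_incl _ _ (in_or_app _ _ _ (or_intror Hx)))).
  assert (HH := lsum_le f g (dedup (A ++ B)) H).
  revert HA HB. unfold Rabs; repeat destruct Rcase_abs; lra.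
Qed.

Lemma hsum_Rabs_le {I : Type} (f g : I -> R) a b :
  (forall i, Rabs (f i) <= g i) -> hsum f a -> hsum g b -> Rabs a <= b.
Proof.
  intros H Ha Hb. apply Rabs_le. split.
  - apply Ropp_le_cancel. rewrite Ropp_involutive.
    apply (hsum_le (fun i => -1 * f i) g).
    + intros i; specialize (H i); revert H; unfold Rabs; destruct Rcase_abs; lra.
    + replace (- a) with (-1 * a) by ring. now apply hsum_scal.
    + exact Hb.
  - apply (hsum_le f g); auto. intros i; specialize (H i); revert H; unfold Rabs; destruct Rcase_abs; lra.
Qed.

Lemma hsum_nonneg_ex {I : Type} (f : I -> R) :
  (forall i, 0 <= f i) -> summable f -> exists l, hsum f l.
Proof.
  intros Hf [M HM].
  destruct (completeness (fun s => exists L, NoDup L /\ s = lsum f L)) as [l [Hub Hl]].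
  - exists M. intros s [L [H1 ->]]. apply Rle_trans with (2 := HM L H1).
    apply lsum_le; intros; apply Rle_abs.
  - exists 0. exists nil. split; [constructor | reflexivity].
  - exists l. intros eps He.
    assert (H : exists L, NoDup L /\ l - eps < lsum f L).
    { apply NNPP; intros Hn. assert (l <= l - eps); [|lra].
      apply Hl. intros s [L [H1 ->]]. apply Rnot_lt_le; intros H2. apply Hn; eauto. }
    destruct H as [L0 [H0 H1]]. exists L0; intros L H2 H3.
    assert (H4 := lsum_incl_le f L0 L Hf H0 H3).
    assert (H5 : lsum f L <= l) by (apply Hub; eauto).
    unfold Rabs; destruct Rcase_abs; lra.
Qed.

(** Both f + |f| and |f| are nonnegative, so their partial sums have a supremum; f is the
    difference. *)
Lemma summable_hsum {I : Type} (f : I -> R) : summable f -> exists l, hsum f l.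
Proof.
  intros [M HM].
  destruct (hsum_nonneg_ex (fun i => f i + Rabs (f i))) as [a Ha].
  - intros i; unfold Rabs; destruct Rcase_abs; lra.
  - exists (2 * M). intros L HL. apply Rle_trans with (2 * lsum (fun i => Rabs (f i)) L).
    + rewrite <- lsum_scal. apply lsum_le. intros i.
      rewrite Rabs_right; unfold Rabs; destruct Rcase_abs; lra.
    + specialize (HM L HL); lra.
  - destruct (hsum_nonneg_ex (fun i => Rabs (f i))) as [b Hb].
    + intros; apply Rabs_pos.
    + exists M; intros L HL. rewrite (lsum_ext _ (fun i => Rabs (f i))); auto.
      intros; apply Rabs_Rabsolu.
    + exists (a + -1 * b).
      apply hsum_ext with (fun i => (f i + Rabs (f i)) + -1 * Rabs (f i)); [intros; ring|].
      apply hsum_plus; [exact Ha | apply hsum_scal, Hb].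
Qed.

Lemma hval_spec {I : Type} (f : I -> R) : summable f -> hsum f (hval f).
Proof. intros H. unfold hval. apply epsilon_spec. now apply summable_hsum. Qed.

Lemma summable_le {I : Type} (C : R) (f g : I -> R) :
  (forall i, Rabs (f i) <= C * g i) -> summable g -> summable f.
Proof.
  intros H [M HM]. exists (Rabs C * M). intros L HL.
  apply Rle_trans with (Rabs C * lsum (fun i => Rabs (g i)) L).
  - rewrite <- lsum_scal. apply lsum_le. intros i. apply Rle_trans with (1 := H i).
    rewrite <- Rabs_mult. apply Rle_abs.
  - apply Rmult_le_compat_l; [apply Rabs_pos | auto].
Qed.

Lemma summable_inj {I J : Type} (s : J -> I) (f : I -> R) :
  (forall x y, s x = s y -> x = y) -> summable f -> summable (fun j => f (s j)).
Proof.
  intros Hs [M HM]. exists M; intros L HL.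
  rewrite <- (lsum_map s (fun i => Rabs (f i))). apply HM.
  apply Injective_map_NoDup; auto.
Qed.

Lemma hsum_reindex {I J : Type} (s : J -> I) (r : I -> J) (f : I -> R) l :
  (forall j, r (s j) = j) -> (forall i, s (r i) = i) ->
  hsum f l -> hsum (fun j => f (s j)) l.
Proof.
  intros H1 H2 Hf eps He. destruct (Hf eps He) as [L0 HL0].
  exists (map r L0). intros L HL Hi. rewrite <- (lsum_map s f). apply HL0.
  - apply Injective_map_NoDup; auto. intros x y Hxy. now rewrite <- (H1 x), <- (H1 y), Hxy.
  - intros i Hi'. rewrite <- (H2 i). apply in_map. apply Hi. now apply in_map.
Qed.

Lemma hsum_odd {I : Type} (s : I -> I) (f : I -> R) l :
  (forall i, s (s i) = i) -> (forall i, f (s i) = - f i) -> hsum f l -> l = 0.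
Proof.
  intros Hs Hf Hl.
  assert (H1 := hsum_reindex s s f l Hs Hs Hl).
  assert (H2 : hsum (fun i => f (s i)) (-1 * l)).
  { apply hsum_ext with (fun i => -1 * f i); [intros; rewrite Hf; ring | now apply hsum_scal]. }
  assert (H3 := hsum_unique _ _ _ H1 H2). lra.
Qed.

Lemma list_prod_NoDup {I J : Type} (A : list I) (B : list J) :
  NoDup A -> NoDup B -> NoDup (list_prod A B).
Proof.
  intros HA HB; induction HA as [|x A Hx HA IH]; simpl; [constructor|].
  apply NoDup_app; auto.
  - apply Injective_map_NoDup; auto. intros u v; congruence.
  - intros [u v] H1 H2. apply in_map_iff in H1. destruct H1 as [w [H1 _]].
    apply in_prod_iff in H2. injection H1; intros; subst. tauto.
Qed.

Lemma summable_prod {I J : Type} (f : I -> R) (g : J -> R) :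
  summable f -> summable g -> summable (fun ij => f (fst ij) * g (snd ij)).
Proof.
  intros [M HM] [N HN]. exists (M * N). intros L HL.
  apply Rle_trans with
    (lsum (fun ij => Rabs (f (fst ij)) * Rabs (g (snd ij)))
       (list_prod (dedup (map fst L)) (dedup (map snd L)))).
  - rewrite (lsum_ext _ (fun ij => Rabs (f (fst ij)) * Rabs (g (snd ij))))
      by (intros; apply Rabs_mult).
    apply lsum_incl_le; auto.
    + intros; apply Rmult_le_pos; apply Rabs_pos.
    + intros [x y] H. apply in_prod; apply dedup_incl.
      * apply (in_map fst _ _ H).
      * apply (in_map snd _ _ H).
  - rewrite (lsum_prod (fun i => Rabs (f i)) (fun j => Rabs (g j))).
    apply Rmult_le_compat; try (apply lsum_nonneg; intros; apply Rabs_pos).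
    + apply HM, dedup_NoDup.
    + apply HN, dedup_NoDup.
Qed.

(** The double sum exists by absolute summability; only its value is at stake, and it is found by
    evaluating on a rectangle large enough for all three sums. *)
Lemma hsum_prod {I J : Type} (f : I -> R) (g : J -> R) a b :
  summable f -> summable g -> hsum f a -> hsum g b ->
  hsum (fun ij => f (fst ij) * g (snd ij)) (a * b).
Proof.
  intros Sf Sg Ha Hb.
  destruct (summable_hsum _ (summable_prod f g Sf Sg)) as [s Hs].
  replace (a * b) with s; [exact Hs|].
  apply NNPP; intros Hn.
  set (eps := Rabs (s - a * b) / 2).
  assert (He : 0 < eps) by (unfold eps; assert (0 < Rabs (s - a * b)) by (apply Rabs_pos_lt; lra); lra).
  destruct (Hs eps He) as [L0 HL0].
  (* With both errors below d <= 1, the product error is at most d (1 + |a| + |b|) <= eps. *)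
  set (d := Rmin 1 (eps / (1 + Rabs a + Rabs b))).
  assert (Ka := Rabs_pos a). assert (Kb := Rabs_pos b).
  assert (Hd : 0 < d).
  { unfold d; apply Rmin_glb_lt; [lra | apply Rdiv_lt_0_compat; lra]. }
  destruct (Ha d Hd) as [A HA]. destruct (Hb d Hd) as [B HB].
  set (A' := dedup (A ++ map fst L0)). set (B' := dedup (B ++ map snd L0)).
  specialize (HA A' (dedup_NoDup _) (fun x Hx => dedup_incl _ _ (in_or_app _ _ _ (or_introl Hx)))).
  specialize (HB B' (dedup_NoDup _) (fun x Hx => dedup_incl _ _ (in_or_app _ _ _ (or_introl Hx)))).
  assert (H := HL0 (list_prod A' B')).
  rewrite lsum_prod in H.
  assert (H' : Rabs (lsum f A' * lsum g B' - s) < eps).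
  { apply H.
    - apply list_prod_NoDup; apply dedup_NoDup.
    - intros [x y] Hxy. apply in_prod; apply dedup_incl, in_or_app; right.
      + apply (in_map fst _ _ Hxy).
      + apply (in_map snd _ _ Hxy). }
  set (u := lsum f A') in *. set (v := lsum g B') in *.
  assert (H1 : Rabs (u * v - a * b) <= eps).
  { replace (u * v - a * b) with ((u - a) * (v - b) + a * (v - b) + b * (u - a)) by ring.
    apply Rle_trans with (Rabs (u - a) * Rabs (v - b) + Rabs a * Rabs (v - b) + Rabs b * Rabs (u - a)).
    - rewrite <- !Rabs_mult. eapply Rle_trans; [apply Rabs_triang|].
      apply Rplus_le_compat_r. apply Rabs_triang.
    - assert (H2 : d <= 1) by apply Rmin_l.
      assert (H3 : d * (1 + Rabs a + Rabs b) <= eps).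
      { apply Rle_trans with (eps / (1 + Rabs a + Rabs b) * (1 + Rabs a + Rabs b)).
        - apply Rmult_le_compat_r; [lra | apply Rmin_r].
        - right; field; lra. }
      assert (K1 := Rabs_pos (u - a)). assert (K2 := Rabs_pos (v - b)). nra. }
  assert (H2 : Rabs (s - a * b) <= Rabs (u * v - s) + Rabs (u * v - a * b)).
  { replace (s - a * b) with (- (u * v - s) + (u * v - a * b)) by ring.
    eapply Rle_trans; [apply Rabs_triang|]. rewrite Rabs_Ropp. lra. }
  unfold eps in *; lra.
Qed.

(** Splits a sum along a partition of the index type into two injective images; it is applied to the
    two parity classes of Z * Z. *)
Lemma hsum_union {I J : Type} (p0 p1 : J -> I) (f : I -> R) a b :
  summable f ->
  (forall x y, p0 x = p0 y -> x = y) -> (forall x y, p1 x = p1 y -> x = y) ->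
  (forall x y, p0 x <> p1 y) -> (forall i, exists j, i = p0 j \/ i = p1 j) ->
  hsum (fun j => f (p0 j)) a -> hsum (fun j => f (p1 j)) b -> hsum f (a + b).
Proof.
  intros Sf I0 I1 Hd Hc Ha Hb.
  destruct (summable_hsum f Sf) as [s Hs].
  replace (a + b) with s; [exact Hs|].
  apply NNPP; intros Hn.
  set (eps := Rabs (s - (a + b)) / 3).
  assert (He : 0 < eps).
  { unfold eps; assert (0 < Rabs (s - (a + b))) by (apply Rabs_pos_lt; lra); lra. }
  destruct (Hs eps He) as [L0 HL0]. destruct (Ha eps He) as [A HA]. destruct (Hb eps He) as [B HB].
  assert (HP : exists P, incl L0 (map p0 P ++ map p1 P)).
  { clear -Hc. induction L0 as [|x L [P HP]].
    - exists nil; intros y [].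
    - destruct (Hc x) as [j Hj]. exists (j :: P). intros y [<-|Hy].
      + apply in_or_app. destruct Hj as [->| ->]; [left | right]; simpl; auto.
      + specialize (HP y Hy). apply in_app_or in HP. apply in_or_app.
        destruct HP; [left | right]; simpl; auto. }
  destruct HP as [P HP].
  set (A' := dedup (A ++ P)). set (B' := dedup (B ++ P)).
  specialize (HA A' (dedup_NoDup _) (fun x Hx => dedup_incl _ _ (in_or_app _ _ _ (or_introl Hx)))).
  specialize (HB B' (dedup_NoDup _) (fun x Hx => dedup_incl _ _ (in_or_app _ _ _ (or_introl Hx)))).
  assert (H : Rabs (lsum f (map p0 A' ++ map p1 B') - s) < eps).
  { apply HL0.
    - apply NoDup_app; try (apply Injective_map_NoDup; [assumption | apply dedup_NoDup]).
      intros x H1 H2. apply in_map_iff in H1. apply in_map_iff in H2.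
      destruct H1 as [u [H1 _]]. destruct H2 as [v [H2 _]]. apply (Hd u v); congruence.
    - intros x Hx. apply HP in Hx. apply in_app_or in Hx. apply in_or_app.
      destruct Hx as [Hx|Hx]; [left | right]; apply in_map_iff in Hx; destruct Hx as [u [<- Hu]];
        apply in_map, dedup_incl, in_or_app; right; exact Hu. }
  rewrite lsum_app, !lsum_map in H.
  unfold eps in *. revert H HA HB He. unfold Rabs; repeat destruct Rcase_abs; lra.
Qed.

Lemma hsum_Kronecker (k : Z) : hsum (fun n => if Z.eq_dec n k then 1 else 0) 1.
Proof.
  intros eps He. exists [k]. intros L HL Hi.
  assert (Hk : In k L) by (apply Hi; simpl; auto).
  assert (E : forall M, NoDup M -> lsum (fun n => if Z.eq_dec n k then 1 else 0) M
     = if in_dec Z.eq_dec k M then 1 else 0).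
  { clear. intros M HM. induction HM as [|x M Hx HM IH]; simpl; [reflexivity|].
    rewrite IH. destruct (Z.eq_dec x k) as [->|Hn].
    - destruct (in_dec Z.eq_dec k M); [contradiction | ring].
    - destruct (in_dec Z.eq_dec k M); simpl; ring. }
  rewrite E by exact HL. destruct (in_dec Z.eq_dec k L); [|contradiction].
  replace (1 - 1) with 0 by ring. now rewrite Rabs_R0.
Qed.

(** Bridge from sums over Z to the one-sided [Series] in [theta4]: the partial sums are taken over
    the symmetric ranges from - N to N. *)
Lemma hsum_even_series (f : Z -> R) l :
  (forall n, f (- n)%Z = f n) -> hsum f l ->
  is_series (fun n : nat => f (Z.of_nat (S n))) ((l - f 0%Z) / 2).
Proof.
  intros Hev Hl.
  set (rg := fun N : nat => 0%Z :: map (fun n => Z.of_nat (S n)) (seq 0 N)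
                     ++ map (fun n => - Z.of_nat (S n))%Z (seq 0 N)).
  assert (Hnd : forall N, NoDup (rg N)).
  { intros N. unfold rg. constructor.
    - intros H. apply in_app_or in H. destruct H as [H|H]; apply in_map_iff in H;
        destruct H as [u [H _]]; lia.
    - apply NoDup_app.
      + apply Injective_map_NoDup; [intros x y; lia | apply seq_NoDup].
      + apply Injective_map_NoDup; [intros x y; lia | apply seq_NoDup].
      + intros x H1 H2. apply in_map_iff in H1. apply in_map_iff in H2.
        destruct H1 as [u [H1 _]]. destruct H2 as [v [H2 _]]. lia. }
  assert (Hin : forall N x, (Z.abs x <= Z.of_nat N)%Z -> In x (rg N)).
  { intros N x Hx. unfold rg. destruct (Z.eq_dec x 0) as [->|Hn]; [now left|right].
    apply in_or_app. destruct (Z_lt_le_dec 0 x).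
    - left. apply in_map_iff. exists (Z.to_nat x - 1)%nat. split; [lia | apply in_seq; lia].
    - right. apply in_map_iff. exists (Z.to_nat (- x) - 1)%nat. split; [lia | apply in_seq; lia]. }
  (* [sum_n _ N] has N + 1 terms, so it matches the range of radius S N. *)
  assert (Hsum : forall N, lsum f (rg (S N)) = f 0%Z + 2 * sum_n (fun n => f (Z.of_nat (S n))) N).
  { intros N.
    assert (E : lsum (fun j => f (Z.of_nat (S j))) (seq 0 (S N)) = sum_n (fun n => f (Z.of_nat (S n))) N).
    { induction N as [|N IH].
      - rewrite sum_O. simpl. ring.
      - rewrite seq_S, lsum_app, IH, sum_Sn. simpl. unfold plus; simpl. ring. }
    change (f 0%Z + lsum f (map (fun n => Z.of_nat (S n)) (seq 0 (S N))
                     ++ map (fun n => - Z.of_nat (S n))%Z (seq 0 (S N)))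
       = f 0%Z + 2 * sum_n (fun n => f (Z.of_nat (S n))) N).
    rewrite lsum_app, !lsum_map.
    rewrite (lsum_ext (fun j => f (- Z.of_nat (S j))%Z) (fun j => f (Z.of_nat (S j))))
      by (intros; apply Hev).
    rewrite E. ring. }
  change (is_lim_seq (sum_n (fun n : nat => f (Z.of_nat (S n)))) (Finite ((l - f 0%Z) / 2))).
  apply is_lim_seq_ext with (fun N => (lsum f (rg (S N)) - f 0%Z) / 2).
  { intros N. rewrite Hsum. field. }
  unfold Rdiv. apply (is_lim_seq_scal_r (fun N => lsum f (rg (S N)) - f 0%Z) (/2) (l - f 0%Z)).
  apply is_lim_seq_minus'; [|apply is_lim_seq_const].
  apply is_lim_seq_spec. intros eps.
  destruct (Hl eps (cond_pos eps)) as [L0 HL0].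
  assert (HN : exists N : nat, forall x, In x L0 -> (Z.abs x <= Z.of_nat N)%Z).
  { clear. induction L0 as [|x L [N HN]].
    - exists 0%nat; intros x [].
    - exists (N + Z.to_nat (Z.abs x))%nat. intros y [<-|Hy]; [lia | specialize (HN y Hy); lia]. }
  destruct HN as [N HN]. exists N. intros n Hn. apply HL0; [apply Hnd|].
  intros x Hx. apply Hin. specialize (HN x Hx). lia.
Qed.

(** * Theta series *)

Lemma exp_ge_lin x : 1 + x <= exp x.
Proof. destruct (Req_dec x 0) as [->|H]; [rewrite exp_0; lra | left; now apply exp_ineq1]. Qed.

(** With z = t (1 + x^2) / 2 the Gaussian is e^t / (e^z)^2, and e^z >= z absorbs the polynomial
    factor. *)
Lemma poly_gauss_bound t x : 0 < t ->
  (1 + x ^ 2) ^ 2 * exp (- (t * x ^ 2)) <= 4 * exp t / t ^ 2.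
Proof.
  intros Ht. set (z := t * (1 + x ^ 2) / 2).
  assert (Hz : 0 < z) by (unfold z; assert (0 <= x ^ 2) by apply pow2_ge_0; nra).
  assert (H1 := exp_ge_lin z).
  assert (H2 : z ^ 2 <= exp z ^ 2) by (apply pow_incr; lra).
  assert (E : exp (- (t * x ^ 2)) = exp t / exp z ^ 2).
  { replace (exp z ^ 2) with (exp (z + z)) by (rewrite exp_plus; ring).
    unfold Rdiv. rewrite <- exp_Ropp, <- exp_plus. f_equal. unfold z; field. }
  rewrite E. apply Rmult_le_reg_r with (exp z ^ 2); [apply pow_lt, exp_pos|].
  replace ((1 + x ^ 2) ^ 2 * (exp t / exp z ^ 2) * exp z ^ 2) with (4 * exp t / t ^ 2 * z ^ 2).
  - apply Rmult_le_compat_l; [|exact H2].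
    apply Rmult_le_pos; [assert (H := exp_pos t); lra | left; apply Rinv_0_lt_compat, pow_lt, Ht].
  - unfold z. field. split; first [apply Rgt_not_eq, exp_pos | lra].
Qed.

(** The terms telescope on each half-line to 1 - 1 / (N + 1); the bound 2 counts the index 0
    twice. *)
Lemma summable_recip_quad :
  summable (fun n : Z => / ((Rabs (IZR n) + 1) * (Rabs (IZR n) + 2))).
Proof.
  set (b := fun n : Z => / ((Rabs (IZR n) + 1) * (Rabs (IZR n) + 2))).
  assert (Hb : forall n, 0 <= b n).
  { intros n; unfold b. left; apply Rinv_0_lt_compat. assert (H := Rabs_pos (IZR n)). nra. }
  exists 2. intros L HL. rewrite (lsum_ext _ b) by (intros; apply Rabs_right, Rle_ge, Hb).
  assert (HN : exists N : nat, forall x, In x L -> (Z.abs x < Z.of_nat N)%Z).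
  { clear. induction L as [|x L [N HN]].
    - exists 0%nat; intros x [].
    - exists (N + S (Z.to_nat (Z.abs x)))%nat. intros y [<-|Hy]; [lia | specialize (HN y Hy); lia]. }
  destruct HN as [N HN].
  apply Rle_trans with (lsum b (map Z.of_nat (seq 0 N) ++ map (fun n => - Z.of_nat n)%Z (seq 0 N))).
  - apply lsum_incl_le; auto. intros x Hx. specialize (HN x Hx). apply in_or_app.
    destruct (Z_le_gt_dec 0 x); [left | right]; apply in_map_iff.
    + exists (Z.to_nat x). split; [lia | apply in_seq; lia].
    + exists (Z.to_nat (- x)). split; [lia | apply in_seq; lia].
  - rewrite lsum_app, !lsum_map.
    rewrite (lsum_ext (fun j => b (- Z.of_nat j)%Z) (fun j => b (Z.of_nat j)))
      by (intros; unfold b; now rewrite opp_IZR, Rabs_Ropp).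
    assert (E : lsum (fun j => b (Z.of_nat j)) (seq 0 N) = 1 - / (INR N + 1)).
    { clear. induction N as [|N IH].
      - simpl. field.
      - rewrite seq_S, lsum_app, IH. change (0 + N)%nat with N. unfold lsum, fold_right, b.
        rewrite <- INR_IZR_INZ. rewrite Rabs_right by (apply Rle_ge, pos_INR).
        rewrite S_INR. assert (H := pos_INR N). field; lra. }
    rewrite E. assert (0 < / (INR N + 1)) by (apply Rinv_0_lt_compat; assert (H := pos_INR N); lra).
    lra.
Qed.

(** Frequencies are the integers m = 2 n + j, so that the half-integer exponents of theta_2 become
    odd m; with q = exp (-4 t) the weight is q^((m / 2)^2). *)
Definition gw (t : R) (m : Z) : R := exp (- (t * IZR m ^ 2)).

Lemma gw_pos t m : 0 < gw t m.
Proof. apply exp_pos. Qed.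

Lemma gw_opp t m : gw t (- m) = gw t m.
Proof. unfold gw. rewrite opp_IZR. do 2 f_equal. ring. Qed.

Lemma summable_gauss_quad t : 0 < t -> summable (fun m => (1 + IZR m ^ 2) * gw t m).
Proof.
  intros Ht. apply summable_le with (C := 4 * (4 * exp t / t ^ 2)) (2 := summable_recip_quad).
  intros m. set (x := IZR m). set (a := Rabs x).
  assert (Ha : 0 <= a) by apply Rabs_pos.
  assert (Hx : x ^ 2 = a ^ 2) by (unfold a; symmetry; apply pow2_abs).
  rewrite Rabs_right.
  2:{ apply Rle_ge, Rmult_le_pos; [assert (H := pow2_ge_0 x); lra | left; apply gw_pos]. }
  assert (H := poly_gauss_bound t x Ht). fold (gw t m) in H.
  change (exp (- (t * x ^ 2))) with (gw t m) in H.
  assert (Hp : 0 < (a + 1) * (a + 2)) by nra.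
  apply Rmult_le_reg_r with ((a + 1) * (a + 2)); [exact Hp|].
  rewrite !Rmult_assoc, Rinv_l, Rmult_1_r by lra.
  rewrite Hx in *. assert (Hg := gw_pos t m).
  assert ((a + 1) * (a + 2) <= 4 * (1 + a ^ 2)) by nra.
  apply Rle_trans with ((1 + a ^ 2) * (gw t m * (4 * (1 + a ^ 2)))).
  - apply Rmult_le_compat_l; [nra|]. apply Rmult_le_compat_l; lra.
  - apply Rle_trans with (4 * ((1 + a ^ 2) ^ 2 * gw t m)); [right; ring | lra].
Qed.

(** The factor 1 + m^2 leaves room for the termwise first derivative and a second-order
    remainder. *)
Lemma summable_gauss (j : Z) t (C : R) (f : Z -> R) : 0 < t ->
  (forall n, Rabs (f n) <= C * ((1 + IZR (2 * n + j) ^ 2) * gw t (2 * n + j))) -> summable f.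
Proof.
  intros Ht H. apply summable_le with (1 := H).
  apply (summable_inj (fun n => 2 * n + j)%Z (fun m => (1 + IZR m ^ 2) * gw t m)).
  - intros; lia.
  - now apply summable_gauss_quad.
Qed.

(* For the nome [q = exp (-4 t)], [th 0 t] and [th 1 t] are Jacobi's theta_3 and theta_2, while
   theta_4 (y) = th 0 t (y + PI / 2) and theta_1 (y) = th 1 t (y - PI / 2). *)
Definition th (j : Z) (t y : R) : R :=
  hval (fun n => gw t (2 * n + j) * cos (IZR (2 * n + j) * y)).

Lemma Rabs_mult_trig_le g c x : 0 < g -> Rabs c <= 1 -> Rabs (g * c) <= 1 * ((1 + x ^ 2) * g).
Proof.
  intros Hg Hc. rewrite Rabs_mult, (Rabs_right g) by lra.
  assert (H := pow2_ge_0 x). assert (H1 := Rabs_pos c). nra.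
Qed.

Lemma Rabs_cos_le x : Rabs (cos x) <= 1.
Proof. apply Rabs_le, COS_bound. Qed.

Lemma Rabs_sin_le x : Rabs (sin x) <= 1.
Proof. apply Rabs_le, SIN_bound. Qed.

Lemma summable_th j t y : 0 < t ->
  summable (fun n => gw t (2 * n + j) * cos (IZR (2 * n + j) * y)).
Proof.
  intros Ht. apply (summable_gauss j t 1); auto. intros n.
  apply Rabs_mult_trig_le; [apply gw_pos | apply Rabs_cos_le].
Qed.

Lemma summable_ths j t y : 0 < t ->
  summable (fun n => gw t (2 * n + j) * sin (IZR (2 * n + j) * y)).
Proof.
  intros Ht. apply (summable_gauss j t 1); auto. intros n.
  apply Rabs_mult_trig_le; [apply gw_pos | apply Rabs_sin_le].
Qed.

Lemma th_hsum j t y : 0 < t ->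
  hsum (fun n => gw t (2 * n + j) * cos (IZR (2 * n + j) * y)) (th j t y).
Proof. intros Ht. apply hval_spec. now apply summable_th. Qed.

Lemma th_intro j t y l : 0 < t ->
  hsum (fun n => gw t (2 * n + j) * cos (IZR (2 * n + j) * y)) l -> th j t y = l.
Proof. intros Ht H. apply (hsum_unique _ _ _ (th_hsum j t y Ht) H). Qed.

(** The reflection n -> - n - j negates the frequency, hence the sine terms cancel in pairs. *)
Lemma ths_hsum j t y : 0 < t ->
  hsum (fun n => gw t (2 * n + j) * sin (IZR (2 * n + j) * y)) 0.
Proof.
  intros Ht. destruct (summable_hsum _ (summable_ths j t y Ht)) as [l Hl].
  replace 0 with l; [exact Hl|].
  apply (hsum_odd (fun n => - n - j)%Z) with (3 := Hl); [intros; lia|].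
  intros n. replace (2 * (- n - j) + j)%Z with (- (2 * n + j))%Z by ring.
  rewrite gw_opp, opp_IZR. replace (- IZR (2 * n + j) * y) with (- (IZR (2 * n + j) * y)) by ring.
  rewrite sin_neg; ring.
Qed.

Lemma th_opp j t y : 0 < t -> th j t (- y) = th j t y.
Proof.
  intros Ht. apply th_intro; auto.
  apply hsum_ext with (2 := th_hsum j t y Ht). intros n.
  rewrite <- cos_neg. do 2 f_equal; ring.
Qed.

Lemma th_2 t y : 0 < t -> th 2 t y = th 0 t y.
Proof.
  intros Ht. apply th_intro; auto.
  apply hsum_ext with (fun n => gw t (2 * (n + 1) + 0) * cos (IZR (2 * (n + 1) + 0) * y)).
  - intros n. now replace (2 * (n + 1) + 0)%Z with (2 * n + 2)%Z by ring.
  - apply (hsum_reindex (fun n => n + 1)%Z (fun n => n - 1)%Z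
      (fun n => gw t (2 * n + 0) * cos (IZR (2 * n + 0) * y))); try (intros; lia).
    now apply th_hsum.
Qed.

Lemma cos_period_Z x k : cos (x + 2 * IZR k * PI) = cos x.
Proof.
  destruct (Z_le_gt_dec 0 k) as [H|H].
  - rewrite <- (cos_period x (Z.to_nat k)). rewrite INR_IZR_INZ, Z2Nat.id by lia. reflexivity.
  - rewrite <- (cos_period (x + 2 * IZR k * PI) (Z.to_nat (- k))).
    rewrite INR_IZR_INZ, Z2Nat.id, opp_IZR by lia. f_equal; ring.
Qed.

Lemma th0_PI t y : 0 < t -> th 0 t (y + PI) = th 0 t y.
Proof.
  intros Ht. apply th_intro; auto.
  apply hsum_ext with (2 := th_hsum 0 t y Ht). intros n. f_equal.
  rewrite <- (cos_period_Z _ n). f_equal. rewrite !plus_IZR, mult_IZR. ring.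
Qed.

Lemma th1_PI t y : 0 < t -> th 1 t (y + PI) = - th 1 t y.
Proof.
  intros Ht. apply th_intro; auto.
  replace (- th 1 t y) with (-1 * th 1 t y) by ring.
  apply hsum_ext with (2 := hsum_scal (-1) _ _ (th_hsum 1 t y Ht)). intros n.
  replace (IZR (2 * n + 1) * (y + PI)) with (IZR (2 * n + 1) * y + PI + 2 * IZR n * PI).
  - rewrite cos_period_Z, neg_cos. ring.
  - rewrite !plus_IZR, mult_IZR. ring.
Qed.

(** The parallelogram law (r + s)^2 + (r - s)^2 = 2 r^2 + 2 s^2; this is where the parameter
    doubles. *)
Lemma gw_double t r s : gw t (r + s) * gw t (r - s) = gw (2 * t) r * gw (2 * t) s.
Proof.
  unfold gw. rewrite <- !exp_plus. f_equal. rewrite plus_IZR, minus_IZR. ring.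
Qed.

(** The product of the two sine series is 0, so subtracting it turns cos * cos into a single cosine
    of the sum, whose phase can be regrouped freely. *)
Lemma hsum_th_prod i j t u v : 0 < t ->
  hsum (fun ab : Z * Z => gw t (2 * fst ab + i) * gw t (2 * snd ab + j) *
          cos (IZR (2 * fst ab + i) * u + IZR (2 * snd ab + j) * v))
       (th i t u * th j t v).
Proof.
  intros Ht.
  assert (H1 := hsum_prod _ _ _ _ (summable_th i t u Ht) (summable_th j t v Ht)
            (th_hsum i t u Ht) (th_hsum j t v Ht)).
  assert (H2 := hsum_prod _ _ _ _ (summable_ths i t u Ht) (summable_ths j t v Ht)
            (ths_hsum i t u Ht) (ths_hsum j t v Ht)).
  assert (H := hsum_plus _ _ _ _ H1 (hsum_scal (-1) _ _ H2)).
  replace (th i t u * th j t v) with (th i t u * th j t v + -1 * (0 * 0)) by ring.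
  apply hsum_ext with (2 := H). intros [a b]; simpl fst; simpl snd. rewrite cos_plus. ring.
Qed.

(* Write the odd or even frequencies as r + s and r - s and split according to the parity of r. *)
Lemma th_double j t x y : 0 < t ->
  th j t (x + y) * th j t (x - y) =
  th 0 (2 * t) (2 * x) * th j (2 * t) (2 * y) + th 1 (2 * t) (2 * x) * th (j + 1) (2 * t) (2 * y).
Proof.
  intros Ht. assert (Ht2 : 0 < 2 * t) by lra.
  assert (H := hsum_th_prod j j t (x + y) (x - y) Ht).
  apply (hsum_unique _ _ _ H).
  (* In the first class r = 2 c and s = 2 d + j; in the second r = 2 c + 1 and s = 2 d + j + 1. The
     class of (a, b) is the parity of r = a + b + j. *)
  apply (hsum_union (fun cd : Z * Z => (fst cd + snd cd, fst cd - snd cd - j))%Z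
                    (fun cd : Z * Z => (fst cd + snd cd + 1, fst cd - snd cd - j))%Z).
  - destruct (summable_prod _ _ (summable_th j t 0 Ht) (summable_th j t 0 Ht)) as [M HM].
    exists M. intros L HL. apply Rle_trans with (2 := HM L HL).
    apply lsum_le. intros [a b]; simpl fst; simpl snd.
    rewrite !Rmult_0_r, cos_0, !Rmult_1_r.
    rewrite Rabs_mult. rewrite <- (Rmult_1_r (Rabs (gw t (2 * a + j) * gw t (2 * b + j)))) at 2.
    apply Rmult_le_compat_l; [apply Rabs_pos | apply Rabs_cos_le].
  - intros [a b] [c d] E; simpl in E; injection E; intros; f_equal; lia.
  - intros [a b] [c d] E; simpl in E; injection E; intros; f_equal; lia.
  - intros [a b] [c d] E; simpl in E; injection E; intros; lia.
  - intros [a b]. assert (Hm := Z.div_mod (a + b + j) 2 ltac:(lia)).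
    assert (Hb := Z.mod_pos_bound (a + b + j) 2 ltac:(lia)).
    set (c := ((a + b + j) / 2)%Z) in *.
    destruct (Z.eq_dec ((a + b + j) mod 2) 0) as [E|E].
    + exists (c, a - c)%Z. left. simpl. f_equal; lia.
    + exists (c, a - c - 1)%Z. right. simpl. f_equal; lia.
  - apply hsum_ext with (2 := hsum_th_prod 0 j (2 * t) (2 * x) (2 * y) Ht2).
    intros [c d]; simpl fst; simpl snd.
    rewrite <- gw_double. f_equal; [f_equal; f_equal; lia|].
    f_equal. rewrite !plus_IZR, !mult_IZR, !minus_IZR, !plus_IZR. ring.
  - apply hsum_ext with (2 := hsum_th_prod 1 (j + 1) (2 * t) (2 * x) (2 * y) Ht2).
    intros [c d]; simpl fst; simpl snd.
    rewrite <- gw_double. f_equal; [f_equal; f_equal; lia|].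
    f_equal. rewrite !plus_IZR, !mult_IZR, !minus_IZR, !plus_IZR. ring.
Qed.

Lemma th0_double t x y : 0 < t -> th 0 t (x + y) * th 0 t (x - y) =
  th 0 (2 * t) (2 * x) * th 0 (2 * t) (2 * y) + th 1 (2 * t) (2 * x) * th 1 (2 * t) (2 * y).
Proof. intros Ht. now rewrite th_double. Qed.

Lemma th1_double t x y : 0 < t -> th 1 t (x + y) * th 1 t (x - y) =
  th 0 (2 * t) (2 * x) * th 1 (2 * t) (2 * y) + th 1 (2 * t) (2 * x) * th 0 (2 * t) (2 * y).
Proof. intros Ht. rewrite th_double by auto. change (1 + 1)%Z with 2%Z. now rewrite (th_2 (2 * t) (2 * y)) by lra. Qed.

(** * Differentiation in the argument and continuity in the parameter *)

Lemma Rabs_sin_sub_le a b : Rabs (sin a - sin b) <= Rabs (a - b).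
Proof.
  destruct (MVT_gen sin b a cos) as [c [_ Hc]].
  - intros; apply is_derive_sin.
  - intros; apply continuity_sin.
  - rewrite Hc, Rabs_mult. assert (H := Rabs_cos_le c). assert (H1 := Rabs_pos (a - b)). nra.
Qed.

Lemma cos_taylor1 a h : Rabs (cos (a + h) - cos a + h * sin a) <= h ^ 2.
Proof.
  destruct (MVT_gen cos a (a + h) (fun x => - sin x)) as [c [Hc1 Hc]].
  - intros; apply is_derive_cos.
  - intros; apply continuity_cos.
  - rewrite Hc. replace (- sin c * (a + h - a) + h * sin a) with (h * (sin a - sin c)) by ring.
    rewrite Rabs_mult. apply Rle_trans with (Rabs h * Rabs h).
    + apply Rmult_le_compat_l; [apply Rabs_pos|]. apply Rle_trans with (1 := Rabs_sin_sub_le _ _).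
      revert Hc1. unfold Rmin, Rmax; destruct (Rle_dec a (a + h)); unfold Rabs; repeat destruct Rcase_abs; lra.
    + rewrite <- Rabs_mult. right. rewrite Rabs_right; nra.
Qed.

(** A remainder of order h^2 with a constant valid for all h is summable term by term, so series are
    differentiated without a uniform convergence argument. *)
Lemma is_derive_quad (f : R -> R) (x l M : R) :
  (forall h, Rabs (f (x + h) - f x - h * l) <= M * h ^ 2) -> is_derive f x l.
Proof.
  intros H. apply is_derive_Reals. intros eps He.
  assert (HM := Rabs_pos M).
  assert (Hd : 0 < eps / (Rabs M + 1)) by (apply Rdiv_lt_0_compat; lra).
  exists (mkposreal _ Hd). intros h Hh Hlt. simpl in Hlt.
  replace ((f (x + h) - f x) / h - l) with ((f (x + h) - f x - h * l) / h) by (field; auto).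
  unfold Rdiv. rewrite Rabs_mult, Rabs_inv.
  assert (Hp : 0 < Rabs h) by now apply Rabs_pos_lt.
  apply Rmult_lt_reg_r with (Rabs h); [exact Hp|].
  rewrite Rmult_assoc, Rinv_l, Rmult_1_r by lra.
  apply Rle_lt_trans with (1 := H h).
  replace (h ^ 2) with (Rabs h * Rabs h) by (rewrite <- pow2_abs; ring).
  assert (H1 : Rabs h * (Rabs M + 1) < eps).
  { apply Rlt_le_trans with (eps / (Rabs M + 1) * (Rabs M + 1)).
    - apply Rmult_lt_compat_r; lra.
    - right; field; lra. }
  assert (H2 := Rle_abs M). nra.
Qed.

Lemma ex_derive_th j t y : 0 < t -> ex_derive (th j t) y.
Proof.
  intros Ht.
  assert (S1 : summable (fun n => - (gw t (2 * n + j) * IZR (2 * n + j) * sin (IZR (2 * n + j) * y)))).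
  { apply (summable_gauss j t 1); auto. intros n. set (m := IZR (2 * n + j)).
    rewrite Rabs_Ropp, !Rabs_mult, (Rabs_right (gw _ _)) by (apply Rle_ge, Rlt_le, gw_pos).
    assert (Hg := gw_pos t (2 * n + j)). assert (Hs := Rabs_sin_le (m * y)).
    assert (Rabs m <= 1 + m ^ 2) by (unfold Rabs; destruct Rcase_abs; nra).
    assert (Hp := Rabs_pos m). assert (Hq := Rabs_pos (sin (m * y))).
    apply Rle_trans with (gw t (2 * n + j) * Rabs m * 1); [|nra].
    apply Rmult_le_compat_l; [nra | lra]. }
  assert (S2 : summable (fun n => gw t (2 * n + j) * IZR (2 * n + j) ^ 2)).
  { apply (summable_gauss j t 1); auto. intros n. set (m := IZR (2 * n + j)).
    assert (Hg := gw_pos t (2 * n + j)). assert (H := pow2_ge_0 m).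
    rewrite Rabs_right; nra. }
  destruct (summable_hsum _ S1) as [l Hl]. destruct (summable_hsum _ S2) as [M HM].
  exists l. apply is_derive_quad with M. intros h.
  apply (hsum_Rabs_le (fun n => (gw t (2 * n + j) * cos (IZR (2 * n + j) * (y + h))
      + -1 * (gw t (2 * n + j) * cos (IZR (2 * n + j) * y)))
      + (- h) * (- (gw t (2 * n + j) * IZR (2 * n + j) * sin (IZR (2 * n + j) * y))))
      (fun n => h ^ 2 * (gw t (2 * n + j) * IZR (2 * n + j) ^ 2))).
  - intros n. set (m := IZR (2 * n + j)). assert (Hg := gw_pos t (2 * n + j)).
    replace (_ + _) with (gw t (2 * n + j) * (cos (m * y + m * h) - cos (m * y) + (m * h) * sin (m * y)))
      by (replace (m * (y + h)) with (m * y + m * h) by ring; ring).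
    rewrite Rabs_mult, Rabs_right by lra.
    apply Rle_trans with (gw t (2 * n + j) * (m * h) ^ 2); [|right; ring].
    apply Rmult_le_compat_l; [lra | apply cos_taylor1].
  - replace (th j t (y + h) - th j t y - h * l) with ((th j t (y + h) + -1 * th j t y) + (- h) * l) by ring.
    apply hsum_plus; [apply hsum_plus; [now apply th_hsum | apply hsum_scal; now apply th_hsum] | now apply hsum_scal].
  - rewrite (Rmult_comm M). now apply hsum_scal.
Qed.

Lemma Rabs_exp_sub_le a b : a <= 0 -> b <= 0 -> Rabs (exp a - exp b) <= Rabs (a - b).
Proof.
  intros Ha Hb.
  destruct (MVT_gen exp b a exp) as [c [Hc1 Hc]].
  - intros; apply is_derive_exp.
  - intros; apply derivable_continuous, derivable_exp.
  - rewrite Hc, Rabs_mult, (Rabs_right (exp c)) by (apply Rle_ge, Rlt_le, exp_pos).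
    assert (exp c <= 1).
    { rewrite <- exp_0.
      destruct (Req_dec c 0) as [->|Hn]; [lra|]. left; apply exp_increasing.
      revert Hc1. unfold Rmin, Rmax; destruct (Rle_dec b a); lra. }
    assert (H1 := Rabs_pos (a - b)). nra.
Qed.

(** Lipschitz bound near t: the weight at t / 2 is factored out, and the remaining exponents are
    nonpositive, where exp is 1-Lipschitz. *)
Lemma continuity_th_param j t : 0 < t -> continuity_pt (fun s => th j s 0) t.
Proof.
  intros Ht. set (t0 := t / 2).
  assert (Ht0 : 0 < t0) by (unfold t0; lra).
  assert (S2 : summable (fun n => gw t0 (2 * n + j) * IZR (2 * n + j) ^ 2)).
  { apply (summable_gauss j t0 1); auto. intros n. set (m := IZR (2 * n + j)).
    assert (Hg := gw_pos t0 (2 * n + j)). assert (H := pow2_ge_0 m).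
    rewrite Rabs_right; nra. }
  destruct (summable_hsum _ S2) as [M HM].
  assert (Hlip : forall s, t0 < s -> Rabs (th j s 0 - th j t 0) <= Rabs (s - t) * M).
  { intros s Hs. unfold t0 in Hs.
    apply (hsum_Rabs_le (fun n => gw s (2 * n + j) * cos (IZR (2 * n + j) * 0)
             + -1 * (gw t (2 * n + j) * cos (IZR (2 * n + j) * 0)))
            (fun n => Rabs (s - t) * (gw t0 (2 * n + j) * IZR (2 * n + j) ^ 2))).
    - intros n. set (m := (2 * n + j)%Z). rewrite Rmult_0_r, cos_0, !Rmult_1_r.
      assert (Hm := pow2_ge_0 (IZR m)).
      assert (E : forall r, gw r m = gw t0 m * exp (- ((r - t0) * IZR m ^ 2))).
      { intros r; unfold gw. rewrite <- exp_plus. f_equal; ring. }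
      rewrite (E s), (E t).
      replace (_ + _) with (gw t0 m * (exp (- ((s - t0) * IZR m ^ 2)) - exp (- ((t - t0) * IZR m ^ 2)))) by ring.
      assert (Hg := gw_pos t0 m). rewrite Rabs_mult, (Rabs_right (gw t0 m)) by lra.
      replace (Rabs (s - t) * (gw t0 m * IZR m ^ 2)) with (gw t0 m * (Rabs (s - t) * IZR m ^ 2)) by ring.
      apply Rmult_le_compat_l; [lra|].
      eapply Rle_trans; [apply Rabs_exp_sub_le; unfold t0; nra|].
      right. replace (- ((s - t0) * IZR m ^ 2) - - ((t - t0) * IZR m ^ 2)) with (- ((s - t) * IZR m ^ 2)) by ring.
      rewrite Rabs_Ropp, Rabs_mult, (Rabs_right (IZR m ^ 2)) by lra. reflexivity.
    - replace (th j s 0 - th j t 0) with (th j s 0 + -1 * th j t 0) by ring.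
      apply hsum_plus; [apply th_hsum; lra | apply hsum_scal, th_hsum; lra].
    - now apply hsum_scal. }
  intros eps He.
  assert (HM' := Rabs_pos M).
  exists (Rmin t0 (eps / (Rabs M + 1))). split.
  - apply Rmin_glb_lt; [lra | apply Rdiv_lt_0_compat; lra].
  - intros s [_ Hs]. simpl in Hs |- *. unfold R_dist in *.
    assert (Hs1 : Rabs (s - t) < t0) by (eapply Rlt_le_trans; [exact Hs | apply Rmin_l]).
    assert (Hs2 : Rabs (s - t) < eps / (Rabs M + 1)) by (eapply Rlt_le_trans; [exact Hs | apply Rmin_r]).
    eapply Rle_lt_trans; [apply Hlip|].
    + revert Hs1. unfold t0, Rabs; destruct Rcase_abs; lra.
    + apply Rle_lt_trans with (Rabs (s - t) * (Rabs M + 1)).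
      * apply Rmult_le_compat_l; [apply Rabs_pos | assert (H := Rle_abs M); lra].
      * apply Rlt_le_trans with (eps / (Rabs M + 1) * (Rabs M + 1)).
        -- apply Rmult_lt_compat_r; lra.
        -- right; field; lra.
Qed.

(** * Theta series for large parameter *)

(** Induction along cos ((m + 2) z) = 2 cos ((m + 1) z) cos z - cos (m z). The factor cos z makes
    every term of th 1 comparable to the leading one, even near its zeros. *)
Lemma Rabs_cos_odd_le (n : Z) z : Rabs (cos (IZR (2 * n + 1) * z)) <= Rabs (IZR (2 * n + 1)) * Rabs (cos z).
Proof.
  assert (H : forall k : nat, Rabs (cos (IZR (2 * Z.of_nat k + 1) * z)) <= IZR (2 * Z.of_nat k + 1) * Rabs (cos z)).
  { induction k as [|k IH].
    - simpl. rewrite !Rmult_1_l. lra.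
    - set (m := IZR (2 * Z.of_nat k + 1)) in *.
      replace (IZR (2 * Z.of_nat (S k) + 1)) with (m + 2)
        by (unfold m; rewrite Nat2Z.inj_succ, !plus_IZR, !mult_IZR, succ_IZR; ring).
      replace (cos ((m + 2) * z)) with (2 * (cos ((m + 1) * z) * cos z) - cos (m * z)).
      2:{ replace ((m + 2) * z) with ((m + 1) * z + z) by ring.
          replace (m * z) with ((m + 1) * z - z) by ring.
          rewrite cos_plus, cos_minus. ring. }
      assert (H1 := Rabs_cos_le ((m + 1) * z)).
      assert (H2 := Rabs_triang (2 * (cos ((m + 1) * z) * cos z)) (- cos (m * z))).
      rewrite Rabs_Ropp, !Rabs_mult, (Rabs_right 2) in H2 by lra.
      assert (H3 := Rabs_pos (cos z)). unfold Rminus. nra. }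
  destruct (Z_le_gt_dec 0 n) as [Hn|Hn].
  - specialize (H (Z.to_nat n)). rewrite Z2Nat.id in H by lia.
    rewrite (Rabs_right (IZR (2 * n + 1))); [exact H | apply Rle_ge, IZR_le; lia].
  - specialize (H (Z.to_nat (- n - 1))). rewrite Z2Nat.id in H by lia.
    replace (2 * (- n - 1) + 1)%Z with (- (2 * n + 1))%Z in H by ring.
    rewrite opp_IZR in H. rewrite (Rabs_left (IZR (2 * n + 1))) by (apply IZR_lt; lia).
    rewrite <- cos_neg. replace (- (IZR (2 * n + 1) * z)) with (- IZR (2 * n + 1) * z) by ring. exact H.
Qed.

Lemma exp_small_eventually C : exists T, 1 <= T /\ forall t, T <= t -> C * exp (2 - t) <= / 2.
Proof.
  exists (Rmax 1 (2 + 2 * Rabs C)). split; [apply Rmax_l|]. intros t Ht.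
  assert (H1 := Rle_trans _ _ _ (Rmax_r _ _) Ht).
  assert (HC := Rabs_pos C). assert (HC' := Rle_abs C).
  assert (H2 := exp_ge_lin (t - 2)).
  assert (E : exp (2 - t) * exp (t - 2) = 1) by (rewrite <- exp_plus, <- exp_0; f_equal; ring).
  assert (H3 := exp_pos (2 - t)). nra.
Qed.

Lemma gw_large t m : 1 <= t -> (1 <= IZR m ^ 2)%R -> gw t m <= exp (1 - t) * gw 1 m.
Proof.
  intros Ht Hm. unfold gw. rewrite <- exp_plus.
  assert (H : - (t * IZR m ^ 2) <= 1 - t + - (1 * IZR m ^ 2)) by nra.
  destruct H as [H|H]; [left; now apply exp_increasing | rewrite H; lra].
Qed.

(** The exponent gains (t - 1) m^2 >= 2 (t - 1). One factor exp (- t) matches the leading term of th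
    1, the other makes the remainder relatively small. *)
Lemma gw_large_odd t m : 1 <= t -> (2 <= IZR m ^ 2)%R -> gw t m <= exp (- t) * exp (2 - t) * gw 1 m.
Proof.
  intros Ht Hm. unfold gw. rewrite <- !exp_plus.
  assert (H : - (t * IZR m ^ 2) <= - t + (2 - t) + - (1 * IZR m ^ 2)) by nra.
  destruct H as [H|H]; [left; now apply exp_increasing | rewrite H; lra].
Qed.

Lemma th0_large : exists T, 1 <= T /\ forall t, T <= t -> forall y, Rabs (th 0 t y - 1) <= / 2.
Proof.
  assert (HC : summable (fun n => (1 + IZR (2 * n + 0) ^ 2) * gw 1 (2 * n + 0))).
  { apply (summable_inj (fun n => 2 * n + 0)%Z (fun m => (1 + IZR m ^ 2) * gw 1 m)); [intros; lia|].
    apply summable_gauss_quad; lra. }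
  destruct (summable_hsum _ HC) as [C HC'].
  destruct (exp_small_eventually C) as [T [HT1 HT]]. exists T. split; [exact HT1|].
  intros t Ht y. apply Rle_trans with (2 := HT t Ht). rewrite Rmult_comm.
  apply (hsum_Rabs_le (fun n => gw t (2 * n + 0) * cos (IZR (2 * n + 0) * y)
            + -1 * (if Z.eq_dec n 0 then 1 else 0))
          (fun n => exp (2 - t) * ((1 + IZR (2 * n + 0) ^ 2) * gw 1 (2 * n + 0)))).
  - intros n. assert (Hg1 := gw_pos 1 (2 * n + 0)). assert (He := exp_pos (2 - t)).
    destruct (Z.eq_dec n 0) as [->|Hn].
    + unfold gw at 1. simpl Z.mul. simpl Z.add. rewrite Rmult_0_l, cos_0.
      replace (- (t * 0 ^ 2)) with 0 by ring. rewrite exp_0.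
      replace (1 * 1 + -1 * 1) with 0 by ring. rewrite Rabs_R0.
      apply Rmult_le_pos; [lra|]. apply Rmult_le_pos; [assert (H := pow2_ge_0 0); lra | left; apply gw_pos].
    + rewrite Rmult_0_r, Rplus_0_r.
      eapply Rle_trans; [apply Rabs_mult_trig_le with (x := 0); [apply gw_pos | apply Rabs_cos_le]|].
      set (m := (2 * n + 0)%Z) in *.
      assert (Hm : 1 <= IZR m ^ 2).
      { replace (IZR m ^ 2) with (IZR (m * m)) by (rewrite mult_IZR; ring). apply IZR_le. unfold m; nia. }
      assert (H1 := gw_large t m ltac:(lra) Hm).
      assert (H2 : exp (1 - t) <= exp (2 - t)) by (left; apply exp_increasing; lra).
      assert (H3 : exp (1 - t) * gw 1 m <= exp (2 - t) * gw 1 m) by (apply Rmult_le_compat_r; lra).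
      apply Rle_trans with (exp (2 - t) * gw 1 m); [lra|].
      apply Rmult_le_compat_l; [lra|]. nra.
  - replace (th 0 t y - 1) with (th 0 t y + -1 * 1) by ring.
    apply hsum_plus; [apply th_hsum; lra | apply hsum_scal, hsum_Kronecker].
  - now apply hsum_scal.
Qed.

(** The terms n = 0 and n = -1, of frequencies 1 and -1, give 2 exp (- t) cos z. The error is
    relative to cos z, so the sign of th 1 is known on the whole interval between two zeros. *)
Lemma th1_large : exists T, 1 <= T /\ forall t, T <= t -> forall z,
  Rabs (th 1 t z - 2 * exp (- t) * cos z) <= exp (- t) * Rabs (cos z).
Proof.
  assert (HC : summable (fun n => (1 + IZR (2 * n + 1) ^ 2) * gw 1 (2 * n + 1))).
  { apply (summable_inj (fun n => 2 * n + 1)%Z (fun m => (1 + IZR m ^ 2) * gw 1 m)); [intros; lia|].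
    apply summable_gauss_quad; lra. }
  destruct (summable_hsum _ HC) as [C HC'].
  destruct (exp_small_eventually C) as [T [HT1 HT]]. exists T. split; [exact HT1|].
  intros t Ht z. assert (Hc := Rabs_pos (cos z)). assert (Het := exp_pos (- t)).
  apply Rle_trans with (exp (- t) * exp (2 - t) * Rabs (cos z) * C).
  2:{ specialize (HT t Ht).
      replace (exp (- t) * exp (2 - t) * Rabs (cos z) * C) with (exp (- t) * Rabs (cos z) * (C * exp (2 - t))) by ring.
      assert (0 <= exp (- t) * Rabs (cos z)) by (apply Rmult_le_pos; lra). nra. }
  apply (hsum_Rabs_le (fun n => gw t (2 * n + 1) * cos (IZR (2 * n + 1) * z)
            + - (exp (- t) * cos z) * ((if Z.eq_dec n 0 then 1 else 0) + (if Z.eq_dec n (-1) then 1 else 0)))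
          (fun n => exp (- t) * exp (2 - t) * Rabs (cos z) * ((1 + IZR (2 * n + 1) ^ 2) * gw 1 (2 * n + 1)))).
  - intros n. assert (Hg1 := gw_pos 1 (2 * n + 1)). assert (He := exp_pos (2 - t)).
    assert (Hpos : 0 <= exp (- t) * exp (2 - t) * Rabs (cos z)) by (repeat apply Rmult_le_pos; lra).
    assert (Hsm : (n = 0 \/ n = -1 \/ (1 <= n \/ n <= -2))%Z) by lia.
    assert (Hz : forall m, 0 <= exp (- t) * exp (2 - t) * Rabs (cos z) * ((1 + IZR m ^ 2) * gw 1 m)).
    { intros m. apply Rmult_le_pos; [exact Hpos|]. apply Rmult_le_pos; [assert (H := pow2_ge_0 (IZR m)); lra | left; apply gw_pos]. }
    destruct Hsm as [->|[->|Hn]].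
    + simpl Z.mul. simpl Z.add. simpl Z.eq_dec.
      replace (gw t 1) with (exp (- t)) by (unfold gw; f_equal; simpl; ring).
      replace (exp (- t) * cos (1 * z) + _) with 0 by (rewrite Rmult_1_l; destruct (Z.eq_dec 0 0); [|lia]; destruct (Z.eq_dec 0 (-1)); [lia|]; ring).
      rewrite Rabs_R0. apply Hz.
    + simpl Z.mul. simpl Z.add.
      replace (gw t (-1)) with (exp (- t)) by (unfold gw; f_equal; simpl; ring).
      replace (exp (- t) * cos (-1 * z) + _) with 0.
      2:{ replace (-1 * z) with (- z) by ring. rewrite cos_neg.
          destruct (Z.eq_dec (-1) 0); [lia|]; destruct (Z.eq_dec (-1) (-1)); [|lia]; ring. }
      rewrite Rabs_R0. apply Hz.
    + destruct (Z.eq_dec n 0); [lia|]; destruct (Z.eq_dec n (-1)); [lia|].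
      rewrite Rplus_0_r, Rmult_0_r, Rplus_0_r.
      set (m := IZR (2 * n + 1)) in *.
      assert (Hm : 2 <= m ^ 2).
      { unfold m. replace (IZR (2 * n + 1) ^ 2) with (IZR ((2 * n + 1) * (2 * n + 1))) by (rewrite mult_IZR; ring).
        apply IZR_le. nia. }
      assert (H1 := gw_large_odd t (2 * n + 1) ltac:(lra) Hm).
      rewrite Rabs_mult, (Rabs_right (gw t _)) by (apply Rle_ge, Rlt_le, gw_pos).
      assert (H2 := Rabs_cos_odd_le n z). fold m in H2.
      assert (H3 : Rabs m <= 1 + m ^ 2) by (unfold Rabs; destruct Rcase_abs; nra).
      assert (H4 := gw_pos t (2 * n + 1)).
      apply Rle_trans with (gw t (2 * n + 1) * ((1 + m ^ 2) * Rabs (cos z))).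
      * apply Rmult_le_compat_l; [lra|]. apply Rle_trans with (1 := H2).
        apply Rmult_le_compat_r; lra.
      * replace (exp (- t) * exp (2 - t) * Rabs (cos z) * ((1 + m ^ 2) * gw 1 (2 * n + 1)))
          with (exp (- t) * exp (2 - t) * gw 1 (2 * n + 1) * ((1 + m ^ 2) * Rabs (cos z))) by ring.
        apply Rmult_le_compat_r; [apply Rmult_le_pos; nra | exact H1].
  - replace (th 1 t z - 2 * exp (- t) * cos z) with (th 1 t z + - (exp (- t) * cos z) * (1 + 1)) by ring.
    apply hsum_plus; [apply th_hsum; lra | apply hsum_scal].
    apply hsum_plus; apply hsum_Kronecker.
  - now apply hsum_scal.
Qed.

(** * Bilinear theta identities *)

Lemma th1_subPI t y : 0 < t -> th 1 t (y - PI) = - th 1 t y.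
Proof.
  intros Ht. assert (H := th1_PI t (y - PI) Ht).
  replace (y - PI + PI) with y in H by ring. lra.
Qed.

Lemma th0_sq t y : 0 < t ->
  th 0 t y ^ 2 = th 0 (2 * t) (2 * y) * th 0 (2 * t) 0 + th 1 (2 * t) (2 * y) * th 1 (2 * t) 0.
Proof.
  intros Ht. assert (H := th0_double t y 0 Ht).
  rewrite Rplus_0_r, Rminus_0_r, Rmult_0_r in H. rewrite <- H; ring.
Qed.

Lemma th1_sq t y : 0 < t ->
  th 1 t y ^ 2 = th 0 (2 * t) (2 * y) * th 1 (2 * t) 0 + th 1 (2 * t) (2 * y) * th 0 (2 * t) 0.
Proof.
  intros Ht. assert (H := th1_double t y 0 Ht).
  rewrite Rplus_0_r, Rminus_0_r, Rmult_0_r in H. rewrite <- H; ring.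
Qed.

(** Shifting x by PI / 2 shifts 2 x by PI, which flips only the sign of th 1. *)
Lemma th4_double t x y : 0 < t -> th 0 t (x + y + PI / 2) * th 0 t (x - y + PI / 2) =
  th 0 (2 * t) (2 * x) * th 0 (2 * t) (2 * y) - th 1 (2 * t) (2 * x) * th 1 (2 * t) (2 * y).
Proof.
  intros Ht. assert (H := th0_double t (x + PI / 2) y Ht).
  replace (2 * (x + PI / 2)) with (2 * x + PI) in H by field.
  rewrite th0_PI, th1_PI in H by lra.
  replace (x + PI / 2 + y) with (x + y + PI / 2) in H by ring.
  replace (x + PI / 2 - y) with (x - y + PI / 2) in H by ring.
  rewrite H; ring.
Qed.

Lemma th4_sq t y : 0 < t ->
  th 0 t (y + PI / 2) ^ 2 = th 0 (2 * t) (2 * y) * th 0 (2 * t) 0 - th 1 (2 * t) (2 * y) * th 1 (2 * t) 0.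
Proof.
  intros Ht. assert (H := th4_double t y 0 Ht).
  rewrite Rplus_0_r, Rminus_0_r, Rmult_0_r in H. rewrite <- H; ring.
Qed.

Lemma th1s_sq t y : 0 < t ->
  th 1 t (y - PI / 2) ^ 2 = th 0 (2 * t) (2 * y) * th 1 (2 * t) 0 - th 1 (2 * t) (2 * y) * th 0 (2 * t) 0.
Proof.
  intros Ht. rewrite th1_sq by auto.
  replace (2 * (y - PI / 2)) with (2 * y - PI) by field.
  rewrite th1_subPI by lra. rewrite <- (th0_PI (2 * t) (2 * y - PI)) by lra.
  replace (2 * y - PI + PI) with (2 * y) by ring. ring.
Qed.

(** Jacobi's product formula for theta_4 (x + y) theta_4 (x - y). Every factor is expressed by
    values at 2 t, where the claim is a polynomial identity. It is the source of the addition
    formula for Z. *)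
Lemma th4_mul_formula t x y : 0 < t ->
  th 0 t (PI / 2) ^ 2 * (th 0 t (x + y + PI / 2) * th 0 t (x - y + PI / 2)) =
  th 0 t (x + PI / 2) ^ 2 * th 0 t (y + PI / 2) ^ 2 - th 1 t (x - PI / 2) ^ 2 * th 1 t (y - PI / 2) ^ 2.
Proof.
  intros Ht. rewrite th4_double, !th4_sq, !th1s_sq by auto.
  replace (PI / 2) with (0 + PI / 2) by ring. rewrite th4_sq by auto.
  rewrite Rmult_0_r. ring.
Qed.

(** Subtracting two instances of the doubling formula leaves a single product on the right. That
    product locates the zeros of th 1 and yields the Wronskian of theta_1 and theta_4. *)
Lemma th_zero_sum t X Y : 0 < t ->
  th 1 t X * th 1 t Y - th 1 t (X - PI / 2) * th 1 t (Y - PI / 2) =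
  2 * (th 1 (2 * t) (X + Y) * th 0 (2 * t) (X - Y)).
Proof.
  intros Ht.
  assert (H := th1_double t ((X + Y) / 2) ((X - Y) / 2) Ht).
  assert (H' := th1_double t ((X + Y) / 2 - PI / 2) ((X - Y) / 2) Ht).
  replace ((X + Y) / 2 + (X - Y) / 2) with X in H by field.
  replace ((X + Y) / 2 - (X - Y) / 2) with Y in H by field.
  replace ((X + Y) / 2 - PI / 2 + (X - Y) / 2) with (X - PI / 2) in H' by field.
  replace ((X + Y) / 2 - PI / 2 - (X - Y) / 2) with (Y - PI / 2) in H' by field.
  replace (2 * ((X - Y) / 2)) with (X - Y) in * by field.
  replace (2 * ((X + Y) / 2)) with (X + Y) in * by field.
  replace (2 * ((X + Y) / 2 - PI / 2)) with (X + Y - PI) in * by field.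
  rewrite th1_subPI in H' by lra.
  rewrite <- (th0_PI (2 * t) (X + Y - PI)) in H' by lra.
  replace (X + Y - PI + PI) with (X + Y) in H' by ring.
  rewrite H, H'; ring.
Qed.

(* The duplication formula [theta_3 theta_4 (y|q) = theta_4 (2y|q^2) theta_4 (0|q^2)], squared. *)
Lemma th34_dup_sq t y : 0 < t ->
  (th 0 t y * th 0 t (y + PI / 2)) ^ 2 = (th 0 (2 * t) (2 * y + PI / 2) * th 0 (2 * t) (PI / 2)) ^ 2.
Proof.
  intros Ht. assert (Ht2 : 0 < 2 * t) by lra.
  rewrite !Rpow_mult_distr, th0_sq, th4_sq, th4_sq by lra.
  replace (PI / 2) with (0 + PI / 2) by ring. rewrite th4_sq by lra.
  replace (_ * _) with (th 0 (2 * t) (2 * y) ^ 2 * th 0 (2 * t) 0 ^ 2 - th 1 (2 * t) (2 * y) ^ 2 * th 1 (2 * t) 0 ^ 2) by ring.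
  rewrite !th0_sq, !th1_sq by lra. rewrite !Rmult_0_r. ring.
Qed.

(** Some 2^n t lies beyond T; the property then descends n times by halving. *)
Lemma halving_induction (P : R -> Prop) :
  (exists T, forall t, T <= t -> P t) -> (forall t, 0 < t -> P (2 * t) -> P t) ->
  forall t, 0 < t -> P t.
Proof.
  intros [T HT] Hs t Ht.
  assert (Hn : forall n t, 0 < t -> P (2 ^ n * t) -> P t).
  { clear t Ht. induction n as [|n IH]; intros t Ht H.
    - simpl in H. now rewrite Rmult_1_l in H.
    - apply Hs; auto. apply IH; [lra|]. replace (2 ^ n * (2 * t)) with (2 ^ S n * t) by (simpl; ring). exact H. }
  destruct (Pow_x_infinity 2 ltac:(rewrite Rabs_right; lra) (T / t)) as [N HN].
  apply (Hn N t Ht). apply HT. specialize (HN N (le_n N)).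
  rewrite Rabs_right in HN by (apply Rle_ge, pow_le; lra).
  apply Rge_le in HN. apply Rmult_le_compat_r with (r := t) in HN; [|lra].
  unfold Rdiv in HN. rewrite Rmult_assoc, Rinv_l, Rmult_1_r in HN by lra. exact HN.
Qed.

(** By the duplication formula a zero at t would force a zero at 2 t, and there is none for large
    t. *)
Lemma th0_neq0 t : 0 < t -> forall y, th 0 t y <> 0.
Proof.
  generalize t; apply (halving_induction (fun t => forall y, th 0 t y <> 0)); clear t.
  - destruct th0_large as [T [_ HT]]. exists T. intros t Ht y E.
    specialize (HT t Ht y). rewrite E in HT. revert HT; unfold Rabs; destruct Rcase_abs; lra.
  - intros t Ht H y E. assert (K := th34_dup_sq t y Ht).
    rewrite E, Rmult_0_l in K.
    apply (pow_nonzero (th 0 (2 * t) (2 * y + PI / 2) * th 0 (2 * t) (PI / 2)) 2).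
    + apply Rmult_integral_contrapositive_currified; apply H.
    + rewrite <- K; ring.
Qed.

Lemma th_at0_pos j t : 0 < t -> 0 < th j t 0.
Proof.
  intros Ht. apply Rlt_le_trans with (gw t j); [apply gw_pos|].
  apply (hsum_le (fun n => gw t j * (if Z.eq_dec n 0 then 1 else 0))
     (fun n => gw t (2 * n + j) * cos (IZR (2 * n + j) * 0))).
  - intros n. rewrite Rmult_0_r, cos_0. destruct (Z.eq_dec n 0) as [->|Hn].
    + simpl (2 * 0 + j)%Z. lra.
    + assert (H := gw_pos t (2 * n + j)). lra.
  - assert (H := hsum_scal (gw t j) _ _ (hsum_Kronecker 0)). now rewrite Rmult_1_r in H.
  - now apply th_hsum.
Qed.

Lemma continuity_th j t y : 0 < t -> continuity_pt (th j t) y.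
Proof.
  intros Ht. apply continuity_pt_filterlim.
  apply (ex_derive_continuous (th j t) y). now apply ex_derive_th.
Qed.

Lemma pos_of_no_zero (f : R -> R) a b : a <= b ->
  (forall x, a <= x <= b -> continuity_pt f x) ->
  (forall x, a <= x <= b -> f x <> 0) -> 0 < f a -> 0 < f b.
Proof.
  intros Hab Hc Hz Ha. destruct (Rtotal_order (f b) 0) as [H|[H|H]]; [|exfalso|exact H].
  - exfalso. destruct Hab as [Hab|Hab]; [|subst; lra].
    destruct (IVT_interv (fun x => - f x) a b) as [z [Hz1 Hz2]].
    + intros x Hx. apply continuity_pt_opp, Hc, Hx.
    + exact Hab.
    + lra.
    + lra.
    + apply (Hz z Hz1). lra.
  - apply (Hz b); [lra | exact H].
Qed.

Lemma th0_pos t y : 0 < t -> 0 < th 0 t y.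
Proof.
  intros Ht.
  assert (H : forall z, 0 <= z -> 0 < th 0 t z).
  { intros z Hz. apply (pos_of_no_zero (th 0 t) 0 z); auto.
    - intros; now apply continuity_th.
    - intros; now apply th0_neq0.
    - now apply th_at0_pos. }
  destruct (Rle_lt_dec 0 y); [now apply H|].
  rewrite <- th_opp by auto. apply H; lra.
Qed.

Lemma th1_neq0 t : 0 < t -> forall z, - (PI / 2) < z < PI / 2 -> th 1 t z <> 0.
Proof.
  generalize t; apply (halving_induction (fun t => forall z, - (PI / 2) < z < PI / 2 -> th 1 t z <> 0)); clear t.
  - destruct th1_large as [T [_ HT]]. exists T. intros t Ht z Hz E.
    specialize (HT t Ht z). rewrite E in HT. assert (Hc := cos_gt_0 z ltac:(lra) ltac:(lra)).
    assert (He := exp_pos (- t)). rewrite (Rabs_right (cos z)), Rabs_left in HT by nra. nra.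
  - intros t Ht H.
    (* For 0 < z < PI / 2 the identity with X = z and Y = z - PI / 2 becomes a duplication formula,
       and 2 z - PI / 2 lies again in the interval where th 1 at 2 t has no zero. *)
    assert (Hp : forall z, 0 < z < PI / 2 -> th 1 t z <> 0).
    { intros z Hz E. assert (K := th_zero_sum t z (z - PI / 2) Ht).
      replace (z - PI / 2 - PI / 2) with (z - PI) in K by field.
      rewrite th1_subPI, E in K by auto.
      replace (z + (z - PI / 2)) with (2 * z - PI / 2) in K by ring.
      replace (z - (z - PI / 2)) with (PI / 2) in K by ring.
      assert (K1 : th 1 (2 * t) (2 * z - PI / 2) * th 0 (2 * t) (PI / 2) <> 0).
      { apply Rmult_integral_contrapositive_currified; [apply H; lra | apply th0_neq0; lra]. }
      lra. }
    intros z Hz. destruct (Rtotal_order z 0) as [Hz0|[->|Hz0]].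
    + rewrite <- th_opp by auto. apply Hp; lra.
    + apply Rgt_not_eq, th_at0_pos, Ht.
    + apply Hp; lra.
Qed.

Lemma th1_pos t z : 0 < t -> - (PI / 2) < z < PI / 2 -> 0 < th 1 t z.
Proof.
  intros Ht.
  assert (H : forall z, 0 <= z < PI / 2 -> 0 < th 1 t z).
  { intros w Hw. apply (pos_of_no_zero (th 1 t) 0 w); try lra.
    - intros; now apply continuity_th.
    - intros; apply th1_neq0; lra.
    - now apply th_at0_pos. }
  intros Hz. destruct (Rle_lt_dec 0 z); [apply H; lra|].
  rewrite <- th_opp by auto. apply H; lra.
Qed.

Lemma th1_PI2 t : 0 < t -> th 1 t (PI / 2) = 0.
Proof.
  intros Ht. assert (H := th1_PI t (- (PI / 2)) Ht).
  rewrite th_opp in H by auto. replace (- (PI / 2) + PI) with (PI / 2) in H by field. lra.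
Qed.

Lemma th4_0_dup t : 0 < t -> th 0 (2 * t) (PI / 2) ^ 2 = th 0 t 0 * th 0 t (PI / 2).
Proof.
  intros Ht. assert (H := th34_dup_sq t 0 Ht). rewrite Rmult_0_r, !Rplus_0_l in H.
  assert (H1 := th0_pos t 0 Ht). assert (H2 := th0_pos t (PI / 2) Ht).
  assert (H3 := th0_pos (2 * t) (PI / 2) ltac:(lra)).
  assert (H4 : 0 < th 0 t 0 * th 0 t (PI / 2)) by nra.
  assert (H5 : 0 < th 0 (2 * t) (PI / 2) ^ 2) by (apply pow_lt; exact H3).
  nra.
Qed.

Lemma th3_0_dup t : 0 < t -> th 0 t 0 ^ 2 = th 0 (2 * t) 0 ^ 2 + th 1 (2 * t) 0 ^ 2.
Proof. intros Ht. rewrite th0_sq, Rmult_0_r by auto. ring. Qed.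

Lemma th2_0_dup t : 0 < t -> th 1 t 0 ^ 2 = 2 * th 0 (2 * t) 0 * th 1 (2 * t) 0.
Proof. intros Ht. rewrite th1_sq, Rmult_0_r by auto. ring. Qed.

Lemma th4_0_dup' t : 0 < t -> th 0 t (PI / 2) ^ 2 = th 0 (2 * t) 0 ^ 2 - th 1 (2 * t) 0 ^ 2.
Proof.
  intros Ht. replace (PI / 2) with (0 + PI / 2) by ring. rewrite th4_sq, Rmult_0_r by auto. ring.
Qed.

(** * Theta quotients *)

Lemma is_derive_even_0 (f : R -> R) l : (forall x, f (- x) = f x) -> is_derive f 0 l -> l = 0.
Proof.
  intros He Hd.
  assert (H : is_derive (fun x => f (- x)) 0 (- l)).
  { evar_last.
    - apply (is_derive_comp f (fun x => - x) 0 l (- (1))).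
      + now rewrite Ropp_0.
      + auto_derive; auto.
    - unfold scal; simpl; unfold mult; simpl. ring. }
  apply is_derive_ext with (g := f) in H; [|exact He].
  assert (E := is_derive_unique _ _ _ Hd). assert (E' := is_derive_unique _ _ _ H). lra.
Qed.

(** The constant theta_1'(0) / theta_2 (0) at the parameter t / 2, which turns out to be the factor
    in the Wronskian of theta_1 and theta_4. *)
Definition mu (t : R) : R := Derive (th 1 (t / 2)) (- (PI / 2)) / th 1 (t / 2) 0.

(** With s added in one factor and subtracted in the other, the s-derivative of theta_1 theta_4 at 0
    is the Wronskian. At parameter t / 2 the same product is a sum of two terms, one of which has
    zero derivative because th 1 is even. *)
Lemma th_wronskian t x : 0 < t ->
  Derive (th 1 t) (x - PI / 2) * th 0 t (x + PI / 2) - th 1 t (x - PI / 2) * Derive (th 0 t) (x + PI / 2)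
  = mu t * (th 1 t x * th 0 t x).
Proof.
  intros Ht. set (r := t / 2). assert (Hr : 0 < r) by (unfold r; lra).
  assert (Er : t = 2 * r) by (unfold r; field).
  assert (E : forall s, 2 * (th 1 t (x - PI / 2 + s) * th 0 t (x + PI / 2 - s)) =
     th 1 r (x - PI / 2) * th 1 r s + th 1 r x * th 1 r (s - PI / 2)).
  { intros s. assert (H := th_zero_sum r (x - PI / 2) s Hr). rewrite <- Er in H.
    replace (x - PI / 2 - PI / 2) with (x - PI) in H by field.
    rewrite th1_subPI in H by auto.
    rewrite <- (th0_PI t (x - PI / 2 - s)) in H by auto.
    replace (x - PI / 2 - s + PI) with (x + PI / 2 - s) in H by field. lra. }
  assert (H0 : Derive (th 1 r) 0 = 0).
  { apply (is_derive_even_0 (th 1 r)); [intros; now apply th_opp|].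
    apply Derive_correct. now apply ex_derive_th. }
  assert (D1 : is_derive (fun s => 2 * (th 1 t (x - PI / 2 + s) * th 0 t (x + PI / 2 - s))) 0
    (2 * (Derive (th 1 t) (x - PI / 2) * th 0 t (x + PI / 2)
       - th 1 t (x - PI / 2) * Derive (th 0 t) (x + PI / 2)))).
  { auto_derive.
    - repeat split; now apply ex_derive_th.
    - rewrite !Rplus_0_r, Ropp_0, Rplus_0_r. change (fun x0 => th 1 t x0) with (th 1 t). change (fun x0 => th 0 t x0) with (th 0 t). ring. }
  assert (D2 : is_derive (fun s => th 1 r (x - PI / 2) * th 1 r s + th 1 r x * th 1 r (s - PI / 2)) 0
     (th 1 r x * Derive (th 1 r) (- (PI / 2)))).
  { auto_derive.
    - repeat split; now apply ex_derive_th.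
    - rewrite Rplus_0_l. change (fun x0 => th 1 r x0) with (th 1 r). rewrite H0. ring. }
  apply is_derive_ext with (1 := E) in D1.
  assert (E1 := is_derive_unique _ _ _ D1). assert (E2 := is_derive_unique _ _ _ D2).
  assert (E3 := eq_trans (eq_sym E1) E2).
  assert (H1 := th_zero_sum r x 0 Hr). rewrite <- Er in H1.
  rewrite Rplus_0_r, Rminus_0_r, Rminus_0_l, th_opp, th1_PI2 in H1 by auto.
  assert (Hp := th_at0_pos 1 r Hr).
  unfold mu. fold r.
  apply Rmult_eq_reg_l with (2 * th 1 r 0); [|lra].
  transitivity (th 1 r 0 * (th 1 r x * Derive (th 1 r) (- (PI / 2)))); [rewrite <- E3; ring|].
  replace (2 * th 1 r 0 * (Derive (th 1 r) (- (PI / 2)) / th 1 r 0 * (th 1 t x * th 0 t x)))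
     with (Derive (th 1 r) (- (PI / 2)) * (2 * (th 1 t x * th 0 t x))) by (field; lra).
  rewrite <- H1. ring.
Qed.

(* [kap t] is the modulus belonging to the nome [exp (-4 t)], and [lam t] equals [2 K / PI]; see [lam_eq]. *)
Definition lam (t : R) : R := mu t * th 0 t 0 ^ 2 / th 0 t (PI / 2) ^ 2.
Definition kap (t : R) : R := th 1 t 0 ^ 2 / th 0 t 0 ^ 2.

(** These quotients are sn, cn and dn of modulus [kap t] in the rescaled argument [lam t] * y; for
    sn this is [sn_snq]. *)
Definition snq (t y : R) : R := th 0 t 0 / th 1 t 0 * (th 1 t (y - PI / 2) / th 0 t (y + PI / 2)).
Definition cnq (t y : R) : R := th 0 t (PI / 2) / th 1 t 0 * (th 1 t y / th 0 t (y + PI / 2)).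
Definition dnq (t y : R) : R := th 0 t (PI / 2) / th 0 t 0 * (th 0 t y / th 0 t (y + PI / 2)).

Lemma is_derive_snq t y : 0 < t -> is_derive (snq t) y (lam t * cnq t y * dnq t y).
Proof.
  intros Ht. assert (H0 := th_at0_pos 0 t Ht). assert (H1 := th_at0_pos 1 t Ht).
  assert (H4 := th0_pos t (PI / 2) Ht). assert (H5 := th0_pos t (y + PI / 2) Ht).
  unfold snq. auto_derive.
  - repeat split; try (now apply ex_derive_th). lra.
  - assert (W := th_wronskian t y Ht).
    change (fun x => th 1 t x) with (th 1 t). change (fun x => th 0 t x) with (th 0 t).
    unfold Rminus in W.
    set (a := Derive (th 1 t) _) in *. set (b := Derive (th 0 t) _) in *.
    unfold lam, cnq, dnq.
    transitivity (th 0 t 0 / th 1 t 0 * ((a * th 0 t (y + PI / 2) + - (th 1 t (y + - (PI / 2)) * b)) / th 0 t (y + PI / 2) ^ 2)).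
    + field. lra.
    + rewrite W. field. lra.
Qed.

Lemma snq_cnq t y : 0 < t -> snq t y ^ 2 + cnq t y ^ 2 = 1.
Proof.
  intros Ht. assert (H1 := th_at0_pos 1 t Ht). assert (H5 := th0_pos t (y + PI / 2) Ht).
  unfold snq, cnq.
  apply Rmult_eq_reg_r with (th 1 t 0 ^ 2 * th 0 t (y + PI / 2) ^ 2).
  2:{ apply Rgt_not_eq, Rmult_lt_0_compat; apply pow_lt; lra. }
  transitivity (th 0 t 0 ^ 2 * th 1 t (y - PI / 2) ^ 2 + th 0 t (PI / 2) ^ 2 * th 1 t y ^ 2).
  - field. lra.
  - rewrite (th3_0_dup t), (th4_0_dup' t), (th2_0_dup t), (th1s_sq t y), (th1_sq t y), (th4_sq t y) by auto. ring.
Qed.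

Lemma snq_dnq t y : 0 < t -> kap t ^ 2 * snq t y ^ 2 + dnq t y ^ 2 = 1.
Proof.
  intros Ht. assert (H0 := th_at0_pos 0 t Ht). assert (H1 := th_at0_pos 1 t Ht).
  assert (H5 := th0_pos t (y + PI / 2) Ht).
  unfold snq, dnq, kap.
  apply Rmult_eq_reg_r with (th 0 t 0 ^ 2 * th 0 t (y + PI / 2) ^ 2).
  2:{ apply Rgt_not_eq, Rmult_lt_0_compat; apply pow_lt; lra. }
  transitivity (th 1 t 0 ^ 2 * th 1 t (y - PI / 2) ^ 2 + th 0 t (PI / 2) ^ 2 * th 0 t y ^ 2).
  - field. lra.
  - rewrite (th3_0_dup t), (th4_0_dup' t), (th2_0_dup t), (th1s_sq t y), (th0_sq t y), (th4_sq t y) by auto. ring.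
Qed.

Lemma dnq_pos t y : 0 < t -> 0 < dnq t y.
Proof.
  intros Ht. unfold dnq. repeat apply Rmult_lt_0_compat; try apply Rinv_0_lt_compat; now apply th0_pos.
Qed.

Lemma cnq_pos t y : 0 < t -> - (PI / 2) < y < PI / 2 -> 0 < cnq t y.
Proof.
  intros Ht Hy. unfold cnq. repeat apply Rmult_lt_0_compat; try apply Rinv_0_lt_compat;
   first [now apply th0_pos | now apply th1_pos | now apply th_at0_pos].
Qed.

Lemma snq_pos t y : 0 < t -> 0 < y < PI -> 0 < snq t y.
Proof.
  intros Ht Hy. unfold snq. repeat apply Rmult_lt_0_compat; try apply Rinv_0_lt_compat;
   first [now apply th0_pos | now apply th_at0_pos | apply th1_pos; lra].
Qed.

Lemma snq_0 t : 0 < t -> snq t 0 = 0.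
Proof.
  intros Ht. unfold snq. rewrite Rminus_0_l, th_opp, th1_PI2 by auto. unfold Rdiv; ring.
Qed.

Lemma snq_PI2 t : 0 < t -> snq t (PI / 2) = 1.
Proof.
  intros Ht. unfold snq. replace (PI / 2 - PI / 2) with 0 by ring.
  replace (PI / 2 + PI / 2) with (0 + PI) by field. rewrite th0_PI by auto.
  assert (H0 := th_at0_pos 0 t Ht). assert (H1 := th_at0_pos 1 t Ht). field; lra.
Qed.

Lemma kap_pos t : 0 < t -> 0 < kap t.
Proof.
  intros Ht. unfold kap. apply Rdiv_lt_0_compat; apply pow_lt; now apply th_at0_pos.
Qed.

(** With a, b the values of th 0, th 1 at parameter 2 t and argument 0, theta_3^2 - theta_2^2 = (a -
    b)^2, and a <> b because theta_4^2 = a^2 - b^2 does not vanish. *)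
Lemma kap_lt1 t : 0 < t -> kap t < 1.
Proof.
  intros Ht. unfold kap.
  assert (H0 := pow_lt _ 2 (th_at0_pos 0 t Ht)).
  apply Rmult_lt_reg_r with (th 0 t 0 ^ 2); [exact H0|].
  unfold Rdiv. rewrite Rmult_assoc, Rinv_l, Rmult_1_r, Rmult_1_l by lra.
  rewrite th3_0_dup, th2_0_dup by auto.
  assert (H := pow_lt _ 2 (th0_pos t (PI / 2) Ht)). rewrite th4_0_dup' in H by auto.
  assert (th 0 (2 * t) 0 <> th 1 (2 * t) 0) by nra.
  assert (0 < (th 0 (2 * t) 0 - th 1 (2 * t) 0) ^ 2) by (apply pow2_gt_0; lra). nra.
Qed.

Lemma kap_double t : 0 < t -> kap t = 2 * sqrt (kap (2 * t)) / (1 + kap (2 * t)).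
Proof.
  intros Ht. assert (Ht2 : 0 < 2 * t) by lra.
  assert (H0 := th_at0_pos 0 _ Ht2). assert (H1 := th_at0_pos 1 _ Ht2).
  unfold kap at 2.
  replace (th 1 (2 * t) 0 ^ 2 / th 0 (2 * t) 0 ^ 2) with ((th 1 (2 * t) 0 / th 0 (2 * t) 0) ^ 2) by (field; lra).
  rewrite sqrt_pow2 by (left; now apply Rdiv_lt_0_compat).
  unfold kap. rewrite th3_0_dup, th2_0_dup by auto. field. nra.
Qed.

Lemma lam_double t : 0 < t -> lam t = (1 + kap (2 * t)) * lam (2 * t).
Proof.
  intros Ht. assert (Ht2 : 0 < 2 * t) by lra.
  assert (H0 := th_at0_pos 0 _ Ht2). assert (H1 := th_at0_pos 1 _ Ht2).
  assert (K0 := th_at0_pos 0 _ Ht). assert (K1 := th_at0_pos 1 _ Ht).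
  assert (K4 := th0_pos t (PI / 2) Ht).
  (* The Wronskian at x = 0, where theta_1 vanishes, relates the constants at t and 2 t. *)
  assert (E : mu t = mu (2 * t) * th 0 t (PI / 2) / th 0 t 0).
  { assert (W := th_wronskian t 0 Ht).
    rewrite Rplus_0_l, Rminus_0_l, th_opp, th1_PI2, Rmult_0_l, Rminus_0_r in W by auto.
    unfold mu at 2. replace (2 * t / 2) with t by field.
    apply Rmult_eq_reg_r with (th 1 t 0 * th 0 t 0); [|nra].
    rewrite <- W. field. lra. }
  unfold lam. rewrite E, th4_0_dup by auto.
  replace (1 + kap (2 * t)) with (th 0 t 0 ^ 2 / th 0 (2 * t) 0 ^ 2).
  - field. lra.
  - rewrite th3_0_dup by auto. unfold kap. field. lra.
Qed.

(** * Jacobi elliptic functions *)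

Lemma eq_of_Derive_0 (f : R -> R) : (forall x, is_derive f x 0) -> forall a b, f a = f b.
Proof.
  intros H.
  assert (H1 : forall a b, a < b -> f a = f b).
  { intros a b Hab. apply (eq_is_derive f a b); [|exact Hab]. intros; apply H. }
  intros a b. destruct (Rtotal_order a b) as [L|[L|L]]; [now apply H1 | now subst | symmetry; now apply H1].
Qed.

Lemma radicand_bound k th : 0 < k < 1 -> 0 < 1 - k ^ 2 * sin th ^ 2 <= 1.
Proof.
  intros Hk. assert (H := SIN_bound th). assert (0 <= sin th ^ 2 <= 1) by nra.
  assert (0 < k ^ 2 < 1) by nra. nra.
Qed.

Lemma ell_integrand_ge1 k th : 0 < k < 1 -> 1 <= ell_integrand k th.
Proof.
  intros Hk. unfold ell_integrand. assert (H := radicand_bound k th Hk).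
  rewrite <- Rinv_1 at 1. apply Rinv_le_contravar.
  - apply sqrt_lt_R0; lra.
  - rewrite <- sqrt_1 at 2. apply sqrt_le_1_alt; lra.
Qed.

Lemma continuous_ell_integrand k th : 0 < k < 1 -> continuous (ell_integrand k) th.
Proof.
  intros Hk. apply (ex_derive_continuous (ell_integrand k) th).
  unfold ell_integrand. assert (H := radicand_bound k th Hk). auto_derive.
  simpl in H |- *. repeat split; try lra.
  apply Rgt_not_eq, sqrt_lt_R0. simpl in *. lra.
Qed.

Lemma ex_RInt_ell k a b : 0 < k < 1 -> ex_RInt (ell_integrand k) a b.
Proof. intros Hk. apply (ex_RInt_continuous (ell_integrand k)). intros; now apply continuous_ell_integrand. Qed.

Lemma is_derive_ellF k x : 0 < k < 1 -> is_derive (ellF k) x (ell_integrand k x).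
Proof.
  intros Hk. apply (is_derive_RInt (ell_integrand k) (ellF k) 0 x).
  - apply filter_forall. intros b. apply (RInt_correct (ell_integrand k) 0 b). now apply ex_RInt_ell.
  - now apply continuous_ell_integrand.
Qed.

Lemma ellF_0 k : ellF k 0 = 0.
Proof. exact (RInt_point 0 (ell_integrand k)). Qed.

(** The integrand is at least 1. This expansion property gives injectivity and surjectivity of
    [ellF], hence a meaningful [am], and makes [am] 1-Lipschitz and increasing. *)
Lemma ellF_ge k a b : 0 < k < 1 -> a <= b -> b - a <= ellF k b - ellF k a.
Proof.
  intros Hk Hab. destruct (MVT_gen (ellF k) a b (ell_integrand k)) as [c [_ Hc]].
  - intros; now apply is_derive_ellF.
  - intros x _. apply continuity_pt_filterlim. apply (ex_derive_continuous (ellF k)).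
    eexists. now apply is_derive_ellF.
  - rewrite Hc. assert (H := ell_integrand_ge1 k c Hk). nra.
Qed.

Lemma continuity_ellF k : 0 < k < 1 -> continuity (ellF k).
Proof.
  intros Hk x. apply continuity_pt_filterlim. apply (ex_derive_continuous (ellF k)).
  eexists. now apply is_derive_ellF.
Qed.

Lemma ellF_surj k u : 0 < k < 1 -> exists p, ellF k p = u.
Proof.
  intros Hk. set (M := Rabs u + 1).
  assert (HM : Rabs u < M) by (unfold M; lra). assert (H0 := Rabs_pos u).
  assert (H1 := ellF_ge k 0 M Hk ltac:(lra)). assert (H2 := ellF_ge k (- M) 0 Hk ltac:(lra)).
  rewrite ellF_0 in H1, H2.
  assert (H3 := Rle_abs u). assert (H4 := Rle_abs (- u)). rewrite Rabs_Ropp in H4.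
  destruct (IVT (fun p => ellF k p - u) (- M) M) as [p [_ Hp]].
  - intros x. apply continuity_pt_minus; [now apply continuity_ellF | apply continuity_pt_const; intros a b; reflexivity].
  - lra.
  - simpl; lra.
  - simpl; lra.
  - exists p; lra.
Qed.

Lemma ellF_am k u : 0 < k < 1 -> ellF k (am k u) = u.
Proof. intros Hk. unfold am. apply epsilon_spec. now apply ellF_surj. Qed.

Lemma ellF_inj k a b : 0 < k < 1 -> ellF k a = ellF k b -> a = b.
Proof.
  intros Hk H. destruct (Rtotal_order a b) as [L|[L|L]]; auto.
  - assert (H1 := ellF_ge k a b Hk ltac:(lra)). lra.
  - assert (H1 := ellF_ge k b a Hk ltac:(lra)). lra.
Qed.

Lemma am_ellF k p : 0 < k < 1 -> am k (ellF k p) = p.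
Proof. intros Hk. apply (ellF_inj k); auto. now apply ellF_am. Qed.

Lemma am_unique k u p : 0 < k < 1 -> ellF k p = u -> am k u = p.
Proof. intros Hk <-. now apply am_ellF. Qed.

Lemma am_Lipschitz k u v : 0 < k < 1 -> Rabs (am k u - am k v) <= Rabs (u - v).
Proof.
  intros Hk.
  assert (H1 := ellF_ge k (am k u) (am k v) Hk). assert (H2 := ellF_ge k (am k v) (am k u) Hk).
  rewrite !ellF_am in * by auto.
  destruct (Rle_lt_dec (am k u) (am k v)); [specialize (H1 r) | specialize (H2 (Rlt_le _ _ r))];
    unfold Rabs; repeat destruct Rcase_abs; lra.
Qed.

Definition dn (k u : R) : R := sqrt (1 - k ^ 2 * sn k u ^ 2).
Definition cn (k u : R) : R := cos (am k u).

Lemma dn_pos k u : 0 < k < 1 -> 0 < dn k u.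
Proof. intros Hk. apply sqrt_lt_R0. apply radicand_bound, Hk. Qed.

Lemma dn_sq k u : 0 < k < 1 -> dn k u ^ 2 = 1 - k ^ 2 * sn k u ^ 2.
Proof. intros Hk. unfold dn. apply pow2_sqrt. left. apply radicand_bound, Hk. Qed.

Lemma cn_sq k u : cn k u ^ 2 = 1 - sn k u ^ 2.
Proof. unfold cn, sn. assert (H := sin2_cos2 (am k u)). unfold Rsqr in H. lra. Qed.

Lemma is_derive_am k u : 0 < k < 1 -> is_derive (am k) u (dn k u).
Proof.
  intros Hk. assert (HF := is_derive_ellF k (am k u) Hk).
  apply is_derive_Reals. apply is_derive_Reals in HF.
  assert (Hd : ell_integrand k (am k u) = / dn k u) by reflexivity. rewrite Hd in HF.
  assert (Hdp := dn_pos k u Hk).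
  assert (Hd1 : dn k u <= 1).
  { assert (H := ell_integrand_ge1 k (am k u) Hk). rewrite Hd in H.
    apply Rmult_le_compat_l with (r := dn k u) in H; [|lra]. rewrite Rinv_r in H; lra. }
  intros eps He. destruct (HF eps He) as [del Hdel]. exists del. intros h Hh Hlt.
  set (d := am k (u + h) - am k u).
  assert (Hdh : Rabs d <= Rabs h).
  { unfold d. eapply Rle_trans; [now apply am_Lipschitz|]. right; f_equal; ring. }
  assert (Hd0 : d <> 0).
  { intros E. assert (am k (u + h) = am k u) by (unfold d in E; lra).
    apply (f_equal (ellF k)) in H. rewrite !ellF_am in H by auto. lra. }
  specialize (Hdel d Hd0 ltac:(lra)).
  replace (am k u + d) with (am k (u + h)) in Hdel by (unfold d; ring).
  rewrite !ellF_am in Hdel by auto.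
  replace (u + h - u) with h in Hdel by ring.
  change (Rabs (d / h - dn k u) < eps).
  (* The error of the inverse quotient is the error of the direct one times a factor bounded by 1,
     since |d| <= |h| and dn <= 1. *)
  replace (d / h - dn k u) with (- (h / d - / dn k u) * (d * dn k u / h)) by (field; lra).
  rewrite Rabs_mult, Rabs_Ropp.
  assert (Hp : 0 < Rabs h) by now apply Rabs_pos_lt.
  assert (H1 : Rabs (d * dn k u / h) <= 1).
  { unfold Rdiv. rewrite !Rabs_mult, Rabs_inv, (Rabs_right (dn k u)) by lra.
    apply Rmult_le_reg_r with (Rabs h); [exact Hp|].
    rewrite Rmult_assoc, Rinv_l, Rmult_1_r, Rmult_1_l by lra.
    assert (H2 := Rabs_pos d). nra. }
  assert (H2 := Rabs_pos (h / d - / dn k u)). assert (H3 := Rabs_pos (d * dn k u / h)). nra.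
Qed.

Lemma is_derive_sn k u : 0 < k < 1 -> is_derive (sn k) u (cn k u * dn k u).
Proof.
  intros Hk. unfold sn, cn.
  assert (H := is_derive_comp sin (am k) u _ _ (is_derive_sin _) (is_derive_am k u Hk)).
  evar_last; [exact H|]. unfold scal; simpl; unfold mult; simpl. ring.
Qed.

Lemma is_derive_cn k u : 0 < k < 1 -> is_derive (cn k) u (- (sn k u * dn k u)).
Proof.
  intros Hk. unfold cn, sn.
  assert (H := is_derive_comp cos (am k) u _ _ (is_derive_cos _) (is_derive_am k u Hk)).
  evar_last; [exact H|]. unfold scal; simpl; unfold mult; simpl. ring.
Qed.

Lemma is_derive_dn k u : 0 < k < 1 -> is_derive (dn k) u (- (k ^ 2 * (sn k u * cn k u))).
Proof.
  intros Hk. assert (Hs := is_derive_sn k u Hk). assert (Hd := dn_pos k u Hk).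
  assert (Hr := radicand_bound k (am k u) Hk). change (sin (am k u)) with (sn k u) in Hr.
  unfold dn. auto_derive.
  - split; [eexists; exact Hs|]. split; [|exact I]. simpl in Hr; lra.
  - change (fun x => sn k x) with (sn k). rewrite (is_derive_unique _ _ _ Hs).
    replace (1 + - (k * (k * 1) * (sn k u * (sn k u * 1)))) with (1 - k ^ 2 * sn k u ^ 2) by ring.
    fold (dn k u). simpl. field. lra.
Qed.

Lemma ellF_opp k p : 0 < k < 1 -> ellF k (- p) = - ellF k p.
Proof.
  intros Hk.
  assert (H : ellF k p + ellF k (- p) = ellF k 0 + ellF k (- 0)).
  { apply (eq_of_Derive_0 (fun p => ellF k p + ellF k (- p))). intros x.
    assert (D1 := is_derive_ellF k x Hk). assert (D2 := is_derive_ellF k (- x) Hk).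
    auto_derive.
    - repeat split; eexists; eassumption.
    - change (fun y => ellF k y) with (ellF k).
      rewrite (is_derive_unique _ _ _ D1), (is_derive_unique _ _ _ D2).
      unfold ell_integrand. rewrite sin_neg.
      replace ((- sin x) ^ 2) with (sin x ^ 2) by ring. ring. }
  rewrite Ropp_0, ellF_0 in H. lra.
Qed.

Lemma ellF_PI k p : 0 < k < 1 -> ellF k (p + PI) = ellF k p + 2 * ellK k.
Proof.
  intros Hk.
  assert (H : forall a b, ellF k (a + PI) - ellF k a = ellF k (b + PI) - ellF k b).
  { apply (eq_of_Derive_0 (fun p => ellF k (p + PI) - ellF k p)). intros x.
    assert (D1 := is_derive_ellF k x Hk). assert (D2 := is_derive_ellF k (x + PI) Hk).
    auto_derive.
    - repeat split; eexists; eassumption.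
    - change (fun y => ellF k y) with (ellF k).
      rewrite (is_derive_unique _ _ _ D1), (is_derive_unique _ _ _ D2).
      unfold ell_integrand. rewrite neg_sin.
      replace ((- sin x) ^ 2) with (sin x ^ 2) by ring. ring. }
  (* The constant is read off at - PI / 2, where oddness of [ellF] gives twice the complete
     integral. *)
  specialize (H p (- (PI / 2))). rewrite ellF_opp in H by auto.
  replace (- (PI / 2) + PI) with (PI / 2) in H by field.
  change (ellF k (PI / 2)) with (ellK k) in H. lra.
Qed.

Lemma am_2K k u : 0 < k < 1 -> am k (u + 2 * ellK k) = am k u + PI.
Proof. intros Hk. apply am_unique; auto. rewrite ellF_PI, ellF_am by auto. ring. Qed.

Lemma am_opp k u : 0 < k < 1 -> am k (- u) = - am k u.
Proof. intros Hk. apply am_unique; auto. rewrite ellF_opp, ellF_am by auto. ring. Qed.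

Lemma am_0 k : 0 < k < 1 -> am k 0 = 0.
Proof. intros Hk. apply am_unique; auto. apply ellF_0. Qed.

Lemma am_K k : 0 < k < 1 -> am k (ellK k) = PI / 2.
Proof. intros Hk. apply am_unique; auto. Qed.

Lemma am_lt k u v : 0 < k < 1 -> u < v -> am k u < am k v.
Proof.
  intros Hk Huv. apply Rnot_le_lt. intros H.
  assert (H1 := ellF_ge k _ _ Hk H). rewrite !ellF_am in H1 by auto. lra.
Qed.

Lemma sn_0 k : 0 < k < 1 -> sn k 0 = 0.
Proof. intros Hk. unfold sn. rewrite am_0 by auto. apply sin_0. Qed.

Lemma sn_opp k u : 0 < k < 1 -> sn k (- u) = - sn k u.
Proof. intros Hk. unfold sn. rewrite am_opp by auto. apply sin_neg. Qed.

Lemma sn_2K k u : 0 < k < 1 -> sn k (u + 2 * ellK k) = - sn k u.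
Proof. intros Hk. unfold sn. rewrite am_2K by auto. apply neg_sin. Qed.

Lemma cn_opp k u : 0 < k < 1 -> cn k (- u) = cn k u.
Proof. intros Hk. unfold cn. rewrite am_opp by auto. apply cos_neg. Qed.

Lemma cn_0 k : 0 < k < 1 -> cn k 0 = 1.
Proof. intros Hk. unfold cn. rewrite am_0 by auto. apply cos_0. Qed.

Lemma dn_opp k u : 0 < k < 1 -> dn k (- u) = dn k u.
Proof. intros Hk. unfold dn. rewrite sn_opp by auto. f_equal; ring. Qed.

Lemma dn_0 k : 0 < k < 1 -> dn k 0 = 1.
Proof. intros Hk. unfold dn. rewrite sn_0 by auto. replace (1 - k ^ 2 * 0 ^ 2) with 1 by ring. apply sqrt_1. Qed.

Lemma ellK_pos k : 0 < k < 1 -> 0 < ellK k.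
Proof.
  intros Hk. assert (H := ellF_ge k 0 (PI / 2) Hk). rewrite ellF_0 in H.
  assert (HP := PI_RGT_0). change (ellF k (PI / 2)) with (ellK k) in H. specialize (H ltac:(lra)). lra.
Qed.

Lemma cn_pos k u : 0 < k < 1 -> 0 <= u < ellK k -> 0 < cn k u.
Proof.
  intros Hk Hu. unfold cn. apply cos_gt_0.
  - assert (H : 0 <= am k u).
    { destruct (proj1 Hu) as [H|H].
      - rewrite <- (am_0 k Hk). left. now apply am_lt.
      - rewrite <- H, am_0; auto; lra. }
    assert (HP := PI_RGT_0). lra.
  - rewrite <- (am_K k Hk). apply am_lt; auto. apply Hu.
Qed.

Lemma sn_sq_bound k u : 0 <= sn k u ^ 2 <= 1.
Proof. unfold sn. assert (H := SIN_bound (am k u)). nra. Qed.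

(* Along [u + v = C] the right-hand side is constant. *)
Lemma sn_plus k u v : 0 < k < 1 ->
  sn k (u + v) = (sn k u * cn k v * dn k v + sn k v * cn k u * dn k u)
                 / (1 - k ^ 2 * sn k u ^ 2 * sn k v ^ 2).
Proof.
  intros Hk.
  assert (Hden : forall a b, 0 < 1 - k ^ 2 * sn k a ^ 2 * sn k b ^ 2).
  { intros a b. assert (H1 := sn_sq_bound k a). assert (H2 := sn_sq_bound k b).
    assert (H3 : 0 < k ^ 2 < 1) by nra.
    assert (H4 : 0 <= sn k a ^ 2 * sn k b ^ 2 <= 1) by nra.
    rewrite Rmult_assoc. nra. }
  set (C := u + v).
  set (F := fun x => (sn k x * cn k (C - x) * dn k (C - x) + sn k (C - x) * cn k x * dn k x)
                 / (1 - k ^ 2 * sn k x ^ 2 * sn k (C - x) ^ 2)).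
  assert (HF : forall x, is_derive F x 0).
  { intros x. unfold F.
    assert (D1 := is_derive_sn k x Hk). assert (D2 := is_derive_cn k x Hk).
    assert (D3 := is_derive_dn k x Hk). assert (D4 := is_derive_sn k (C - x) Hk).
    assert (D5 := is_derive_cn k (C - x) Hk). assert (D6 := is_derive_dn k (C - x) Hk).
    assert (Hd := Hden x (C - x)).
    auto_derive.
    - unfold Rminus in *. repeat split; try (eexists; eassumption). simpl in Hd; lra.
    - change (fun y => sn k y) with (sn k). change (fun y => cn k y) with (cn k). change (fun y => dn k y) with (dn k).
      unfold Rminus in *.
      rewrite (is_derive_unique _ _ _ D1), (is_derive_unique _ _ _ D2), (is_derive_unique _ _ _ D3),
        (is_derive_unique _ _ _ D4), (is_derive_unique _ _ _ D5), (is_derive_unique _ _ _ D6).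
      assert (C1 := cn_sq k x). assert (C2 := cn_sq k (C + - x)).
      assert (E1 := dn_sq k x Hk). assert (E2 := dn_sq k (C + - x) Hk).
      set (s := sn k x) in *. set (c := cn k x) in *. set (d := dn k x) in *.
      set (s' := sn k (C + - x)) in *. set (c' := cn k (C + - x)) in *. set (d' := dn k (C + - x)) in *.
      field_simplify_eq; [|simpl in Hd |- *; lra].
      clear D1 D2 D3 D4 D5 D6.
      replace (c ^ 3) with (c * c ^ 2) by ring. replace (c' ^ 3) with (c' * c' ^ 2) by ring.
      replace (d ^ 3) with (d * d ^ 2) by ring. replace (d' ^ 3) with (d' * d' ^ 2) by ring.
      rewrite C1, C2, E1, E2. ring. }
  assert (E := eq_of_Derive_0 F HF u C). unfold F in E.
  replace (C - u) with v in E by (unfold C; ring).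
  replace (C - C) with 0 in E by ring.
  rewrite cn_0, dn_0, sn_0 in E by auto. rewrite E. field.
Qed.

(** * Inversion *)

Lemma is_derive_asin x : -1 < x < 1 -> is_derive asin x (/ sqrt (1 - x ^ 2)).
Proof.
  intros Hx. apply is_derive_Reals. replace (/ sqrt (1 - x ^ 2)) with (1 / sqrt (1 - x²)).
  - rewrite <- (derive_pt_asin x Hx). apply derive_pt_eq_1 with (pr := derivable_pt_asin x Hx). reflexivity.
  - unfold Rdiv, Rsqr. rewrite Rmult_1_l. do 3 f_equal. ring.
Qed.

Lemma snq_bound t y : 0 < t -> - (PI / 2) < y < PI / 2 -> -1 < snq t y < 1.
Proof.
  intros Ht Hy. assert (H := snq_cnq t y Ht). assert (Hc := cnq_pos t y Ht Hy). nra.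
Qed.

Lemma kap_range t : 0 < t -> 0 < kap t < 1.
Proof. intros Ht. split; [now apply kap_pos | now apply kap_lt1]. Qed.

(** The differential equation of [snq] makes ellF (asin (snq y)) - lam y constant. On the open
    interval cnq > 0, so asin is differentiable there and the square root of 1 - snq^2 is cnq. *)
Lemma sn_snq_open t y : 0 < t -> - (PI / 2) < y < PI / 2 ->
  am (kap t) (lam t * y) = asin (snq t y).
Proof.
  intros Ht Hy. assert (Hk := kap_range t Ht).
  apply am_unique; auto.
  set (H := fun z => ellF (kap t) (asin (snq t z)) - lam t * z).
  assert (HD : forall z, - (PI / 2) < z < PI / 2 -> is_derive H z 0).
  { intros z Hz. unfold H.
    assert (Hb := snq_bound t z Ht Hz). assert (D1 := is_derive_snq t z Ht).
    assert (D2 := is_derive_asin _ Hb). assert (D3 := is_derive_ellF (kap t) (asin (snq t z)) Hk).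
    assert (Hc := cnq_pos t z Ht Hz). assert (Hd := dnq_pos t z Ht).
    assert (Ec : sqrt (1 - snq t z ^ 2) = cnq t z).
    { rewrite <- (snq_cnq t z Ht). replace (_ - _) with (cnq t z ^ 2) by ring. apply sqrt_pow2; lra. }
    assert (Ed : ell_integrand (kap t) (asin (snq t z)) = / dnq t z).
    { unfold ell_integrand. rewrite sin_asin by lra.
      rewrite <- (snq_dnq t z Ht). replace (_ - _) with (dnq t z ^ 2) by ring. f_equal. apply sqrt_pow2; lra. }
    auto_derive.
    - split; [eexists; exact D3|]. split; [eexists; exact D2|]. split; [eexists; exact D1|]. exact I.
    - change (fun x => ellF (kap t) x) with (ellF (kap t)). change (fun x => asin x) with asin.
      change (fun x => snq t x) with (snq t).
      rewrite (is_derive_unique _ _ _ D1), (is_derive_unique _ _ _ D2), (is_derive_unique _ _ _ D3), Ed, Ec.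
      field. lra. }
  assert (E : H y = H 0).
  { assert (HP := PI_RGT_0).
    destruct (Rtotal_order y 0) as [L|[L|L]]; [|now subst|].
    - apply (eq_is_derive H y 0); [|exact L]. intros z Hz; apply HD; lra.
    - symmetry. apply (eq_is_derive H 0 y); [|exact L]. intros z Hz; apply HD; lra. }
  unfold H in E. rewrite snq_0, asin_0, ellF_0 in E by auto. lra.
Qed.

Lemma limit_agree_left (f : R -> R) a b : a < b -> continuity_pt f b ->
  (forall x, a < x < b -> f x = 0) -> f b = 0.
Proof.
  intros Hab Hc H. apply NNPP; intros Hn.
  destruct (Hc (Rabs (f b)) (Rabs_pos_lt _ Hn)) as [d [Hd Hx]].
  set (x := Rmax ((a + b) / 2) (b - d / 2)).
  assert (Hx1 : a < x < b).
  { unfold x. split; [apply Rlt_le_trans with (2 := Rmax_l _ _); lra | apply Rmax_lub_lt; lra]. }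
  assert (Hx2 : b - d / 2 <= x) by apply Rmax_r.
  specialize (Hx x). simpl in Hx. unfold R_dist in Hx. rewrite (H x Hx1) in Hx.
  rewrite Rminus_0_l, Rabs_Ropp in Hx.
  assert (Rabs (f b) < Rabs (f b)); [|lra]. apply Hx. split.
  - split; [exact I | lra].
  - rewrite Rabs_left; lra.
Qed.

Lemma sn_snq_half t y : 0 < t -> - (PI / 2) < y <= PI / 2 -> sn (kap t) (lam t * y) = snq t y.
Proof.
  intros Ht Hy. assert (HP := PI_RGT_0). assert (Hk := kap_range t Ht).
  assert (H : forall z, - (PI / 2) < z < PI / 2 -> sn (kap t) (lam t * z) = snq t z).
  { intros z Hz. unfold sn. rewrite sn_snq_open by auto. apply sin_asin.
    assert (Hb := snq_bound t z Ht Hz). lra. }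
  destruct (proj2 Hy) as [L|L]; [apply H; lra|].
  apply Rminus_diag_uniq.
  apply (limit_agree_left (fun z => sn (kap t) (lam t * z) - snq t z) 0 y); [lra| |].
  - apply continuity_pt_filterlim. apply (ex_derive_continuous (fun z => sn (kap t) (lam t * z) - snq t z)).
    assert (D1 := is_derive_sn (kap t) (lam t * y) Hk). assert (D2 := is_derive_snq t y Ht).
    auto_derive. split; [eexists; exact D1|]. split; [eexists; exact D2 | exact I].
  - intros z Hz. rewrite H by lra. ring.
Qed.

(** sn equals 1 at lam PI / 2, but also at other points than K. For y < PI / 2 the amplitude stays
    below PI / 2, so lam PI / 2 cannot exceed K; the sign of [snq] excludes lam < 0; and on [0, K)
    cn > 0 excludes sn = 1. *)
Lemma ellK_kap t : 0 < t -> ellK (kap t) = lam t * (PI / 2).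
Proof.
  intros Ht. assert (HP := PI_RGT_0). assert (Hk := kap_range t Ht).
  assert (H1 := sn_snq_half t (PI / 2) Ht ltac:(lra)). rewrite snq_PI2 in H1 by auto.
  assert (Hlt : forall y, 0 <= y < PI / 2 -> lam t * y < ellK (kap t)).
  { intros y Hy. apply Rnot_le_lt; intros L.
    assert (H2 := sn_snq_open t y Ht ltac:(lra)).
    assert (H3 : asin (snq t y) < PI / 2) by (apply asin_bound_lt, snq_bound; auto; lra).
    rewrite <- H2 in H3. destruct L as [L|L].
    - assert (H4 := am_lt (kap t) _ _ Hk L). rewrite am_K in H4 by auto. lra.
    - rewrite <- L, am_K in H3 by auto. lra. }
  assert (Hle : lam t * (PI / 2) <= ellK (kap t)).
  { apply Rnot_lt_le; intros L.
    assert (HK := ellK_pos _ Hk).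
    assert (Hl : 0 < lam t) by nra.
    specialize (Hlt (ellK (kap t) / lam t)).
    assert (E : lam t * (ellK (kap t) / lam t) = ellK (kap t)) by (field; lra).
    assert (ellK (kap t) < ellK (kap t)); [|lra]. rewrite <- E at 1. apply Hlt. split.
    - left; apply Rdiv_lt_0_compat; lra.
    - apply Rmult_lt_reg_l with (lam t); lra. }
  assert (Hlam : 0 <= lam t * (PI / 2)).
  { apply Rnot_lt_le; intros L.
    assert (H5 := sn_snq_open t (PI / 4) Ht ltac:(lra)).
    assert (H6 : 0 < snq t (PI / 4)) by (apply snq_pos; auto; lra).
    assert (H7 : am (kap t) (lam t * (PI / 4)) < 0).
    { rewrite <- (am_0 (kap t) Hk). apply am_lt; auto. lra. }
    rewrite H5 in H7.
    assert (H8 := snq_bound t (PI / 4) Ht ltac:(lra)).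
    assert (H9 := sin_asin (snq t (PI / 4)) ltac:(lra)).
    assert (H10 := asin_bound (snq t (PI / 4))).
    assert (H11 : 0 < sin (- asin (snq t (PI / 4)))) by (apply sin_gt_0; lra).
    rewrite sin_neg in H11. lra. }
  destruct Hle as [L|L]; [|now rewrite L].
  exfalso. assert (Hc := cn_pos (kap t) (lam t * (PI / 2)) Hk ltac:(lra)).
  assert (H2 := cn_sq (kap t) (lam t * (PI / 2))). rewrite H1 in H2. nra.
Qed.

Lemma lam_eq t : 0 < t -> lam t = 2 * ellK (kap t) / PI.
Proof. intros Ht. rewrite ellK_kap by auto. field. apply PI_neq0. Qed.

Lemma snq_PI t y : 0 < t -> snq t (y + PI) = - snq t y.
Proof.
  intros Ht. unfold snq. replace (y + PI - PI / 2) with (y - PI / 2 + PI) by ring.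
  replace (y + PI + PI / 2) with (y + PI / 2 + PI) by ring.
  rewrite th1_PI, th0_PI by auto. assert (H := th0_pos t (y + PI / 2) Ht).
  assert (H1 := th_at0_pos 1 t Ht). field. lra.
Qed.

Lemma periodic_reduce (G : R -> Prop) p : 0 < p -> (forall y, G y <-> G (y + p)) ->
  (forall y, - (p / 2) < y <= p / 2 -> G y) -> forall y, G y.
Proof.
  intros Hp HG H0.
  assert (HN : forall (n : nat) y, G y <-> G (y + INR n * p)).
  { induction n as [|n IH]; intros y.
    - simpl. now rewrite Rmult_0_l, Rplus_0_r.
    - rewrite S_INR. replace (y + (INR n + 1) * p) with (y + INR n * p + p) by ring.
      rewrite <- HG. apply IH. }
  intros y. destruct (archimed (y / p - / 2)) as [A1 A2]. set (n := up (y / p - / 2)) in *.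
  (* [up] places y - n p in the interval closed on the left; its endpoint - p / 2 is moved to p / 2
     by adding a period. *)
  assert (Hr : - (p / 2) < y - IZR n * p + p <= p / 2 \/ - (p/2) < y - IZR n * p <= p / 2).
  { assert (E : y = (y / p) * p) by (field; lra). set (z := y / p) in *. rewrite E.
    destruct (Rle_lt_dec (z - IZR n) (- / 2)); [left | right]; nra. }
  assert (Hm : exists m : Z, - (p / 2) < y - IZR m * p <= p / 2).
  { destruct Hr as [Hr|Hr]; [exists (n - 1)%Z | exists n; exact Hr].
    rewrite minus_IZR. replace (y - (IZR n - 1) * p) with (y - IZR n * p + p) by ring. exact Hr. }
  destruct Hm as [m Hm]. assert (Gm := H0 _ Hm).
  destruct (Z_le_gt_dec 0 m).
  - apply (HN (Z.to_nat m)) in Gm. rewrite INR_IZR_INZ, Z2Nat.id in Gm by lia.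
    now replace (y - IZR m * p + IZR m * p) with y in Gm by ring.
  - apply (HN (Z.to_nat (- m))). rewrite INR_IZR_INZ, Z2Nat.id, opp_IZR by lia.
    now replace (y + - IZR m * p) with (y - IZR m * p) by ring.
Qed.

Lemma sn_snq t y : 0 < t -> sn (kap t) (lam t * y) = snq t y.
Proof.
  intros Ht. assert (Hk := kap_range t Ht). revert y.
  apply (periodic_reduce (fun y => sn (kap t) (lam t * y) = snq t y) PI PI_RGT_0).
  - intros y. replace (lam t * (y + PI)) with (lam t * y + 2 * ellK (kap t)) by (rewrite ellK_kap by auto; field).
    rewrite sn_2K, snq_PI by auto. split; intros; lra.
  - intros y Hy. now apply sn_snq_half.
Qed.

(** * Surjectivity of the modulus and Landen's transformation *)

Lemma kap_large : exists T, 1 <= T /\ forall t, T <= t ->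
  4 / 9 * exp (- 2 * t) <= kap t <= 36 * exp (- 2 * t).
Proof.
  destruct th0_large as [T0 [HT0 H0]]. destruct th1_large as [T1 [HT1 H1]].
  exists (Rmax T0 T1). split; [apply Rle_trans with (2 := Rmax_l _ _); lra|].
  intros t Ht. specialize (H0 t (Rle_trans _ _ _ (Rmax_l _ _) Ht) 0).
  specialize (H1 t (Rle_trans _ _ _ (Rmax_r _ _) Ht) 0).
  rewrite cos_0, Rabs_R1 in H1.
  replace (exp (- 2 * t)) with (exp (- t) ^ 2) by (simpl; rewrite Rmult_1_r, <- exp_plus; f_equal; ring).
  assert (He := exp_pos (- t)). unfold kap.
  (* The constants 4 / 9 and 36 are (1 / (3 / 2))^2 and (3 / (1 / 2))^2 from these two ranges. *)
  assert (A : / 2 <= th 0 t 0 <= 3 / 2) by (revert H0; unfold Rabs; destruct Rcase_abs; lra).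
  assert (B : exp (- t) <= th 1 t 0 <= 3 * exp (- t)) by (revert H1; unfold Rabs; destruct Rcase_abs; lra).
  set (a := th 0 t 0) in *. set (b := th 1 t 0) in *. set (e := exp (- t)) in *.
  assert (Ha : 0 < a ^ 2) by (apply pow_lt; lra).
  split; apply Rmult_le_reg_r with (a ^ 2); auto; unfold Rdiv; rewrite (Rmult_assoc (b ^ 2)), Rinv_l, Rmult_1_r by lra.
  - assert (a ^ 2 <= 9 / 4) by nra. assert (e ^ 2 <= b ^ 2) by nra. nra.
  - assert (/ 4 <= a ^ 2) by nra. assert (b ^ 2 <= 9 * e ^ 2) by nra. nra.
Qed.

Lemma continuity_kap t : 0 < t -> continuity_pt kap t.
Proof.
  intros Ht. unfold kap.
  assert (C0 := continuity_th_param 0 t Ht). assert (C1 := continuity_th_param 1 t Ht).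
  assert (H := th_at0_pos 0 t Ht).
  apply (continuity_pt_div (fun t => th 1 t 0 ^ 2) (fun t => th 0 t 0 ^ 2)).
  - apply (continuity_pt_comp (fun s => th 1 s 0) (fun x => x ^ 2)); [exact C1|].
    apply derivable_continuous_pt, derivable_pt_pow.
  - apply (continuity_pt_comp (fun s => th 0 s 0) (fun x => x ^ 2)); [exact C0|].
    apply derivable_continuous_pt, derivable_pt_pow.
  - apply pow_nonzero; lra.
Qed.

Lemma kap_onto_small k : 0 < k < kap 1 -> exists t, 0 < t /\ kap t = k.
Proof.
  intros Hk. destruct kap_large as [T [HT1 HT]].
  (* Since exp (2 S) >= 1 + 2 S, the condition 36 <= k S brings 36 exp (-2 S) below k. *)
  set (S := Rmax (T + 1) (36 / k)).
  assert (HS1 : T + 1 <= S) by apply Rmax_l. assert (HS2 : 36 / k <= S) by apply Rmax_r.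
  assert (HS : kap S < k).
  { apply Rle_lt_trans with (1 := proj2 (HT S ltac:(lra))).
    assert (E : exp (- 2 * S) * exp (2 * S) = 1) by (rewrite <- exp_plus, <- exp_0; f_equal; ring).
    assert (E1 := exp_ge_lin (2 * S)). assert (E2 := exp_pos (- 2 * S)).
    assert (E3 : 36 <= k * S).
    { apply Rmult_le_compat_l with (r := k) in HS2; [|lra].
      replace (k * (36 / k)) with 36 in HS2 by (field; lra). exact HS2. }
    assert (E4 : exp (-2 * S) * (1 + 2 * S) <= 1) by nra.
    apply Rmult_lt_reg_r with S; [lra|]. nra. }
  destruct (IVT_interv (fun t => k - kap t) 1 S) as [t [Ht1 Ht2]].
  - intros a Ha. apply continuity_pt_minus; [apply continuity_pt_const; intros u v; reflexivity | apply continuity_kap; lra].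
  - lra.
  - lra.
  - lra.
  - exists t. lra.
Qed.

Lemma kprime_sq k : 0 < k < 1 -> kprime k ^ 2 = 1 - k ^ 2.
Proof. intros Hk. unfold kprime. apply pow2_sqrt. nra. Qed.

Lemma kprime_range k : 0 < k < 1 -> 0 < kprime k < 1.
Proof.
  intros Hk. assert (H := kprime_sq k Hk). assert (0 < kprime k) by (unfold kprime; apply sqrt_lt_R0; nra). nra.
Qed.

(* [l] is the descending Landen transform [(1 - k') / (1 + k')] of [k]. *)
Lemma landen_inverse k : 0 < k < 1 -> let l := (k / (1 + kprime k)) ^ 2 in
  0 < l < 1 /\ l <= k ^ 2 /\ 2 * sqrt l / (1 + l) = k.
Proof.
  intros Hk l. assert (H := kprime_sq k Hk). assert (H1 := kprime_range k Hk).
  assert (Hp : 0 < k / (1 + kprime k)) by (apply Rdiv_lt_0_compat; lra).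
  assert (Hp1 : k / (1 + kprime k) <= k).
  { apply Rmult_le_reg_r with (1 + kprime k); [lra|]. unfold Rdiv.
    rewrite Rmult_assoc, Rinv_l, Rmult_1_r by lra. nra. }
  unfold l. repeat split; try nra.
  rewrite sqrt_pow2 by lra.
  assert (E : k ^ 2 = (1 - kprime k) * (1 + kprime k)) by nra.
  replace (1 + (k / (1 + kprime k)) ^ 2) with (2 / (1 + kprime k)).
  - field. lra.
  - apply Rmult_eq_reg_r with ((1 + kprime k) ^ 2); [|apply pow_nonzero; lra].
    transitivity ((1 + kprime k) ^ 2 + k ^ 2); [rewrite E; field; lra | field; lra].
Qed.

(** Each descending Landen step at least squares the modulus, so finitely many lead below kap 1,
    where the intermediate value theorem applies; every step back halves t. *)
Lemma kap_onto k : 0 < k < 1 -> exists t, 0 < t /\ kap t = k.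
Proof.
  assert (H : forall n k, 0 < k < 1 -> k ^ (2 ^ n) < kap 1 -> exists t, 0 < t /\ kap t = k).
  { induction n as [|n IH]; intros k0 Hk0 Hs.
    - apply kap_onto_small. simpl in Hs. lra.
    - destruct (landen_inverse k0 Hk0) as [H1 [H2 H3]].
      destruct (IH _ H1) as [t [Ht1 Ht2]].
      + apply Rle_lt_trans with (2 := Hs). change (2 ^ S n)%nat with (2 * 2 ^ n)%nat.
        rewrite pow_mult. apply pow_incr. split; [left; apply H1 | exact H2].
      + exists (t / 2). split; [lra|]. rewrite kap_double by lra.
        replace (2 * (t / 2)) with t by field. rewrite Ht2. exact H3. }
  intros Hk. assert (Hk1 := kap_pos 1 Rlt_0_1).
  destruct (pow_lt_1_zero k ltac:(rewrite Rabs_right; lra) (kap 1) Hk1) as [N HN].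
  apply (H N k Hk). specialize (HN (2 ^ N)%nat).
  rewrite Rabs_right in HN by (apply Rle_ge, pow_le; lra). apply HN.
  apply Nat.lt_le_incl, Nat.pow_gt_lin_r. lia.
Qed.

Lemma ellK_landen l : 0 < l < 1 -> ellK (2 * sqrt l / (1 + l)) = (1 + l) * ellK l.
Proof.
  intros Hl. destruct (kap_onto l Hl) as [t [Ht <-]].
  assert (Ht2 : 0 < t / 2) by lra. assert (E : 2 * (t / 2) = t) by field.
  assert (H := kap_double (t / 2) Ht2). assert (H1 := lam_double (t / 2) Ht2). rewrite E in *.
  rewrite <- H. rewrite !ellK_kap, H1 by auto. ring.
Qed.

(** * The nome *)

Definition lognome (k : R) : R := - PI * ellK (kprime k) / ellK k.

(** With l = kap (2 t) and k = kap t, Landen's transformation takes l to k and k' to l'. Hence K (k)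
    = (1 + l) K (l) and K (l') = (1 + k') K (k'), while (1 + k') (1 + l) = 2. *)
Lemma lognome_double t : 0 < t -> lognome (kap (2 * t)) = 2 * lognome (kap t).
Proof.
  intros Ht. assert (Ht2 : 0 < 2 * t) by lra.
  assert (Hl := kap_range _ Ht2). assert (Hk := kap_range _ Ht).
  assert (E := kap_double t Ht).
  set (l := kap (2 * t)) in *. set (k := kap t) in *.
  assert (Hs : 0 < sqrt l) by (apply sqrt_lt_R0; lra).
  assert (Hs2 : sqrt l * sqrt l = l) by (apply sqrt_sqrt; lra).
  assert (Ek : kprime k = (1 - l) / (1 + l)).
  { unfold kprime. replace (1 - k ^ 2) with (((1 - l) / (1 + l)) ^ 2).
    - apply sqrt_pow2. apply Rmult_le_pos; [lra | left; apply Rinv_0_lt_compat; lra].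
    - rewrite E. apply Rmult_eq_reg_r with ((1 + l) ^ 2); [|apply pow_nonzero; lra].
      transitivity ((1 - l) ^ 2); [field; lra|].
      transitivity ((1 + l) ^ 2 - 4 * (sqrt l * sqrt l)); [rewrite Hs2; ring | field; lra]. }
  assert (Hk' := kprime_range k Hk).
  assert (El : kprime l = 2 * sqrt (kprime k) / (1 + kprime k)).
  { assert (A1 : 0 < 2 * sqrt (kprime k) / (1 + kprime k)).
    { apply Rdiv_lt_0_compat; [|lra]. assert (0 < sqrt (kprime k)) by (apply sqrt_lt_R0; lra). lra. }
    unfold kprime at 1. rewrite <- (sqrt_pow2 (2 * sqrt (kprime k) / (1 + kprime k))) by lra.
    f_equal.
    assert (A2 : sqrt (kprime k) * sqrt (kprime k) = kprime k) by (apply sqrt_sqrt; lra).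
    transitivity (4 * (sqrt (kprime k) * sqrt (kprime k)) / (1 + kprime k) ^ 2); [|field; lra].
    rewrite A2, Ek. field. lra. }
  assert (L1 := ellK_landen l Hl). assert (L2 := ellK_landen (kprime k) Hk').
  rewrite <- E in L1. rewrite <- El in L2.
  assert (K1 := ellK_pos l Hl). assert (K2 := ellK_pos k Hk).
  unfold lognome. rewrite L1, L2, Ek. field. lra.
Qed.

Lemma ellK_lower k : 0 < k < 1 -> PI / 2 <= ellK k.
Proof.
  intros Hk. assert (H := ellF_ge k 0 (PI / 2) Hk). rewrite ellF_0 in H.
  change (ellF k (PI / 2)) with (ellK k) in H. assert (HP := PI_RGT_0). specialize (H ltac:(lra)). lra.
Qed.

Lemma ellF_MVT k a b : 0 < k < 1 -> a <= b ->
  exists c, a <= c <= b /\ ellF k b - ellF k a = ell_integrand k c * (b - a).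
Proof.
  intros Hk Hab. destruct (MVT_gen (ellF k) a b (ell_integrand k)) as [c [Hc1 Hc]].
  - intros; now apply is_derive_ellF.
  - intros x _. now apply continuity_ellF.
  - exists c. rewrite Rmin_left, Rmax_right in Hc1 by auto. auto.
Qed.

(** The integrand is at most 1 + k^2, because (1 + m)^2 (1 - m) >= 1 for m = k^2 <= 1 / 2. The error
    k^2 is small enough to survive multiplication by t. *)
Lemma ellK_upper k : 0 < k -> k ^ 2 <= / 2 -> ellK k <= PI / 2 * (1 + k ^ 2).
Proof.
  intros Hk0 Hk2. assert (Hk : 0 < k < 1) by nra. assert (HP := PI_RGT_0).
  destruct (ellF_MVT k 0 (PI / 2) Hk ltac:(lra)) as [c [_ Hc]].
  rewrite ellF_0 in Hc. change (ellF k (PI / 2)) with (ellK k) in Hc.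
  rewrite !Rminus_0_r in Hc. rewrite Hc, Rmult_comm. apply Rmult_le_compat_l; [lra|].
  unfold ell_integrand. assert (Hr := radicand_bound k c Hk).
  assert (Hs : 1 - k ^ 2 <= 1 - k ^ 2 * sin c ^ 2) by (assert (H := SIN_bound c); assert (0 <= sin c ^ 2 <= 1) by nra; nra).
  assert (Hq := sqrt_lt_R0 _ (proj1 Hr)).
  apply Rmult_le_reg_r with (sqrt (1 - k ^ 2 * sin c ^ 2)); [exact Hq|].
  rewrite Rinv_l by lra.
  assert (Hsq : sqrt (1 - k ^ 2 * sin c ^ 2) * sqrt (1 - k ^ 2 * sin c ^ 2) = 1 - k ^ 2 * sin c ^ 2) by (apply sqrt_sqrt; lra).
  assert (0 < k ^ 2) by nra.
  assert (H1 : 1 <= ((1 + k ^ 2) * sqrt (1 - k ^ 2 * sin c ^ 2)) ^ 2).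
  { rewrite Rpow_mult_distr. replace (sqrt (1 - k ^ 2 * sin c ^ 2) ^ 2) with (1 - k ^ 2 * sin c ^ 2) by (symmetry; apply pow2_sqrt; lra).
    assert (1 <= (1 + k ^ 2) ^ 2 * (1 - k ^ 2)) by nra. nra. }
  assert (0 < (1 + k ^ 2) * sqrt (1 - k ^ 2 * sin c ^ 2)) by nra. nra.
Qed.

Lemma is_derive_arcsinh x : is_derive arcsinh x (/ sqrt (x ^ 2 + 1)).
Proof. apply is_derive_Reals. apply derivable_pt_lim_arcsinh. Qed.

Lemma arcsinh_bounds x : 1 <= x -> ln x <= arcsinh x <= ln 3 + ln x.
Proof.
  intros Hx. unfold arcsinh.
  assert (H1 : sqrt (x ^ 2 + 1) <= 2 * x).
  { rewrite <- (sqrt_pow2 (2 * x)) by lra. apply sqrt_le_1_alt. nra. }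
  assert (H2 := sqrt_pos (x ^ 2 + 1)).
  split.
  - apply ln_le; lra.
  - rewrite <- ln_mult by lra. apply ln_le; lra.
Qed.

Lemma monotone_of_derive (f df : R -> R) a b : a <= b ->
  (forall x, a <= x <= b -> is_derive f x (df x)) -> (forall x, a <= x <= b -> 0 <= df x) -> f a <= f b.
Proof.
  intros Hab Hd Hp. destruct (MVT_gen f a b df) as [c [Hc1 Hc]].
  - intros x Hx. rewrite Rmin_left, Rmax_right in Hx by auto. apply Hd; lra.
  - intros x Hx. rewrite Rmin_left, Rmax_right in Hx by auto.
    apply continuity_pt_filterlim. apply (ex_derive_continuous f). eexists; apply Hd; lra.
  - rewrite Rmin_left, Rmax_right in Hc1 by auto. assert (H := Hp c Hc1). nra.
Qed.

(** The integrand 1 / sqrt (cos^2 + k^2 sin^2) is bounded below by sin / sqrt (cos^2 + k^2), whose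
    primitive is - arcsinh (cos p / k). *)
Lemma ellK_kprime_lower k : 0 < k < 1 -> arcsinh (/ k) <= ellK (kprime k).
Proof.
  intros Hk. assert (Hk' := kprime_range k Hk). assert (HP := PI_RGT_0).
  set (G := fun p => ellF (kprime k) p + arcsinh (cos p / k)).
  assert (H : G 0 <= G (PI / 2)).
  { apply (monotone_of_derive G (fun p => ell_integrand (kprime k) p - sin p / k * / sqrt ((cos p / k) ^ 2 + 1))); [lra| |].
    - intros p _. unfold G. assert (D1 := is_derive_ellF (kprime k) p Hk').
      assert (D2 := is_derive_arcsinh (cos p / k)).
      auto_derive.
      + split; [eexists; exact D1|]. split; [eexists; exact D2 | exact I].
      + change (fun x => ellF (kprime k) x) with (ellF (kprime k)). change (fun x => arcsinh x) with arcsinh.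
        unfold Rdiv in D2 |- *. rewrite (is_derive_unique _ _ _ D1), (is_derive_unique _ _ _ D2). unfold Rdiv; ring.
    - intros p Hp. assert (Hr := radicand_bound (kprime k) p Hk').
      assert (Hq := sqrt_lt_R0 _ (proj1 Hr)).
      unfold ell_integrand. apply Rge_le, Rge_minus, Rle_ge.
      assert (Hs := sin_ge_0 p ltac:(lra) ltac:(lra)).
      assert (Hs1 := SIN_bound p).
      assert (Hw : 0 < (cos p / k) ^ 2 + 1) by (assert (0 <= (cos p / k) ^ 2) by apply pow2_ge_0; lra).
      assert (Hw' := sqrt_lt_R0 _ Hw).
      apply Rmult_le_reg_r with (sqrt (1 - kprime k ^ 2 * sin p ^ 2)); [exact Hq|]. rewrite Rinv_l by lra.
      apply Rmult_le_reg_r with (sqrt ((cos p / k) ^ 2 + 1)); [exact Hw'|].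
      replace (sin p / k * / sqrt ((cos p / k) ^ 2 + 1) * sqrt (1 - kprime k ^ 2 * sin p ^ 2) * sqrt ((cos p / k) ^ 2 + 1))
        with (sin p / k * sqrt (1 - kprime k ^ 2 * sin p ^ 2)) by (field; lra).
      rewrite Rmult_1_l.
      rewrite <- (sqrt_pow2 (sin p / k)) by (apply Rmult_le_pos; [lra | left; apply Rinv_0_lt_compat; lra]).
      rewrite <- sqrt_mult_alt by apply pow2_ge_0. apply sqrt_le_1_alt.
      rewrite (kprime_sq k Hk).
      assert (Hcs := sin2_cos2 p). unfold Rsqr in Hcs.
      apply Rmult_le_reg_r with (k ^ 2); [apply pow_lt; lra|].
      replace ((sin p / k) ^ 2 * (1 - (1 - k ^ 2) * sin p ^ 2) * k ^ 2) with (sin p ^ 2 * (1 - (1 - k ^ 2) * sin p ^ 2)) by (field; lra).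
      replace (((cos p / k) ^ 2 + 1) * k ^ 2) with (cos p ^ 2 + k ^ 2) by (field; lra).
      replace (cos p ^ 2) with (1 - sin p ^ 2) by nra.
      assert (0 <= sin p ^ 2 <= 1) by nra. set (s := sin p ^ 2) in *. assert (0 < k ^ 2 < 1) by nra. set (m := k ^ 2) in *.
      assert (0 <= m * (1 - s * s)) by (apply Rmult_le_pos; nra). nra. }
  unfold G in H. rewrite ellF_0, cos_0, cos_PI2 in H.
  replace (0 / k) with 0 in H by (field; lra). rewrite arcsinh_0 in H.
  unfold Rdiv in H at 1. rewrite Rmult_1_l in H.
  change (ellF (kprime k) (PI / 2)) with (ellK (kprime k)) in H. lra.
Qed.

(** On [PI / 4, PI / 2] the integrand is bounded above by 1 / (sin p sqrt (cos^2 + k^2 sin^2)), with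
    primitive - arcsinh (cot p / k). This blows up at 0, so on [0, PI / 4] the bound 2 for the
    integrand is used instead. *)
Lemma ellK_kprime_upper k : 0 < k < 1 -> ellK (kprime k) <= arcsinh (/ k) + PI / 2.
Proof.
  intros Hk. assert (Hk' := kprime_range k Hk). assert (HP := PI_RGT_0).
  assert (H0 : ellF (kprime k) (PI / 4) <= PI / 2).
  { destruct (ellF_MVT (kprime k) 0 (PI / 4) Hk' ltac:(lra)) as [c [Hc1 Hc]].
    rewrite ellF_0 in Hc. rewrite !Rminus_0_r in Hc. rewrite Hc.
    assert (ell_integrand (kprime k) c <= 2); [|nra].
    unfold ell_integrand. assert (Hr := radicand_bound (kprime k) c Hk').
    assert (Hc2 : cos (PI / 4) <= cos c) by (apply cos_decr_1; lra).
    assert (Hc3 : / 2 <= cos c ^ 2).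
    { apply Rle_trans with (cos (PI / 4) ^ 2).
      - assert (E := cos_PI4). assert (E2 : cos (PI / 4) = sin (PI / 4)) by (rewrite cos_PI4, sin_PI4; reflexivity).
        assert (E3 := sin2_cos2 (PI / 4)). unfold Rsqr in E3. rewrite <- E2 in E3. lra.
      - apply pow_incr. split; [|exact Hc2]. apply cos_ge_0; lra. }
    assert (Hcs := sin2_cos2 c). unfold Rsqr in Hcs.
    assert (Hge : / 4 <= 1 - kprime k ^ 2 * sin c ^ 2).
    { assert (0 <= sin c ^ 2 <= / 2) by nra. assert (0 < kprime k ^ 2 < 1) by nra. nra. }
    replace 2 with (/ (/ 2)) by field. apply Rinv_le_contravar; [lra|].
    rewrite <- (sqrt_pow2 (/ 2)) by lra. apply sqrt_le_1_alt. lra. }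
  set (G := fun p => - arcsinh (cos p / (k * sin p)) - ellF (kprime k) p).
  assert (H : G (PI / 4) <= G (PI / 2)).
  { apply (monotone_of_derive G (fun p => / (k * sin p ^ 2) * / sqrt ((cos p / (k * sin p)) ^ 2 + 1) - ell_integrand (kprime k) p)); [lra| |].
    - intros p Hp. unfold G. assert (D1 := is_derive_ellF (kprime k) p Hk').
      assert (D2 := is_derive_arcsinh (cos p / (k * sin p))).
      assert (Hs := sin_gt_0 p ltac:(lra) ltac:(lra)).
      assert (Hcs := sin2_cos2 p). unfold Rsqr in Hcs.
      auto_derive.
      + split; [eexists; exact D2|]. split; [nra|]. split; [eexists; exact D1 | exact I].
      + change (fun x => ellF (kprime k) x) with (ellF (kprime k)). change (fun x => arcsinh x) with arcsinh.
        unfold Rdiv in D2 |- *.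
        rewrite (is_derive_unique _ _ _ D1), (is_derive_unique _ _ _ D2).
        set (w := / sqrt _).
        replace (/ (k * sin p ^ 2)) with ((sin p * sin p + cos p * cos p) * / (k * sin p ^ 2)) by (rewrite Hcs; ring).
        field. split; nra.
    - intros p Hp. assert (Hr := radicand_bound (kprime k) p Hk').
      assert (Hq := sqrt_lt_R0 _ (proj1 Hr)).
      unfold ell_integrand. apply Rge_le, Rge_minus, Rle_ge.
      assert (Hs := sin_gt_0 p ltac:(lra) ltac:(lra)).
      assert (Hs1 := SIN_bound p).
      set (w := cos p / (k * sin p)).
      assert (Hw : 0 < w ^ 2 + 1) by (assert (0 <= w ^ 2) by apply pow2_ge_0; lra).
      assert (Hw' := sqrt_lt_R0 _ Hw).
      rewrite <- Rinv_mult. apply Rinv_le_contravar.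
      + apply Rmult_lt_0_compat; [apply Rmult_lt_0_compat; [lra | apply pow_lt; lra] | exact Hw'].
      + rewrite <- (sqrt_pow2 (k * sin p ^ 2)) by (apply Rmult_le_pos; [lra | apply pow2_ge_0]).
        rewrite <- sqrt_mult_alt by apply pow2_ge_0. apply sqrt_le_1_alt.
        rewrite (kprime_sq k Hk).
        assert (Hcs := sin2_cos2 p). unfold Rsqr in Hcs.
        replace ((k * sin p ^ 2) ^ 2 * (w ^ 2 + 1)) with (sin p ^ 2 * (cos p ^ 2 + k ^ 2 * sin p ^ 2))
          by (unfold w; field; lra).
        replace (cos p ^ 2) with (1 - sin p ^ 2) by nra.
        assert (0 <= sin p ^ 2 <= 1) by nra. set (s := sin p ^ 2) in *. assert (0 < k ^ 2 < 1) by nra.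
        set (m := k ^ 2) in *. assert (0 <= 1 - s + m * s) by nra. nra. }
  unfold G in H. rewrite cos_PI2, sin_PI2 in H.
  replace (0 / (k * 1)) with 0 in H by (field; lra). rewrite arcsinh_0 in H.
  replace (cos (PI / 4) / (k * sin (PI / 4))) with (/ k) in H.
  2:{ rewrite cos_PI4, sin_PI4. assert (0 < sqrt 2) by (apply sqrt_lt_R0; lra). field. lra. }
  change (ellF (kprime k) (PI / 2)) with (ellK (kprime k)) in H. lra.
Qed.

(** K' = - ln k + O(1) = 2 t + O(1) and K = PI / 2 + O(k^2), where t k^2 is bounded because k decays
    like exp (-2 t). *)
Lemma lognome_asymp : exists T C, 1 <= T /\ forall t, T <= t -> Rabs (lognome (kap t) + 4 * t) <= C.
Proof.
  destruct kap_large as [T [HT HK]].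
  set (T' := Rmax T (36 ^ 2)). set (C1 := ln 36 + ln 3 + PI / 2).
  assert (HP := PI_RGT_0).
  assert (L36 : 0 < ln 36) by (rewrite <- ln_1; apply ln_increasing; lra).
  assert (L3 : 0 < ln 3) by (rewrite <- ln_1; apply ln_increasing; lra).
  exists T', (2 * C1 + 4 * 36 ^ 2). split; [apply Rle_trans with (1 := HT), Rmax_l|].
  intros t Ht. assert (Ht1 : T <= t) by (apply Rle_trans with (2 := Ht), Rmax_l).
  assert (Ht2 : 36 ^ 2 <= t) by (apply Rle_trans with (2 := Ht), Rmax_r).
  specialize (HK t Ht1). assert (Hk := kap_range t ltac:(lra)).
  set (k := kap t) in *.
  assert (He : exp (- 2 * t) ^ 2 * (4 * t) <= 1).
  { replace (exp (- 2 * t) ^ 2) with (exp (- (4 * t))) by (simpl; rewrite Rmult_1_r, <- exp_plus; f_equal; ring).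
    assert (E : exp (- (4 * t)) * exp (4 * t) = 1) by (rewrite <- exp_plus, <- exp_0; f_equal; ring).
    assert (E1 := exp_ge_lin (4 * t)). assert (E2 := exp_pos (- (4 * t))). nra. }
  assert (Hep := exp_pos (- 2 * t)).
  assert (Hk2 : k ^ 2 <= 36 ^ 2 * exp (- 2 * t) ^ 2) by (rewrite <- Rpow_mult_distr; apply pow_incr; lra).
  assert (Hk2t : k ^ 2 * (4 * t) <= 36 ^ 2).
  { apply Rle_trans with (36 ^ 2 * exp (- 2 * t) ^ 2 * (4 * t)); [apply Rmult_le_compat_r; lra|].
    rewrite Rmult_assoc. lra. }
  assert (Hk2h : k ^ 2 <= / 2) by nra.
  assert (KU := ellK_upper k ltac:(lra) Hk2h). assert (KL := ellK_lower k Hk).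
  assert (K'L := ellK_kprime_lower k Hk). assert (K'U := ellK_kprime_upper k Hk).
  assert (Hik : 1 <= / k) by (rewrite <- Rinv_1 at 1; apply Rinv_le_contravar; lra).
  assert (HA := arcsinh_bounds (/ k) Hik).
  rewrite ln_Rinv in HA by lra.
  assert (Hln1 : ln k <= ln 36 - 2 * t).
  {
    apply Rle_trans with (ln (36 * exp (- 2 * t))); [apply ln_le; lra|].
    rewrite ln_mult, ln_exp by lra. lra. }
  assert (Hln2 : - ln 36 - 2 * t <= ln k).
  { apply Rle_trans with (ln (/ 36 * exp (- 2 * t))); [rewrite ln_mult, ln_exp, ln_Rinv by lra; lra|].
    apply ln_le; lra. }
  set (K := ellK k) in *. set (K' := ellK (kprime k)) in *.
  assert (H1 : Rabs (K' - 2 * t) <= C1) by (apply Rabs_le; unfold C1; lra).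
  unfold lognome. fold K K'.
  (* The main terms cancel in the numerator: 2 PI t is added and subtracted. *)
  replace (- PI * K' / K + 4 * t) with ((- PI * (K' - 2 * t) + 4 * t * (K - PI / 2)) / K) by (field; lra).
  unfold Rdiv at 1. rewrite Rabs_mult, Rabs_inv, (Rabs_right K) by lra.
  apply Rmult_le_reg_r with K; [lra|]. rewrite Rmult_assoc, Rinv_l, Rmult_1_r by lra.
  eapply Rle_trans; [apply Rabs_triang|].
  rewrite !Rabs_mult, Rabs_Ropp, (Rabs_right PI), (Rabs_right 4), (Rabs_right t), (Rabs_right (K - PI / 2)) by lra.
  assert (H2 : 4 * t * (K - PI / 2) <= PI / 2 * 36 ^ 2).
  { apply Rle_trans with (4 * t * (PI / 2 * k ^ 2)); [apply Rmult_le_compat_l; lra|].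
    replace (4 * t * (PI / 2 * k ^ 2)) with (PI / 2 * (k ^ 2 * (4 * t))) by ring.
    apply Rmult_le_compat_l; lra. }
  assert (HC1 : 0 < C1) by (unfold C1; lra).
  assert (H3 : PI * Rabs (K' - 2 * t) <= PI * C1) by (apply Rmult_le_compat_l; lra).
  assert (H4 : PI / 2 * (2 * C1 + 4 * 36 ^ 2) <= K * (2 * C1 + 4 * 36 ^ 2)) by (apply Rmult_le_compat_r; lra).
  nra.
Qed.

(* [lognome (kap t) + 4 t] doubles with t but stays bounded, hence vanishes. *)
Lemma lognome_kap t : 0 < t -> lognome (kap t) = - 4 * t.
Proof.
  intros Ht. destruct lognome_asymp as [T [C [HT HC]]].
  assert (Hn : forall n t, 0 < t -> lognome (kap (2 ^ n * t)) + 4 * (2 ^ n * t) = 2 ^ n * (lognome (kap t) + 4 * t)).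
  { induction n as [|n IH]; intros s Hs.
    - simpl. rewrite !Rmult_1_l. reflexivity.
    - replace (2 ^ S n * s) with (2 ^ n * (2 * s)) by (simpl; ring). rewrite IH, lognome_double by lra. simpl; ring. }
  apply NNPP; intros Hne.
  set (d := lognome (kap t) + 4 * t) in *.
  assert (Hd : 0 < Rabs d) by (apply Rabs_pos_lt; unfold d; lra).
  destruct (Pow_x_infinity 2 ltac:(rewrite Rabs_right; lra) (Rmax (T / t) (C / Rabs d + 1))) as [N HN].
  specialize (HN N (le_n N)).
  assert (Hp : 0 < 2 ^ N) by (apply pow_lt; lra).
  rewrite Rabs_right in HN by lra. apply Rge_le in HN.
  assert (H1 : T / t <= 2 ^ N) by (apply Rle_trans with (2 := HN), Rmax_l).
  assert (H2 : C / Rabs d + 1 <= 2 ^ N) by (apply Rle_trans with (2 := HN), Rmax_r).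
  assert (H3 : T <= 2 ^ N * t).
  { apply Rmult_le_compat_r with (r := t) in H1; [|lra]. unfold Rdiv in H1.
    rewrite Rmult_assoc, Rinv_l, Rmult_1_r in H1 by lra. exact H1. }
  specialize (HC _ H3). rewrite Hn, Rabs_mult, (Rabs_right (2 ^ N)) in HC by lra. fold d in HC.
  apply Rmult_le_compat_r with (r := Rabs d) in H2; [|lra].
  replace ((C / Rabs d + 1) * Rabs d) with (C + Rabs d) in H2 by (field; lra). lra.
Qed.

Lemma nome_kap t : 0 < t -> nome (kap t) = exp (- 4 * t).
Proof. intros Ht. rewrite <- lognome_kap by auto. reflexivity. Qed.

Lemma exp_pow_nat x n : exp x ^ n = exp (INR n * x).
Proof.
  induction n as [|n IH].
  - simpl. now rewrite Rmult_0_l, exp_0.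
  - rewrite S_INR. simpl. rewrite IH, <- exp_plus. f_equal; ring.
Qed.

Lemma cos_add_nPI x n : cos (x + INR n * PI) = (-1) ^ n * cos x.
Proof.
  induction n as [|n IH].
  - simpl. rewrite Rmult_0_l, Rplus_0_r; ring.
  - rewrite S_INR. replace (x + (INR n + 1) * PI) with (x + INR n * PI + PI) by ring.
    rewrite neg_cos, IH. simpl; ring.
Qed.

(** * [Theta] in terms of theta series *)

(** The signs (-1)^n come from shifting the argument by PI / 2, which shifts the phase 2 n y by n
    PI. *)
Lemma theta4_kap t y : 0 < t -> theta4 (kap t) y = th 0 t (y + PI / 2).
Proof.
  intros Ht. unfold theta4.
  set (f := fun n : Z => gw t (2 * n + 0) * cos (IZR (2 * n + 0) * (y + PI / 2))).
  assert (Hev : forall n, f (- n)%Z = f n).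
  { intros n. unfold f. replace (2 * - n + 0)%Z with (- (2 * n + 0))%Z by ring.
    rewrite gw_opp, opp_IZR, <- (cos_neg (IZR (2 * n + 0) * _)). do 2 f_equal. ring. }
  assert (H := hsum_even_series f _ Hev (th_hsum 0 t (y + PI / 2) Ht)).
  assert (F0 : f 0%Z = 1).
  { unfold f, gw. simpl Z.mul. simpl Z.add. replace (- (t * 0 ^ 2)) with 0 by ring.
    rewrite exp_0, Rmult_0_l, cos_0. ring. }
  rewrite F0 in H.
  rewrite (Series_ext _ (fun n : nat => f (Z.of_nat (S n)))).
  - rewrite (is_series_unique _ _ H). field.
  - intros n. unfold f. rewrite nome_kap, exp_pow_nat by auto.
    set (m := S n). rewrite Z.add_0_r. unfold gw.
    replace (IZR (2 * Z.of_nat m) * (y + PI / 2)) with (2 * INR m * y + INR m * PI)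
      by (rewrite mult_IZR, <- INR_IZR_INZ; field).
    rewrite cos_add_nPI. rewrite mult_IZR, <- INR_IZR_INZ, mult_INR.
    replace (INR m * INR m * (-4 * t)) with (- (t * (2 * INR m) ^ 2)) by ring. ring.
Qed.

Lemma Theta_kap t x : 0 < t -> Theta (kap t) x = th 0 t (PI * x / (2 * ellK (kap t)) + PI / 2).
Proof. intros Ht. unfold Theta. now apply theta4_kap. Qed.

Lemma Theta_pos k x : 0 < k < 1 -> 0 < Theta k x.
Proof. intros Hk. destruct (kap_onto k Hk) as [t [Ht <-]]. rewrite Theta_kap by auto. now apply th0_pos. Qed.

Lemma ex_derive_Theta k x : 0 < k < 1 -> ex_derive (Theta k) x.
Proof.
  intros Hk. destruct (kap_onto k Hk) as [t [Ht <-]].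
  apply ex_derive_ext with (fun x => th 0 t (PI * x / (2 * ellK (kap t)) + PI / 2)).
  - intros y. exact (eq_sym (Theta_kap t y Ht)).
  - auto_derive. now apply ex_derive_th.
Qed.

Lemma Theta_2K k x : 0 < k < 1 -> Theta k (x + 2 * ellK k) = Theta k x.
Proof.
  intros Hk. assert (H := ellK_pos _ Hk). destruct (kap_onto k Hk) as [t [Ht <-]]. rewrite !Theta_kap by auto.
  rewrite <- (th0_PI t (PI * x / _ + _)) by auto. f_equal. field. lra.
Qed.

Lemma Theta_mul_formula k x y : 0 < k < 1 ->
  Theta k 0 ^ 2 * (Theta k (x + y) * Theta k (x - y)) =
  Theta k x ^ 2 * Theta k y ^ 2 * (1 - k ^ 2 * sn k x ^ 2 * sn k y ^ 2).
Proof.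
  intros Hk. assert (H := ellK_pos _ Hk). destruct (kap_onto k Hk) as [t [Ht <-]]. rewrite !Theta_kap by auto.
  set (K := ellK (kap t)) in *. assert (HP := PI_RGT_0).
  (* In the variable of the theta series, k sn^2 = theta_1^2 / theta_4^2. *)
  assert (Hs : forall z, kap t * sn (kap t) z ^ 2 = th 1 t (PI * z / (2 * K) - PI / 2) ^ 2 / th 0 t (PI * z / (2 * K) + PI / 2) ^ 2).
  { intros z. assert (E := sn_snq t (PI * z / (2 * K)) Ht).
    rewrite lam_eq in E by auto. fold K in E.
    replace (2 * K / PI * (PI * z / (2 * K))) with z in E by (field; lra).
    rewrite E. unfold snq, kap. assert (H0 := th_at0_pos 0 t Ht). assert (H1 := th_at0_pos 1 t Ht).
    assert (H2 := th0_pos t (PI * z / (2 * K) + PI / 2) Ht). field. lra. }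
  replace (1 - kap t ^ 2 * sn (kap t) x ^ 2 * sn (kap t) y ^ 2)
    with (1 - (kap t * sn (kap t) x ^ 2) * (kap t * sn (kap t) y ^ 2)) by ring.
  rewrite !Hs.
  replace (PI * (x + y) / (2 * K)) with (PI * x / (2 * K) + PI * y / (2 * K)) by (field; lra).
  replace (PI * (x - y) / (2 * K)) with (PI * x / (2 * K) - PI * y / (2 * K)) by (field; lra).
  replace (PI * 0 / (2 * K) + PI / 2) with (PI / 2) by (field; lra).
  rewrite th4_mul_formula by auto.
  assert (H2 := th0_pos t (PI * x / (2 * K) + PI / 2) Ht).
  assert (H3 := th0_pos t (PI * y / (2 * K) + PI / 2) Ht). field. lra.
Qed.

(** * The periodic profile *)

Definition ordered (z1 z2 z3 : R) : Prop := 0 < z3 /\ z3 < z2 /\ z2 < z1.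

Lemma nuc_sq z1 z2 z3 : ordered z1 z2 z3 -> nuc z1 z3 ^ 2 = z1 ^ 2 - z3 ^ 2.
Proof. intros [H3 [H2 H1]]. unfold nuc. apply pow2_sqrt. nra. Qed.

Lemma nuc_pos z1 z2 z3 : ordered z1 z2 z3 -> 0 < nuc z1 z3.
Proof. intros [H3 [H2 H1]]. unfold nuc. apply sqrt_lt_R0. nra. Qed.

Lemma kmod_sq z1 z2 z3 : ordered z1 z2 z3 -> kmod z1 z2 z3 ^ 2 = (z1 ^ 2 - z2 ^ 2) / (z1 ^ 2 - z3 ^ 2).
Proof.
  intros [H3 [H2 H1]]. unfold kmod. apply pow2_sqrt. left. apply Rdiv_lt_0_compat; nra.
Qed.

Lemma kmod_range z1 z2 z3 : ordered z1 z2 z3 -> 0 < kmod z1 z2 z3 < 1.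
Proof.
  intros H. assert (Hs := kmod_sq _ _ _ H). destruct H as [H3 [H2 H1]].
  assert (Hp : 0 < kmod z1 z2 z3) by (unfold kmod; apply sqrt_lt_R0, Rdiv_lt_0_compat; nra).
  split; [exact Hp|].
  assert (kmod z1 z2 z3 ^ 2 < 1); [|nra].
  rewrite Hs. apply Rmult_lt_reg_r with (z1 ^ 2 - z3 ^ 2); [nra|].
  unfold Rdiv. rewrite Rmult_assoc, Rinv_l by nra. nra.
Qed.

Lemma nuc_kmod_sq z1 z2 z3 : ordered z1 z2 z3 -> nuc z1 z3 ^ 2 * kmod z1 z2 z3 ^ 2 = z1 ^ 2 - z2 ^ 2.
Proof.
  intros H. rewrite (kmod_sq _ _ _ H), (nuc_sq _ _ _ H). destruct H as [H3 [H2 H1]]. field. nra.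
Qed.

Definition phi_den (z1 z2 z3 X : R) : R := (z1 + z3) - (z1 - z2) * X.

Lemma phi_den_bound z1 z2 z3 X : ordered z1 z2 z3 -> 0 <= X <= 1 ->
  z2 + z3 <= phi_den z1 z2 z3 X <= z1 + z3.
Proof. intros [H3 [H2 H1]] HX. unfold phi_den. nra. Qed.

Definition dphi (z1 z2 z3 x : R) : R :=
  let u := nuc z1 z3 * x in let k := kmod z1 z2 z3 in
  4 * (z1 + z3) * (z2 + z3) * (z1 - z2) * nuc z1 z3 * (sn k u * cn k u * dn k u)
    / phi_den z1 z2 z3 (sn k u ^ 2) ^ 2.

Lemma is_derive_phi z1 z2 z3 x : ordered z1 z2 z3 -> is_derive (phi z1 z2 z3) x (dphi z1 z2 z3 x).
Proof.
  intros H. assert (Hk := kmod_range _ _ _ H).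
  set (k := kmod z1 z2 z3) in *. set (nu := nuc z1 z3).
  assert (D1 := is_derive_sn k (nu * x) Hk).
  assert (HW := phi_den_bound _ _ _ _ H (sn_sq_bound k (nu * x))). destruct H as [H3 [H2 H1]].
  unfold phi, dphi. fold k nu. unfold phi_den in *.
  auto_derive.
  - split; [eexists; exact D1|]. split; [|exact I]. simpl in HW. lra.
  - change (fun y => sn k y) with (sn k). rewrite (is_derive_unique _ _ _ D1). field. lra.
Qed.

(** The travelling-wave equation integrated once, with integration constant b. *)
Lemma is_derive_dphi z1 z2 z3 x : ordered z1 z2 z3 ->
  is_derive (dphi z1 z2 z3) x
    (2 * phi z1 z2 z3 x ^ 3 - ccoef z1 z2 z3 * phi z1 z2 z3 x + bcoef z1 z2 z3).
Proof.
  intros H. assert (Hk := kmod_range _ _ _ H).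
  assert (Hn2 := nuc_sq _ _ _ H). assert (Hnk := nuc_kmod_sq _ _ _ H).
  set (k := kmod z1 z2 z3) in *. set (nu := nuc z1 z3) in *.
  assert (D1 := is_derive_sn k (nu * x) Hk). assert (D2 := is_derive_cn k (nu * x) Hk).
  assert (D3 := is_derive_dn k (nu * x) Hk).
  assert (C1 := cn_sq k (nu * x)). assert (C2 := dn_sq k (nu * x) Hk).
  assert (HW := phi_den_bound _ _ _ _ H (sn_sq_bound k (nu * x))). destruct H as [H3 [H2 H1]].
  unfold phi, dphi. fold k nu. unfold phi_den in *.
  auto_derive.
  - split; [eexists; exact D1|]. split; [eexists; exact D2|]. split; [eexists; exact D3|]. split; [|split; [|exact I]];
    simpl in HW |- *; first [eexists; exact D1 | apply Rgt_not_eq, Rmult_lt_0_compat; lra].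
  - change (fun y => sn k y) with (sn k). change (fun y => cn k y) with (cn k). change (fun y => dn k y) with (dn k).
    rewrite (is_derive_unique _ _ _ D1), (is_derive_unique _ _ _ D2), (is_derive_unique _ _ _ D3).
    set (s := sn k (nu * x)) in *. set (c := cn k (nu * x)) in *. set (d := dn k (nu * x)) in *.
    clear D1 D2 D3.
    set (W := z1 + z3 - (z1 - z2) * s ^ 2) in *.
    (* Arranged so that nu and k occur only as nu^2 and nu^2 k^2, which are rational in the
       parameters. *)
    transitivity (4 * (z1 + z3) * (z2 + z3) * (z1 - z2) *
      ((nu ^ 2 * (c ^ 2 * d ^ 2) - s ^ 2 * (nu ^ 2 * d ^ 2) - (nu ^ 2 * k ^ 2) * s ^ 2 * c ^ 2) / W ^ 2
        + 4 * (z1 - z2) * s ^ 2 * (nu ^ 2 * (c ^ 2 * d ^ 2)) / W ^ 3)).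
    + unfold W. field. fold W. lra.
    + rewrite C1, C2.
      replace (nu ^ 2 * ((1 - s ^ 2) * (1 - k ^ 2 * s ^ 2))) with
        ((1 - s ^ 2) * (nu ^ 2 - nu ^ 2 * k ^ 2 * s ^ 2)) by ring.
      replace (nu ^ 2 * (1 - k ^ 2 * s ^ 2)) with (nu ^ 2 - nu ^ 2 * k ^ 2 * s ^ 2) by ring.
      rewrite Hnk, Hn2. unfold ccoef, bcoef. unfold W. field. fold W. lra.
Qed.

(** The quartic in phi has the roots - (z1 + z2 + z3), z1 + z2 - z3, z1 + z3 - z2 and z2 + z3 - z1;
    phi oscillates between the last two. *)
Lemma dphi_sq z1 z2 z3 x : ordered z1 z2 z3 ->
  dphi z1 z2 z3 x ^ 2 = phi z1 z2 z3 x ^ 4 - ccoef z1 z2 z3 * phi z1 z2 z3 x ^ 2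
    + 2 * bcoef z1 z2 z3 * phi z1 z2 z3 x
    + (z1 ^ 4 + z2 ^ 4 + z3 ^ 4 - 2 * (z1 ^ 2 * z2 ^ 2 + z2 ^ 2 * z3 ^ 2 + z1 ^ 2 * z3 ^ 2)).
Proof.
  intros H. assert (Hk := kmod_range _ _ _ H).
  assert (Hn2 := nuc_sq _ _ _ H). assert (Hnk := nuc_kmod_sq _ _ _ H).
  set (k := kmod z1 z2 z3) in *. set (nu := nuc z1 z3) in *.
  assert (C1 := cn_sq k (nu * x)). assert (C2 := dn_sq k (nu * x) Hk).
  assert (HW := phi_den_bound _ _ _ _ H (sn_sq_bound k (nu * x))). destruct H as [H3 [H2 H1]].
  unfold phi, dphi. fold k nu. unfold phi_den in *.
  set (s := sn k (nu * x)) in *. set (c := cn k (nu * x)) in *. set (d := dn k (nu * x)) in *.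
  set (W := z1 + z3 - (z1 - z2) * s ^ 2) in *.
  transitivity ((4 * (z1 + z3) * (z2 + z3) * (z1 - z2)) ^ 2 * s ^ 2 * (nu ^ 2 * (c ^ 2 * d ^ 2)) / W ^ 4).
  - unfold W. field. fold W. lra.
  - rewrite C1, C2.
    replace (nu ^ 2 * ((1 - s ^ 2) * (1 - k ^ 2 * s ^ 2))) with
        ((1 - s ^ 2) * (nu ^ 2 - nu ^ 2 * k ^ 2 * s ^ 2)) by ring.
    rewrite Hnk, Hn2. unfold ccoef, bcoef. unfold W. field. fold W. lra.
Qed.

Lemma phi_bounds z1 z2 z3 x : ordered z1 z2 z3 ->
  z2 + z3 - z1 <= phi z1 z2 z3 x <= z1 + z3 - z2.
Proof.
  intros H. assert (HW := phi_den_bound _ _ _ _ H (sn_sq_bound (kmod z1 z2 z3) (nuc z1 z3 * x))).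
  destruct H as [H3 [H2 H1]]. unfold phi. fold (phi_den z1 z2 z3 (sn (kmod z1 z2 z3) (nuc z1 z3 * x) ^ 2)).
  set (W := phi_den _ _ _ _) in *.
  assert (A1 : 2 * (z2 + z3) <= 2 * (z1 + z3) * (z2 + z3) / W).
  { apply Rmult_le_reg_r with W; [lra|]. unfold Rdiv. rewrite (Rmult_assoc _ (/ W)), Rinv_l, Rmult_1_r by lra. nra. }
  assert (A2 : 2 * (z1 + z3) * (z2 + z3) / W <= 2 * (z1 + z3)).
  { apply Rmult_le_reg_r with W; [lra|]. unfold Rdiv. rewrite (Rmult_assoc _ (/ W)), Rinv_l, Rmult_1_r by lra. nra. }
  lra.
Qed.

Definition kb_D (z1 z2 z3 x : R) : R :=
  ccoef z1 z2 z3 + 2 * dphi z1 z2 z3 x - 2 * phi z1 z2 z3 x ^ 2.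

Lemma is_derive_kb_D z1 z2 z3 x : ordered z1 z2 z3 ->
  is_derive (kb_D z1 z2 z3) x (2 * bcoef z1 z2 z3 - 2 * phi z1 z2 z3 x * kb_D z1 z2 z3 x).
Proof.
  intros H. assert (D1 := is_derive_phi z1 z2 z3 x H). assert (D2 := is_derive_dphi z1 z2 z3 x H).
  unfold kb_D at 1. auto_derive.
  - split; [eexists; exact D2|]. split; [eexists; exact D1 | exact I].
  - change (fun y => phi z1 z2 z3 y) with (phi z1 z2 z3). change (fun y => dphi z1 z2 z3 y) with (dphi z1 z2 z3).
    rewrite (is_derive_unique _ _ _ D1), (is_derive_unique _ _ _ D2). unfold kb_D. ring.
Qed.

(* [D (c - 2 phi' - 2 phi^2)] is an affine function of [phi] by the first integral; it is bounded below
   through [phi <= z1 + z3 - z2]. *)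
Lemma kb_D_lower z1 z2 z3 x : ordered z1 z2 z3 ->
  16 * (z1 * z2 + z2 * z3 - z1 * z3) ^ 2 / (2 * ccoef z1 z2 z3) <= kb_D z1 z2 z3 x.
Proof.
  intros H. assert (H1 := dphi_sq z1 z2 z3 x H). assert (H2 := phi_bounds z1 z2 z3 x H).
  assert (Hc : 0 < ccoef z1 z2 z3) by (destruct H as [? [? ?]]; unfold ccoef; nra).
  (* The product equals c^2 - 4 h - 8 b phi, with h the constant of the first integral. At the
     maximum phi = z1 + z3 - z2 it takes the value on the left. *)
  assert (Hprod : 16 * (z1 * z2 + z2 * z3 - z1 * z3) ^ 2 <=
     kb_D z1 z2 z3 x * (ccoef z1 z2 z3 - 2 * dphi z1 z2 z3 x - 2 * phi z1 z2 z3 x ^ 2)).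
  { replace (kb_D z1 z2 z3 x * _) with
      ((ccoef z1 z2 z3 - 2 * phi z1 z2 z3 x ^ 2) ^ 2 - 4 * dphi z1 z2 z3 x ^ 2) by (unfold kb_D; ring).
    rewrite H1. unfold ccoef, bcoef. destruct H as [Z3 [Z2 Z1]].
    assert (Hz : 0 < z1 * z2 * z3) by (repeat apply Rmult_lt_0_compat; lra).
    set (p := phi z1 z2 z3 x) in *.
    assert (Hz2 : z1 * z2 * z3 * p <= z1 * z2 * z3 * (z1 + z3 - z2)) by (apply Rmult_le_compat_l; lra).
    nra. }
  assert (Hsum : 0 < ccoef z1 z2 z3 - 2 * phi z1 z2 z3 x ^ 2).
  { unfold ccoef. destruct H as [Z3 [Z2 Z1]]. set (p := phi z1 z2 z3 x) in *.
    assert (p ^ 2 < z1 ^ 2 + z2 ^ 2 + z3 ^ 2); [|lra].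
    destruct (Rle_lt_dec 0 p); nra. }
  assert (Hpos : 0 < z1 * z2 + z2 * z3 - z1 * z3) by (destruct H as [? [? ?]]; nra).
  assert (Hm : 0 < 16 * (z1 * z2 + z2 * z3 - z1 * z3) ^ 2) by nra.
  set (m := 16 * (z1 * z2 + z2 * z3 - z1 * z3) ^ 2) in *.
  set (D := kb_D z1 z2 z3 x) in *.
  set (D' := ccoef z1 z2 z3 - 2 * dphi z1 z2 z3 x - 2 * phi z1 z2 z3 x ^ 2) in *.
  (* Positive sum and positive product make D positive; D' <= 2 c then converts the bound on the
     product into one on D. *)
  assert (Hs : D + D' = 2 * (ccoef z1 z2 z3 - 2 * phi z1 z2 z3 x ^ 2)) by (unfold D, D', kb_D; ring).
  assert (HD : 0 < D) by nra.
  assert (HD' : D' <= 2 * ccoef z1 z2 z3).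
  { assert (0 <= phi z1 z2 z3 x ^ 2) by apply pow2_ge_0. lra. }
  apply Rmult_le_reg_r with (2 * ccoef z1 z2 z3); [lra|].
  unfold Rdiv. rewrite Rmult_assoc, Rinv_l, Rmult_1_r by lra. nra.
Qed.

Lemma kb_D_pos z1 z2 z3 x : ordered z1 z2 z3 -> 0 < kb_D z1 z2 z3 x.
Proof.
  intros H. apply Rlt_le_trans with (2 := kb_D_lower z1 z2 z3 x H). destruct H as [H3 [H2 H1]].
  apply Rdiv_lt_0_compat.
  - assert (0 < z1 * z2 + z2 * z3 - z1 * z3) by nra. nra.
  - unfold ccoef. nra.
Qed.

(** * The zeta function and the choice of alpha *)

(** Logarithmic derivative of [Theta_mul_formula] with respect to y. *)
Lemma jacZ_add k x y : 0 < k < 1 ->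
  jacZ k (x + y) - jacZ k (x - y) =
  2 * jacZ k y - 2 * k ^ 2 * sn k x ^ 2 * (sn k y * cn k y * dn k y) / (1 - k ^ 2 * sn k x ^ 2 * sn k y ^ 2).
Proof.
  intros Hk. assert (P0 := Theta_pos k 0 Hk). assert (P1 := Theta_pos k (x + y) Hk).
  assert (P2 := Theta_pos k (x - y) Hk). assert (P3 := Theta_pos k x Hk). assert (P4 := Theta_pos k y Hk).
  assert (D0 := is_derive_sn k y Hk).
  assert (E := fun y => Theta_mul_formula k x y Hk).
  assert (D1 : is_derive (fun y => Theta k 0 ^ 2 * (Theta k (x + y) * Theta k (x - y))) y
    (Theta k 0 ^ 2 * (Derive (Theta k) (x + y) * Theta k (x - y) - Theta k (x + y) * Derive (Theta k) (x - y)))).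
  { auto_derive.
    - repeat split; now apply ex_derive_Theta.
    - change (fun y => Theta k y) with (Theta k). unfold Rminus. ring. }
  assert (D2 : is_derive (fun y => Theta k x ^ 2 * Theta k y ^ 2 * (1 - k ^ 2 * sn k x ^ 2 * sn k y ^ 2)) y
    (Theta k x ^ 2 * (2 * Theta k y * Derive (Theta k) y * (1 - k ^ 2 * sn k x ^ 2 * sn k y ^ 2)
       - Theta k y ^ 2 * (2 * k ^ 2 * sn k x ^ 2 * (sn k y * cn k y * dn k y))))).
  { auto_derive.
    - split; [now apply ex_derive_Theta|]. split; [eexists; exact D0 | exact I].
    - change (fun y => Theta k y) with (Theta k). change (fun y => sn k y) with (sn k).
      rewrite (is_derive_unique _ _ _ D0). ring. }
  apply is_derive_ext with (1 := E) in D1.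
  assert (E1 := is_derive_unique _ _ _ D1). assert (E2 := is_derive_unique _ _ _ D2).
  assert (E3 := eq_trans (eq_sym E1) E2). specialize (E y).
  unfold jacZ.
  set (a := Theta k (x + y)) in *. set (b := Theta k (x - y)) in *. set (c := Theta k 0) in *.
  set (p := Theta k x) in *. set (r := Theta k y) in *.
  set (a' := Derive (Theta k) (x + y)) in *. set (b' := Derive (Theta k) (x - y)) in *. set (r' := Derive (Theta k) y) in *.
  set (w := 1 - k ^ 2 * sn k x ^ 2 * sn k y ^ 2) in *.
  assert (Hw : w <> 0).
  { intros Hw. rewrite Hw, Rmult_0_r in E.
    assert (0 < c ^ 2 * (a * b)) by (apply Rmult_lt_0_compat; [apply pow_lt; lra | nra]). lra. }
  transitivity ((c ^ 2 * (a' * b - a * b')) / (c ^ 2 * (a * b))).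
  - field. lra.
  - rewrite E3, E. field. repeat split; lra.
Qed.

Definition admissible (z1 z2 z3 alpha : R) : Prop :=
  ordered z1 z2 z3 /\ 0 < alpha < ellK (kmod z1 z2 z3) /\
  sn (kmod z1 z2 z3) alpha = sqrt ((z1 - z3) / (z1 + z2)).

Lemma sn_alpha_sq z1 z2 z3 al : admissible z1 z2 z3 al ->
  sn (kmod z1 z2 z3) al ^ 2 = (z1 - z3) / (z1 + z2).
Proof.
  intros [[H3 [H2 H1]] [_ ->]]. apply pow2_sqrt. left. apply Rdiv_lt_0_compat; lra.
Qed.

Lemma sn_alpha_pos z1 z2 z3 al : admissible z1 z2 z3 al -> 0 < sn (kmod z1 z2 z3) al.
Proof.
  intros [[H3 [H2 H1]] [_ ->]]. apply sqrt_lt_R0. apply Rdiv_lt_0_compat; lra.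
Qed.

(** The squares agree, and both sides are positive since alpha < K. *)
Lemma cndn_alpha z1 z2 z3 al : admissible z1 z2 z3 al ->
  nuc z1 z3 * (cn (kmod z1 z2 z3) al * dn (kmod z1 z2 z3) al) = (z2 + z3) * sn (kmod z1 z2 z3) al.
Proof.
  intros H. assert (Hs2 := sn_alpha_sq _ _ _ _ H). assert (Hs := sn_alpha_pos _ _ _ _ H).
  destruct H as [H [Ha _]]. assert (Hk := kmod_range _ _ _ H).
  assert (Hn := nuc_pos _ _ _ H). assert (Hn2 := nuc_sq _ _ _ H). assert (Hk2 := kmod_sq _ _ _ H).
  assert (Hc := cn_pos _ al Hk ltac:(lra)). assert (Hd := dn_pos _ al Hk).
  assert (Hc2 := cn_sq (kmod z1 z2 z3) al). assert (Hd2 := dn_sq _ al Hk).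
  set (k := kmod z1 z2 z3) in *. set (nu := nuc z1 z3) in *.
  destruct H as [H3 [H2 H1]].
  assert (E : (nu * (cn k al * dn k al)) ^ 2 = ((z2 + z3) * sn k al) ^ 2).
  { rewrite !Rpow_mult_distr, Hn2, Hc2, Hd2, Hs2, Hk2. field. repeat split; nra. }
  assert (0 < nu * (cn k al * dn k al)) by (repeat apply Rmult_lt_0_compat; lra).
  assert (0 < (z2 + z3) * sn k al) by (apply Rmult_lt_0_compat; lra). nra.
Qed.

(** The choice of alpha amounts to k^2 sn^2 alpha = (z1 - z2) / (z1 + z3), which makes the
    denominator of the addition formula proportional to that of phi. *)
Lemma phi_jacZ z1 z2 z3 al x : admissible z1 z2 z3 al ->
  phi z1 z2 z3 x = s0 z1 z2 z3 al + nuc z1 z3 *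
    (jacZ (kmod z1 z2 z3) (nuc z1 z3 * x - al) - jacZ (kmod z1 z2 z3) (nuc z1 z3 * x + al)).
Proof.
  intros H. assert (Hs2 := sn_alpha_sq _ _ _ _ H). assert (Hcd := cndn_alpha _ _ _ _ H).
  destruct H as [H [Ha _]]. assert (Hk := kmod_range _ _ _ H). assert (Hk2 := kmod_sq _ _ _ H).
  assert (HJ := jacZ_add (kmod z1 z2 z3) (nuc z1 z3 * x) al Hk).
  unfold s0, phi. fold (nuc z1 z3).
  assert (HW := phi_den_bound _ _ _ _ H (sn_sq_bound (kmod z1 z2 z3) (nuc z1 z3 * x))).
  set (k := kmod z1 z2 z3) in *. set (nu := nuc z1 z3) in *.
  destruct H as [H3 [H2 H1]].
  replace (jacZ k (nu * x - al) - jacZ k (nu * x + al)) with (- (jacZ k (nu * x + al) - jacZ k (nu * x - al))) by ring.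
  rewrite HJ. set (X := sn k (nu * x) ^ 2) in *. unfold phi_den in HW.
  assert (Ew : 1 - k ^ 2 * X * sn k al ^ 2 = (z1 + z3 - (z1 - z2) * X) / (z1 + z3)).
  { rewrite Hs2, Hk2. field. repeat split; nra. }
  rewrite Ew.
  transitivity (z2 + z3 - z1 + 2 * X * k ^ 2 * sn k al * (nu * (cn k al * dn k al)) / ((z1 + z3 - (z1 - z2) * X) / (z1 + z3))).
  - rewrite Hcd. replace (2 * X * k ^ 2 * sn k al * ((z2 + z3) * sn k al)) with (2 * X * (z2 + z3) * (k ^ 2 * sn k al ^ 2)) by ring.
    replace (k ^ 2 * sn k al ^ 2) with ((z1 - z2) / (z1 + z3)).
    + field. lra.
    + rewrite Hs2, Hk2. field. repeat split; nra.
  - field. lra.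
Qed.

(* The right-hand side is even about [x = al / nu], so [phi^2 - phi'] and [phi^2 + phi'] are exchanged by the
   shift by [2 al / nu]. *)
Lemma phi_miura z1 z2 z3 al x : admissible z1 z2 z3 al ->
  phi z1 z2 z3 x ^ 2 - dphi z1 z2 z3 x =
  (z2 + z3 - z1) ^ 2 - 2 * (z1 - z2) * (z1 - z3)
  + 2 * (z1 ^ 2 - z2 ^ 2) * sn (kmod z1 z2 z3) (nuc z1 z3 * x - al) ^ 2.
Proof.
  intros H. assert (Hs2 := sn_alpha_sq _ _ _ _ H). assert (Hcd := cndn_alpha _ _ _ _ H).
  destruct H as [H [Ha _]]. assert (Hk := kmod_range _ _ _ H). assert (Hk2 := kmod_sq _ _ _ H).
  assert (Hn := nuc_pos _ _ _ H). assert (Hn2 := nuc_sq _ _ _ H). assert (Hnk := nuc_kmod_sq _ _ _ H).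
  assert (HW := phi_den_bound _ _ _ _ H (sn_sq_bound (kmod z1 z2 z3) (nuc z1 z3 * x))).
  replace (nuc z1 z3 * x - al) with (nuc z1 z3 * x + - al) by ring. rewrite sn_plus, sn_opp, cn_opp, dn_opp by auto.
  unfold dphi, phi. unfold phi_den in *.
  set (k := kmod z1 z2 z3) in *. set (nu := nuc z1 z3) in *.
  assert (C1 := cn_sq k (nu * x)). assert (C2 := dn_sq k (nu * x) Hk).
  assert (A1 := cn_sq k al). assert (A2 := dn_sq k al Hk).
  set (s := sn k (nu * x)) in *. set (c := cn k (nu * x)) in *. set (d := dn k (nu * x)) in *.
  set (sa := sn k al) in *. set (ca := cn k al) in *. set (da := dn k al) in *.
  destruct H as [H3 [H2 H1]].
  assert (Ew : 1 - k ^ 2 * s ^ 2 * (- sa) ^ 2 = (z1 + z3 - (z1 - z2) * s ^ 2) / (z1 + z3)).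
  { replace ((- sa) ^ 2) with (sa ^ 2) by ring. rewrite Hs2, Hk2. field. repeat split; nra. }
  rewrite Ew.
  set (W := z1 + z3 - (z1 - z2) * s ^ 2) in *.
  replace (((s * ca * da + - sa * c * d) / (W / (z1 + z3))) ^ 2) with
    ((s ^ 2 * (ca ^ 2 * da ^ 2) + sa ^ 2 * (c ^ 2 * d ^ 2) - 2 * (sa / nu) * (nu * (ca * da)) * (s * c * d)) * (z1 + z3) ^ 2 / W ^ 2)
    by (field; lra).
  rewrite Hcd.
  replace (2 * (sa / nu) * ((z2 + z3) * sa)) with (2 * (z2 + z3) * (sa ^ 2) * nu / nu ^ 2) by (field; lra).
  rewrite C1, C2, A1, A2, Hs2, Hk2, Hn2. unfold W. field.
  fold W. repeat split; nra.
Qed.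

(** * The breather *)

Ltac mul_pos := repeat first [assumption | lra | apply Rmult_lt_0_compat].

Definition theta_ratio (z1 z2 z3 al x : R) : R :=
  Theta (kmod z1 z2 z3) (nuc z1 z3 * x - al) ^ 2 / Theta (kmod z1 z2 z3) (nuc z1 z3 * x + al) ^ 2.

(** A primitive of 2 phi, exponentiated: the integrating factor for the linear equations satisfied
    by D and by the shifted sums. *)
Definition exp_ratio (z1 z2 z3 al x : R) : R := exp (2 * (s0 z1 z2 z3 al * x)) * theta_ratio z1 z2 z3 al x.

Lemma theta_ratio_pos z1 z2 z3 al x : ordered z1 z2 z3 -> 0 < theta_ratio z1 z2 z3 al x.
Proof.
  intros H. assert (Hk := kmod_range _ _ _ H). unfold theta_ratio.
  apply Rdiv_lt_0_compat; apply pow_lt; now apply Theta_pos.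
Qed.

Lemma exp_ratio_pos z1 z2 z3 al x : ordered z1 z2 z3 -> 0 < exp_ratio z1 z2 z3 al x.
Proof. intros H. apply Rmult_lt_0_compat; [apply exp_pos | now apply theta_ratio_pos]. Qed.

Lemma is_derive_exp_ratio z1 z2 z3 al x : admissible z1 z2 z3 al ->
  is_derive (exp_ratio z1 z2 z3 al) x (2 * phi z1 z2 z3 x * exp_ratio z1 z2 z3 al x).
Proof.
  intros Hadm. rewrite (phi_jacZ _ _ _ _ x Hadm). destruct Hadm as [H _].
  assert (Hk := kmod_range _ _ _ H). unfold exp_ratio, theta_ratio, jacZ.
  set (k := kmod z1 z2 z3) in *. set (nu := nuc z1 z3).
  assert (P1 := Theta_pos k (nu * x - al) Hk). assert (P2 := Theta_pos k (nu * x + al) Hk).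
  auto_derive.
  - split; [now apply ex_derive_Theta|]. split; [now apply ex_derive_Theta|]. split; [|exact I].
    apply Rgt_not_eq. mul_pos.
  - change (fun y => Theta k y) with (Theta k). fold (nu * x - al). field. lra.
Qed.

Lemma s0_pos z1 z2 z3 al : admissible z1 z2 z3 al -> 0 < s0 z1 z2 z3 al.
Proof.
  intros Hadm. assert (H := proj1 Hadm).
  assert (Hk := kmod_range _ _ _ H). assert (Hn := nuc_pos _ _ _ H).
  assert (HK := ellK_pos _ Hk).
  assert (Hb : 0 < bcoef z1 z2 z3) by (destruct H as [? [? ?]]; unfold bcoef; mul_pos).
  (* A common period of D and of the theta quotient, so the only growth over it is the factor exp (2
     s0 T). *)
  set (T := 2 * ellK (kmod z1 z2 z3) / nuc z1 z3).
  assert (HT : 0 < T) by (unfold T; apply Rdiv_lt_0_compat; lra).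
  assert (EnT : nuc z1 z3 * T = 0 + 2 * ellK (kmod z1 z2 z3)) by (unfold T; field; lra).
  assert (EsT : sn (kmod z1 z2 z3) (nuc z1 z3 * T) = 0) by (rewrite EnT, sn_2K, sn_0 by auto; ring).
  assert (Es0 : sn (kmod z1 z2 z3) (nuc z1 z3 * 0) = 0) by (rewrite Rmult_0_r, sn_0 by auto; ring).
  assert (ED : kb_D z1 z2 z3 T = kb_D z1 z2 z3 0).
  { unfold kb_D, dphi, phi. rewrite EsT, Es0. unfold Rdiv. ring. }
  assert (ER : theta_ratio z1 z2 z3 al T = theta_ratio z1 z2 z3 al 0).
  { unfold theta_ratio. rewrite EnT, Rmult_0_r.
    replace (0 + 2 * ellK (kmod z1 z2 z3) - al) with (0 - al + 2 * ellK (kmod z1 z2 z3)) by ring.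
    replace (0 + 2 * ellK (kmod z1 z2 z3) + al) with (0 + al + 2 * ellK (kmod z1 z2 z3)) by ring.
    now rewrite !Theta_2K. }
  destruct (MVT_gen (fun x => exp_ratio z1 z2 z3 al x * kb_D z1 z2 z3 x) 0 T (fun x => 2 * bcoef z1 z2 z3 * exp_ratio z1 z2 z3 al x))
    as [c [_ Hc]].
  - intros x _. assert (D1 := is_derive_exp_ratio z1 z2 z3 al x Hadm). assert (D2 := is_derive_kb_D z1 z2 z3 x H).
    auto_derive.
    + split; [eexists; exact D1|]. split; [eexists; exact D2 | exact I].
    + change (fun y => exp_ratio z1 z2 z3 al y) with (exp_ratio z1 z2 z3 al). change (fun y => kb_D z1 z2 z3 y) with (kb_D z1 z2 z3).
      rewrite (is_derive_unique _ _ _ D1), (is_derive_unique _ _ _ D2). ring.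
  - intros x _. assert (D1 := is_derive_exp_ratio z1 z2 z3 al x Hadm). assert (D2 := is_derive_kb_D z1 z2 z3 x H).
    apply continuity_pt_filterlim. apply (ex_derive_continuous (fun x => exp_ratio z1 z2 z3 al x * kb_D z1 z2 z3 x)).
    auto_derive. split; [eexists; exact D1|]. split; [eexists; exact D2 | exact I].
  - assert (Hc1 := exp_ratio_pos z1 z2 z3 al c H). rewrite ED in Hc.
    assert (HD := kb_D_pos z1 z2 z3 0 H). unfold exp_ratio in Hc at 1 2. rewrite ER in Hc.
    assert (HR := theta_ratio_pos z1 z2 z3 al 0 H).
    rewrite Rmult_0_r, Rmult_0_r, exp_0, Rminus_0_r in Hc.
    assert (Hr : 0 < 2 * bcoef z1 z2 z3 * exp_ratio z1 z2 z3 al c * T) by (mul_pos).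
    assert (HRD : 0 < theta_ratio z1 z2 z3 al 0 * kb_D z1 z2 z3 0) by (apply Rmult_lt_0_compat; lra).
    assert (He : 1 < exp (2 * (s0 z1 z2 z3 al * T))).
    { apply Rnot_le_lt; intros L. nra. }
    rewrite <- exp_0 in He. apply exp_lt_inv in He.
    apply Rmult_lt_reg_r with T; lra.
Qed.

Lemma phi_opp z1 z2 z3 x : ordered z1 z2 z3 -> phi z1 z2 z3 (- x) = phi z1 z2 z3 x.
Proof.
  intros H. assert (Hk := kmod_range _ _ _ H). unfold phi.
  replace (nuc z1 z3 * - x) with (- (nuc z1 z3 * x)) by ring. rewrite sn_opp by auto.
  now replace ((- sn (kmod z1 z2 z3) (nuc z1 z3 * x)) ^ 2) with (sn (kmod z1 z2 z3) (nuc z1 z3 * x) ^ 2) by ring.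
Qed.

Lemma dphi_opp z1 z2 z3 x : ordered z1 z2 z3 -> dphi z1 z2 z3 (- x) = - dphi z1 z2 z3 x.
Proof.
  intros H. assert (Hk := kmod_range _ _ _ H). unfold dphi.
  replace (nuc z1 z3 * - x) with (- (nuc z1 z3 * x)) by ring. rewrite sn_opp, cn_opp, dn_opp by auto.
  replace ((- sn (kmod z1 z2 z3) (nuc z1 z3 * x)) ^ 2) with (sn (kmod z1 z2 z3) (nuc z1 z3 * x) ^ 2) by ring.
  unfold Rdiv; ring.
Qed.

(** [phi_miura] is applied at minus the shifted point, where phi is even, phi' is odd, and the
    argument of sn is the negative of the original one. *)
Lemma phi_miura_shift z1 z2 z3 al x : admissible z1 z2 z3 al ->
  phi z1 z2 z3 x ^ 2 - dphi z1 z2 z3 x =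
  phi z1 z2 z3 (x - 2 * al / nuc z1 z3) ^ 2 + dphi z1 z2 z3 (x - 2 * al / nuc z1 z3).
Proof.
  intros Hadm. assert (H := proj1 Hadm). assert (Hk := kmod_range _ _ _ H). assert (Hn := nuc_pos _ _ _ H).
  set (y := x - 2 * al / nuc z1 z3).
  rewrite <- (phi_opp z1 z2 z3 y H). replace (dphi z1 z2 z3 y) with (- dphi z1 z2 z3 (- y)) by (rewrite dphi_opp by auto; ring).
  fold (phi z1 z2 z3 (- y) ^ 2 - dphi z1 z2 z3 (- y)).
  rewrite !(phi_miura _ _ _ al) by auto.
  replace (nuc z1 z3 * - y - al) with (- (nuc z1 z3 * x - al)) by (unfold y; field; lra).
  rewrite sn_opp by auto. ring.
Qed.

(** The shift sends al / nu to - al / nu, where phi takes the same value; this supplies the initial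
    value for the next identity. *)
Lemma kb_D_alpha z1 z2 z3 al : admissible z1 z2 z3 al ->
  kb_D z1 z2 z3 (al / nuc z1 z3) * phi z1 z2 z3 (al / nuc z1 z3) = bcoef z1 z2 z3.
Proof.
  intros Hadm. assert (Hs2 := sn_alpha_sq _ _ _ _ Hadm). assert (Hcd := cndn_alpha _ _ _ _ Hadm).
  assert (H := proj1 Hadm). assert (Hn := nuc_pos _ _ _ H).
  unfold kb_D, dphi, phi, phi_den. replace (nuc z1 z3 * (al / nuc z1 z3)) with al by (field; lra).
  set (k := kmod z1 z2 z3) in *. set (nu := nuc z1 z3) in *.
  replace (4 * (z1 + z3) * (z2 + z3) * (z1 - z2) * nu * (sn k al * cn k al * dn k al)) with
    (4 * (z1 + z3) * (z2 + z3) * (z1 - z2) * sn k al * (nu * (cn k al * dn k al))) by ring.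
  rewrite Hcd.
  replace (4 * (z1 + z3) * (z2 + z3) * (z1 - z2) * sn k al * ((z2 + z3) * sn k al)) with
    (4 * (z1 + z3) * (z2 + z3) ^ 2 * (z1 - z2) * sn k al ^ 2) by ring.
  rewrite Hs2. unfold ccoef, bcoef. destruct H as [H3 [H2 H1]].
  field. repeat split; nra.
Qed.

(* [Q = D (phi + phi(. - 2 al / nu)) - 2 b] satisfies [Q' = - (phi + phi(. - 2 al / nu)) Q] and vanishes at
   [al / nu]. *)
Lemma kb_D_phi_sum z1 z2 z3 al x : admissible z1 z2 z3 al ->
  kb_D z1 z2 z3 x * (phi z1 z2 z3 x + phi z1 z2 z3 (x - 2 * al / nuc z1 z3)) = 2 * bcoef z1 z2 z3.
Proof.
  intros Hadm. assert (H := proj1 Hadm). assert (Hn := nuc_pos _ _ _ H).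
  set (h := 2 * al / nuc z1 z3).
  set (Q := fun x => kb_D z1 z2 z3 x * (phi z1 z2 z3 x + phi z1 z2 z3 (x - h)) - 2 * bcoef z1 z2 z3).
  (* The product of the two integrating factors has logarithmic derivative 2 (phi + phi (. - h)),
     which cancels that of Q^2. Constancy of G replaces a uniqueness theorem for the linear
     equation. *)
  set (G := fun x => Q x ^ 2 * (exp_ratio z1 z2 z3 al x * exp_ratio z1 z2 z3 al (x - h))).
  assert (HG : forall x, is_derive G x 0).
  { intros y. unfold G, Q.
    assert (D1 := is_derive_phi z1 z2 z3 y H). assert (D2 := is_derive_phi z1 z2 z3 (y - h) H).
    assert (D3 := is_derive_kb_D z1 z2 z3 y H).
    assert (D4 := is_derive_exp_ratio z1 z2 z3 al y Hadm). assert (D5 := is_derive_exp_ratio z1 z2 z3 al (y - h) Hadm).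
    assert (M := phi_miura_shift z1 z2 z3 al y Hadm). fold h in M.
    auto_derive.
    - repeat split; eexists; eassumption.
    - change (fun y => phi z1 z2 z3 y) with (phi z1 z2 z3). change (fun y => kb_D z1 z2 z3 y) with (kb_D z1 z2 z3).
      change (fun y => exp_ratio z1 z2 z3 al y) with (exp_ratio z1 z2 z3 al).
      unfold Rminus in *.
      rewrite (is_derive_unique _ _ _ D1), (is_derive_unique _ _ _ D2), (is_derive_unique _ _ _ D3),
        (is_derive_unique _ _ _ D4), (is_derive_unique _ _ _ D5).
      replace (dphi z1 z2 z3 (y + - h)) with (phi z1 z2 z3 y ^ 2 - dphi z1 z2 z3 y - phi z1 z2 z3 (y + - h) ^ 2) by lra.
      ring. }
  assert (E := eq_of_Derive_0 G HG x (al / nuc z1 z3)).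
  assert (HQ : Q (al / nuc z1 z3) = 0).
  { unfold Q. replace (al / nuc z1 z3 - h) with (- (al / nuc z1 z3)) by (unfold h; field; lra).
    rewrite phi_opp by auto. assert (HD := kb_D_alpha _ _ _ _ Hadm). lra. }
  unfold G in E. rewrite HQ in E.
  replace (0 ^ 2 * _) with 0 in E by ring.
  assert (P1 := exp_ratio_pos z1 z2 z3 al x H). assert (P2 := exp_ratio_pos z1 z2 z3 al (x - h) H).
  assert (HQx : Q x = 0).
  { apply Rmult_integral in E. destruct E as [E|E]; [nra|].
    assert (0 < exp_ratio z1 z2 z3 al x * exp_ratio z1 z2 z3 al (x - h)) by nra. lra. }
  unfold Q in HQx. fold h. lra.
Qed.

(** * The solution, its derivatives and its limits *)

Definition kb_defect (b E D : R) : R := 2 * b * E / (4 + E * D).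

Lemma Derive_phi z1 z2 z3 x : ordered z1 z2 z3 -> Derive (phi z1 z2 z3) x = dphi z1 z2 z3 x.
Proof. intros H. apply is_derive_unique. now apply is_derive_phi. Qed.

Lemma Derive2_phi z1 z2 z3 x : ordered z1 z2 z3 -> Derive_n (phi z1 z2 z3) 2 x =
  2 * phi z1 z2 z3 x ^ 3 - ccoef z1 z2 z3 * phi z1 z2 z3 x + bcoef z1 z2 z3.
Proof.
  intros H. simpl Derive_n. rewrite (Derive_ext _ (dphi z1 z2 z3)).
  - apply is_derive_unique. now apply is_derive_dphi.
  - intros t. apply (Derive_phi z1 z2 z3 t H).
Qed.

Lemma kb_den_eq z1 z2 z3 al eta0 xi eta : admissible z1 z2 z3 al ->
  kb_den z1 z2 z3 al eta0 xi eta = Theta (kmod z1 z2 z3) (nuc z1 z3 * xi + al) ^ 2 *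
    (4 + exp (2 * (eta + eta0)) * theta_ratio z1 z2 z3 al xi * kb_D z1 z2 z3 xi).
Proof.
  intros Hadm. assert (H := proj1 Hadm). assert (Hk := kmod_range _ _ _ H).
  unfold kb_den. rewrite Derive_phi by auto. unfold theta_ratio, kb_D.
  assert (P := Theta_pos (kmod z1 z2 z3) (nuc z1 z3 * xi + al) Hk). field. lra.
Qed.

Lemma kb_factor_pos z1 z2 z3 al e xi : ordered z1 z2 z3 -> 0 < e ->
  0 < 4 + e * theta_ratio z1 z2 z3 al xi * kb_D z1 z2 z3 xi.
Proof.
  intros H He. assert (P1 := theta_ratio_pos z1 z2 z3 al xi H). assert (P2 := kb_D_pos z1 z2 z3 xi H).
  assert (0 < e * theta_ratio z1 z2 z3 al xi * kb_D z1 z2 z3 xi) by (mul_pos). lra.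
Qed.

Lemma kb_den_pos z1 z2 z3 al eta0 xi eta : admissible z1 z2 z3 al -> 0 < kb_den z1 z2 z3 al eta0 xi eta.
Proof.
  intros Hadm. assert (H := proj1 Hadm). assert (Hk := kmod_range _ _ _ H).
  rewrite kb_den_eq by auto. apply Rmult_lt_0_compat.
  - apply pow_lt. now apply Theta_pos.
  - apply kb_factor_pos; auto. apply exp_pos.
Qed.

(** By the equation of the profile, 2 phi phi' - phi'' - b = phi D - 2 b, so phi splits off from the
    quotient. *)
Lemma kbU_eq z1 z2 z3 al eta0 xi eta : admissible z1 z2 z3 al ->
  kbU z1 z2 z3 al eta0 xi eta = phi z1 z2 z3 xi
   - kb_defect (bcoef z1 z2 z3) (exp (2 * (eta + eta0)) * theta_ratio z1 z2 z3 al xi) (kb_D z1 z2 z3 xi).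
Proof.
  intros Hadm. assert (H := proj1 Hadm). assert (Hk := kmod_range _ _ _ H).
  unfold kbU. rewrite kb_den_eq by auto. unfold kb_num, kb_defect. rewrite Derive_phi, Derive2_phi by auto.
  assert (P := Theta_pos (kmod z1 z2 z3) (nuc z1 z3 * xi + al) Hk).
  assert (P2 := kb_factor_pos z1 z2 z3 al (exp (2 * (eta + eta0))) xi H (exp_pos _)).
  replace (4 * phi z1 z2 z3 xi * Theta (kmod z1 z2 z3) (nuc z1 z3 * xi + al) ^ 2 + _) with
   (Theta (kmod z1 z2 z3) (nuc z1 z3 * xi + al) ^ 2 *
     (4 * phi z1 z2 z3 xi + exp (2 * (eta + eta0)) * theta_ratio z1 z2 z3 al xi *
       (phi z1 z2 z3 xi * kb_D z1 z2 z3 xi - 2 * bcoef z1 z2 z3))).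
  - field. lra.
  - unfold theta_ratio, kb_D. field. lra.
Qed.

Lemma kb_defect_bounds b E D : 0 < b -> 0 < E -> 0 < D -> 0 <= kb_defect b E D <= 2 * b / D.
Proof.
  intros Hb HE HD. unfold kb_defect. assert (0 < E * D) by nra. split.
  - apply Rmult_le_pos; [nra | left; apply Rinv_0_lt_compat; lra].
  - apply Rmult_le_reg_r with ((4 + E * D) * D); [apply Rmult_lt_0_compat; lra|].
    replace (2 * b * E / (4 + E * D) * ((4 + E * D) * D)) with (2 * b * (E * D)) by (field; lra).
    replace (2 * b / D * ((4 + E * D) * D)) with (2 * b * (4 + E * D)) by (field; lra). nra.
Qed.

(** Since c_b = c - b / s0, the phase is eta = s0 xi - b t: apart from xi, time enters only through
    exp (-2 b t). *)
Lemma exp_eta z1 z2 z3 al eta0 x t : admissible z1 z2 z3 al ->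
  exp (2 * (eta_of z1 z2 z3 al x t + eta0)) * theta_ratio z1 z2 z3 al (xi_of z1 z2 z3 x t) =
  exp (2 * eta0 - 2 * bcoef z1 z2 z3 * t) * exp_ratio z1 z2 z3 al (xi_of z1 z2 z3 x t).
Proof.
  intros Hadm. assert (Hs := s0_pos _ _ _ _ Hadm).
  unfold exp_ratio. rewrite <- Rmult_assoc, <- exp_plus. do 2 f_equal.
  unfold eta_of, xi_of, cb. fold (s0 z1 z2 z3 al). fold (ccoef z1 z2 z3). fold (bcoef z1 z2 z3).
  field. lra.
Qed.

Definition kb_defect_xt (z1 z2 z3 al eta0 x t : R) : R :=
  kb_defect (bcoef z1 z2 z3) (exp (2 * eta0 - 2 * bcoef z1 z2 z3 * t) * exp_ratio z1 z2 z3 al (x + ccoef z1 z2 z3 * t))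
       (kb_D z1 z2 z3 (x + ccoef z1 z2 z3 * t)).

Lemma kbu_eq z1 z2 z3 al eta0 x t : admissible z1 z2 z3 al ->
  kbu z1 z2 z3 al eta0 x t = phi z1 z2 z3 (x + ccoef z1 z2 z3 * t) - kb_defect_xt z1 z2 z3 al eta0 x t.
Proof. intros Hadm. unfold kbu. rewrite kbU_eq, exp_eta by auto. reflexivity. Qed.

Lemma is_derive_kb_defect_x z1 z2 z3 al eta0 x t : admissible z1 z2 z3 al ->
  is_derive (fun x => kb_defect_xt z1 z2 z3 al eta0 x t) x
   (2 * phi z1 z2 z3 (x + ccoef z1 z2 z3 * t) * kb_defect_xt z1 z2 z3 al eta0 x t - kb_defect_xt z1 z2 z3 al eta0 x t ^ 2).
Proof.
  intros Hadm. assert (H := proj1 Hadm). unfold kb_defect_xt, kb_defect.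
  set (c := ccoef z1 z2 z3). set (b := bcoef z1 z2 z3). set (e := exp (2 * eta0 - 2 * b * t)).
  assert (He : 0 < e) by apply exp_pos.
  assert (D1 := is_derive_exp_ratio z1 z2 z3 al (x + c * t) Hadm). assert (D2 := is_derive_kb_D z1 z2 z3 (x + c * t) H).
  assert (PE := exp_ratio_pos z1 z2 z3 al (x + c * t) H). assert (PD := kb_D_pos z1 z2 z3 (x + c * t) H).
  assert (PW : 0 < e * exp_ratio z1 z2 z3 al (x + c * t) * kb_D z1 z2 z3 (x + c * t)) by (mul_pos).
  auto_derive.
  - repeat split; first [eexists; exact D1 | eexists; exact D2 | lra].
  - change (fun y => exp_ratio z1 z2 z3 al y) with (exp_ratio z1 z2 z3 al). change (fun y => kb_D z1 z2 z3 y) with (kb_D z1 z2 z3).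
    rewrite (is_derive_unique _ _ _ D1), (is_derive_unique _ _ _ D2). fold b. field. lra.
Qed.

Lemma is_derive_kb_defect_t z1 z2 z3 al eta0 x t : admissible z1 z2 z3 al ->
  let p := phi z1 z2 z3 (x + ccoef z1 z2 z3 * t) in
  let v := kb_defect_xt z1 z2 z3 al eta0 x t in
  is_derive (fun t => kb_defect_xt z1 z2 z3 al eta0 x t) t
   (v * (2 * ccoef z1 z2 z3 * p - 2 * bcoef z1 z2 z3 + 2 * dphi z1 z2 z3 (x + ccoef z1 z2 z3 * t) * v - 2 * p ^ 2 * v)).
Proof.
  intros Hadm p v. assert (H := proj1 Hadm). unfold v, p, kb_defect_xt, kb_defect.
  set (c := ccoef z1 z2 z3). set (b := bcoef z1 z2 z3).
  assert (He : 0 < exp (2 * eta0 - 2 * b * t)) by apply exp_pos.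
  assert (D1 := is_derive_exp_ratio z1 z2 z3 al (x + c * t) Hadm). assert (D2 := is_derive_kb_D z1 z2 z3 (x + c * t) H).
  assert (PE := exp_ratio_pos z1 z2 z3 al (x + c * t) H). assert (PD := kb_D_pos z1 z2 z3 (x + c * t) H).
  assert (PW : 0 < exp (2 * eta0 - 2 * b * t) * exp_ratio z1 z2 z3 al (x + c * t) * kb_D z1 z2 z3 (x + c * t)) by (mul_pos).
  auto_derive.
  - unfold Rminus in PW. repeat split; first [eexists; exact D1 | eexists; exact D2 | lra].
  - change (fun y => exp_ratio z1 z2 z3 al y) with (exp_ratio z1 z2 z3 al). change (fun y => kb_D z1 z2 z3 y) with (kb_D z1 z2 z3).
    rewrite (is_derive_unique _ _ _ D1), (is_derive_unique _ _ _ D2). fold b.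
    (* phi' is eliminated in favour of D, so that the identity is rational in phi, D and E. *)
    replace (dphi z1 z2 z3 (x + c * t)) with ((kb_D z1 z2 z3 (x + c * t) - c + 2 * phi z1 z2 z3 (x + c * t) ^ 2) / 2)
      by (unfold kb_D; fold c; field).
    unfold Rminus in *. field. lra.
Qed.

Lemma derive_n_chain (f f1 f2 f3 : R -> R) : (forall x, is_derive f x (f1 x)) ->
  (forall x, is_derive f1 x (f2 x)) -> (forall x, is_derive f2 x (f3 x)) -> forall x,
  ex_derive_n f 1 x /\ ex_derive_n f 2 x /\ ex_derive_n f 3 x /\ Derive f x = f1 x /\ Derive_n f 3 x = f3 x.
Proof.
  intros H1 H2 H3 x.
  assert (E1 : forall y, Derive f y = f1 y) by (intros; now apply is_derive_unique).
  assert (E2 : forall y, Derive (Derive f) y = f2 y).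
  { intros y. rewrite (Derive_ext _ f1) by exact E1. now apply is_derive_unique. }
  assert (E3 : forall y, Derive (Derive (Derive f)) y = f3 y).
  { intros y. rewrite (Derive_ext _ f2) by exact E2. now apply is_derive_unique. }
  repeat split.
  - exists (f1 x). apply H1.
  - simpl. apply ex_derive_ext with f1; [intros; symmetry; apply E1 | exists (f2 x); apply H2].
  - simpl. apply ex_derive_ext with f2; [intros; symmetry; apply E2 | exists (f3 x); apply H3].
  - apply E1.
  - apply E3.
Qed.

Lemma kbu_mKdV z1 z2 z3 al eta0 : admissible z1 z2 z3 al -> mKdV_solution (kbu z1 z2 z3 al eta0).
Proof.
  intros Hadm x t. assert (H := proj1 Hadm).
  set (c := ccoef z1 z2 z3). set (b := bcoef z1 z2 z3).
  set (p := fun y => phi z1 z2 z3 (y + c * t)). set (p1 := fun y => dphi z1 z2 z3 (y + c * t)).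
  set (v := fun y => kb_defect_xt z1 z2 z3 al eta0 y t).
  set (p2 := fun y => 2 * p y ^ 3 - c * p y + b).
  assert (Dp : forall y, is_derive p y (p1 y)).
  { intros y. assert (D1 := is_derive_phi z1 z2 z3 (y + c * t) H). unfold p. auto_derive.
    - eexists; exact D1.
    - change (fun y => phi z1 z2 z3 y) with (phi z1 z2 z3). rewrite (is_derive_unique _ _ _ D1). unfold p1; ring. }
  assert (Dp1 : forall y, is_derive p1 y (p2 y)).
  { intros y. assert (D1 := is_derive_dphi z1 z2 z3 (y + c * t) H). unfold p1. auto_derive.
    - eexists; exact D1.
    - change (fun y => dphi z1 z2 z3 y) with (dphi z1 z2 z3). rewrite (is_derive_unique _ _ _ D1). unfold p2, p; fold c b; ring. }
  assert (Dv : forall y, is_derive v y (2 * p y * v y - v y ^ 2)).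
  { intros y. apply is_derive_kb_defect_x, Hadm. }
  assert (Hu : forall y, p y - v y = kbu z1 z2 z3 al eta0 y t).
  { intros y. rewrite kbu_eq by auto. reflexivity. }
  (* The x-derivatives of u, with phi'' replaced by its cubic and v_x by 2 phi v - v^2 at each
     stage; they remain polynomials in phi, phi' and v. *)
  set (u1 := fun y => p1 y - 2 * p y * v y + v y ^ 2).
  set (u2 := fun y => p2 y - 2 * p1 y * v y + (2 * v y - 2 * p y) * (2 * p y * v y - v y ^ 2)).
  set (u3 := fun y => (6 * p y ^ 2 - c) * p1 y - 2 * p2 y * v y - 2 * p1 y * (2 * p y * v y - v y ^ 2)
     + (2 * (2 * p y * v y - v y ^ 2) - 2 * p1 y) * (2 * p y * v y - v y ^ 2)
     + (2 * v y - 2 * p y) * (2 * p1 y * v y + 2 * (p y - v y) * (2 * p y * v y - v y ^ 2))).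
  destruct (derive_n_chain (fun y => kbu z1 z2 z3 al eta0 y t) u1 u2 u3) with (x := x)
    as [X1 [X2 [X3 [X4 X5]]]].
  - intros y. apply is_derive_ext with (1 := Hu). assert (A := Dp y). assert (C := Dv y).
    auto_derive.
    + split; [eexists; exact A|]. split; [eexists; exact C | exact I].
    + change (fun y => p y) with p. change (fun y => v y) with v.
      rewrite (is_derive_unique _ _ _ A), (is_derive_unique _ _ _ C). unfold u1. ring.
  - intros y. assert (A := Dp y). assert (B := Dp1 y). assert (C := Dv y). unfold u1.
    auto_derive.
    + repeat split; eexists; eassumption.
    + change (fun y => p y) with p. change (fun y => v y) with v. change (fun y => p1 y) with p1.
      rewrite (is_derive_unique _ _ _ A), (is_derive_unique _ _ _ B), (is_derive_unique _ _ _ C). unfold u2. ring.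
  - intros y. assert (A := Dp y). assert (B := Dp1 y). assert (C := Dv y). unfold u2, p2.
    auto_derive.
    + repeat split; eexists; eassumption.
    + change (fun y => p y) with p. change (fun y => v y) with v. change (fun y => p1 y) with p1.
      rewrite (is_derive_unique _ _ _ A), (is_derive_unique _ _ _ B), (is_derive_unique _ _ _ C). unfold u3, p2. ring.
  - assert (Dt : is_derive (fun s => kbu z1 z2 z3 al eta0 x s) t
      (c * p1 x - v x * (2 * c * p x - 2 * b + 2 * p1 x * v x - 2 * p x ^ 2 * v x))).
    { set (w := fun s : R => kb_defect_xt z1 z2 z3 al eta0 x s).
      apply is_derive_ext with (fun s => phi z1 z2 z3 (x + c * s) - w s).
      - intros s. now rewrite kbu_eq.
      - assert (D1 := is_derive_phi z1 z2 z3 (x + c * t) H).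
        assert (D2 := is_derive_kb_defect_t z1 z2 z3 al eta0 x t Hadm). cbv zeta in D2. fold c b in D2.
        change (is_derive w t (v x * (2 * c * p x - 2 * b + 2 * p1 x * v x - 2 * p x ^ 2 * v x))) in D2.
        auto_derive.
        + split; [eexists; exact D1|]. split; [eexists; exact D2 | exact I].
        + change (fun y => phi z1 z2 z3 y) with (phi z1 z2 z3).
          change (fun y => w y) with w.
          rewrite (is_derive_unique _ _ _ D1), (is_derive_unique _ _ _ D2). unfold p1. ring. }
    split; [eexists; exact Dt|]. split; [exact X1|]. split; [exact X2|]. split; [exact X3|].
    assert (Et : Derive (fun s : R => kbu z1 z2 z3 al eta0 x s) t = _) by exact (is_derive_unique _ _ _ Dt).
    rewrite Et, X4, X5, <- Hu. unfold u1, u3, p2. ring.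
Qed.

Lemma is_lim_exp_affine_m (eta0 : R) : is_lim (fun eta => exp (2 * (eta + eta0))) m_infty 0.
Proof.
  apply is_lim_comp with m_infty.
  - apply is_lim_exp_m.
  - apply is_lim_spec. intros M. exists (M / 2 - eta0). intros x Hx. lra.
  - exists 0. intros y _. discriminate.
Qed.

Lemma is_lim_exp_affine_p (eta0 : R) : is_lim (fun eta => exp (- (2 * (eta + eta0)))) p_infty 0.
Proof.
  apply is_lim_comp with m_infty.
  - apply is_lim_exp_m.
  - apply is_lim_spec. intros M. exists (- M / 2 - eta0). intros x Hx. lra.
  - exists 0. intros y _. discriminate.
Qed.

Theorem theorem2 (z1 z2 z3 alpha eta0 : R) :
  0 < z3 -> z3 < z2 -> z2 < z1 ->
  0 < alpha < ellK (kmod z1 z2 z3) ->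
  sn (kmod z1 z2 z3) alpha = sqrt ((z1 - z3) / (z1 + z2)) ->
  (forall x t, kb_den z1 z2 z3 alpha eta0 (xi_of z1 z2 z3 x t)
                 (eta_of z1 z2 z3 alpha x t) <> 0) /\
  mKdV_solution (kbu z1 z2 z3 alpha eta0) /\
  (exists M, forall x t, Rabs (kbu z1 z2 z3 alpha eta0 x t) <= M) /\
  cb z1 z2 z3 alpha < ccoef z1 z2 z3 /\
  0 < s0 z1 z2 z3 alpha /\
  (forall xi, is_lim (fun eta => kbU z1 z2 z3 alpha eta0 xi eta) m_infty
                (phi z1 z2 z3 xi)) /\
  (forall xi, is_lim (fun eta => kbU z1 z2 z3 alpha eta0 xi eta) p_infty
                (- phi z1 z2 z3 (xi - 2 * alpha / nuc z1 z3))).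
Proof.
  intros H3 H2 H1 Ha Hs.
  assert (H : ordered z1 z2 z3) by (repeat split; assumption).
  assert (Hadm : admissible z1 z2 z3 alpha) by (repeat split; tauto).
  assert (Hs0 := s0_pos _ _ _ _ Hadm).
  assert (Hb : 0 < bcoef z1 z2 z3) by (unfold bcoef; mul_pos).
  split; [|split; [|split; [|split; [|split; [|split]]]]].
  - intros x t. apply Rgt_not_eq. now apply kb_den_pos.
  - now apply kbu_mKdV.
  - set (m := 16 * (z1 * z2 + z2 * z3 - z1 * z3) ^ 2 / (2 * ccoef z1 z2 z3)).
    assert (Hm : 0 < m).
    { unfold m, ccoef. apply Rdiv_lt_0_compat; [|nra]. assert (0 < z1 * z2 + z2 * z3 - z1 * z3) by nra. nra. }
    (* phi lies in [- z1, z1] and 0 <= v <= 2 b / D <= 2 b / m. *)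
    exists (z1 + 2 * bcoef z1 z2 z3 / m). intros x t.
    unfold kbu. rewrite kbU_eq by auto. set (xi := xi_of z1 z2 z3 x t).
    assert (Hp := phi_bounds z1 z2 z3 xi H). assert (HD := kb_D_lower z1 z2 z3 xi H). fold m in HD.
    assert (Hv := kb_defect_bounds (bcoef z1 z2 z3) (exp (2 * (eta_of z1 z2 z3 alpha x t + eta0)) * theta_ratio z1 z2 z3 alpha xi)
      (kb_D z1 z2 z3 xi) Hb (Rmult_lt_0_compat _ _ (exp_pos _) (theta_ratio_pos _ _ _ _ _ H)) ltac:(lra)).
    set (v := kb_defect _ _ _) in *.
    assert (2 * bcoef z1 z2 z3 / kb_D z1 z2 z3 xi <= 2 * bcoef z1 z2 z3 / m).
    { apply Rmult_le_compat_l; [lra|]. apply Rinv_le_contravar; lra. }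
    apply Rabs_le. lra.
  - unfold cb. fold (s0 z1 z2 z3 alpha). fold (ccoef z1 z2 z3). fold (bcoef z1 z2 z3).
    assert (0 < bcoef z1 z2 z3 / s0 z1 z2 z3 alpha) by (apply Rdiv_lt_0_compat; lra). lra.
  - exact Hs0.
  - intros xi. assert (PD := kb_D_pos z1 z2 z3 xi H). assert (PR := theta_ratio_pos z1 z2 z3 alpha xi H).
    (* The solution as a function of e = exp (2 (eta + eta0)), which is continuous at e = 0. *)
    set (g := fun e => phi z1 z2 z3 xi - kb_defect (bcoef z1 z2 z3) (e * theta_ratio z1 z2 z3 alpha xi) (kb_D z1 z2 z3 xi)).
    apply is_lim_ext with (fun eta => g (exp (2 * (eta + eta0)))).
    { intros eta. unfold g. now rewrite kbU_eq. }
    replace (phi z1 z2 z3 xi) with (g 0) by (unfold g, kb_defect; field; lra).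
    apply (is_lim_comp_continuous (fun eta => exp (2 * (eta + eta0))) g m_infty 0).
    + apply is_lim_exp_affine_m.
    + apply (ex_derive_continuous g). unfold g, kb_defect. auto_derive. lra.
  - intros xi. assert (PD := kb_D_pos z1 z2 z3 xi H). assert (PR := theta_ratio_pos z1 z2 z3 alpha xi H).
    (* Numerator and denominator of v are divided by the exponential, so the variable e is now its
       inverse, again tending to 0; g 0 = phi - 2 b / D. *)
    set (g := fun e => phi z1 z2 z3 xi - 2 * bcoef z1 z2 z3 * theta_ratio z1 z2 z3 alpha xi
                / (4 * e + theta_ratio z1 z2 z3 alpha xi * kb_D z1 z2 z3 xi)).
    assert (PRD : 0 < theta_ratio z1 z2 z3 alpha xi * kb_D z1 z2 z3 xi) by (apply Rmult_lt_0_compat; lra).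
    apply is_lim_ext with (fun eta => g (exp (- (2 * (eta + eta0))))).
    { intros eta. unfold g. rewrite kbU_eq by auto. unfold kb_defect.
      assert (He := exp_pos (2 * (eta + eta0))). rewrite exp_Ropp.
      assert (0 < exp (2 * (eta + eta0)) * (theta_ratio z1 z2 z3 alpha xi * kb_D z1 z2 z3 xi)) by (apply Rmult_lt_0_compat; lra).
      field. lra. }
    assert (E := kb_D_phi_sum z1 z2 z3 alpha xi Hadm).
    replace (- phi z1 z2 z3 (xi - 2 * alpha / nuc z1 z3)) with (g 0).
    2:{ unfold g. replace (2 * bcoef z1 z2 z3) with
          (kb_D z1 z2 z3 xi * (phi z1 z2 z3 xi + phi z1 z2 z3 (xi - 2 * alpha / nuc z1 z3))) by exact E.
        field. lra. }
    apply (is_lim_comp_continuous (fun eta => exp (- (2 * (eta + eta0)))) g p_infty 0).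
    + apply is_lim_exp_affine_p.
    + apply (ex_derive_continuous g). unfold g. auto_derive. lra.
Qed.
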